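(* Let $D$ be a domain in $\mathbb C^n$, $p\in\partial D$, and $U$ an open neighborhood of $p$ such that $D\cap U$ is convex and enjoys the visibility property. Then for any neighborhood $V$ of $p$ with $V\subset\subset U$, there exists $C>0$ such that for all $z,w\in D\cap V$, $$k_{D\cap U}(z,w)\le k_D(z,w)+C.$$
   Context: For a domain $D\subset\mathbb C^n$, $k_D$ denotes the Kobayashi (pseudo)distance (the integrated form of the Kobayashi–Royden metric). A domain is complete hyperbolic if its Kobayashi pseudodistance is a complete distance. A geodesic is a curve $\sigma:I\to D$ on an interval $I\subset\mathbb R$ with $k_D(\sigma(s),\sigma(t))=|s-t|$ for all $s,t\in I$. Visibility: let $G$ be a complete hyperbolic domain and $p,q\in\partial G$, $p\ne q$. The pair $\{p,q\}$ has visible geodesics if there are neighborhoods $U,V$ of $p,q$ respectively with $\overline U\cap\overline V=\emptyset$ and a compact set $K\subset G$ such that every geodesic $\gamma:[0,L]\to G$ (for $k_G$) with $\gamma(0)\in U$, $\gamma(L)\in V$ satisfies $\gamma([0,L])\cap K\ne\emptyset$. $G$ has the visibility property if every pair of distinct boundary points has visible geodesics. *)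

(* Defs.v *)
From HB Require Import structures.
From mathcomp Require Import all_boot all_order all_algebra.
From mathcomp Require Import complex.
From mathcomp Require Import all_classical all_reals all_analysis.

Set Implicit Arguments.
Unset Strict Implicit.
Unset Printing Implicit Defensive.

Import Order.TTheory GRing.Theory Num.Theory numFieldNormedType.Exports.

Local Open Scope classical_set_scope.
Local Open Scope ring_scope.
Local Open Scope complex_scope.

(* R[i] packaged as a numClosedFieldType: this is what gives it (and hence
   'rV[cplx R]_n, our C^n) the norm, topology and complex differentiation of
   MathComp-Analysis, which are not inferred on the bare type R[i]. *)
Definition cplx (R : realType) : numClosedFieldType := R[i].

Section Kobayashi.
Context {R : realType} {n : nat}.

Local Notation Cn := 'rV[cplx R]_n.

Implicit Types (D G A : set Cn) (p q z w v : Cn) (g : R -> Cn).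

Definition is_domain D := [/\ open D, connected D & D !=set0].

Definition boundary A : set Cn := closure A `\` interior A.

Definition convexC A :=
  forall z w (t : R), A z -> A w -> 0 <= t -> t <= 1 ->
    A (t%:C *: z + (1 - t)%:C *: w).

(* Holomorphic maps from the open unit disc into D; derivability is over the
   field cplx R, i.e. it is complex differentiability. *)
Definition holomorphic_disc D (f : cplx R -> Cn) :=
  forall x : cplx R, `|x| < 1 -> derivable f x 1 /\ D (f x).

(* Kobayashi-Royden metric, normalised so that it is |v| at the centre of the
   unit disc. *)
Definition kobayashi_royden D z v : \bar R :=
  ereal_inf [set a%:E | a in [set a : R | 0 < a /\
    exists f : cplx R -> Cn,
      [/\ holomorphic_disc D f, f 0 = z & a%:C *: 'D_1 f 0 = v]]].

(* Difference quotients in the real variable. *)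
Definition diff_quot g (t s : R) : Cn := ((s - t)^-1)%:C *: (g s - g t).

(* g is C^1 on the closed interval [a, b], with one-sided derivatives at the
   endpoints. *)
Definition C1_on (a b : R) g :=
  exists dg : R -> Cn,
    {within `[a, b], continuous dg} /\
    forall t, t \in `[a, b] ->
      diff_quot g t s @[s --> within `[a, b] t^'] --> dg t.

Definition piecewise_C1 (a b : R) g :=
  exists s : seq R, itv_partition a b s /\
    forall i, (i < size s)%N -> C1_on (nth b (a :: s) i) (nth b s i) g.

(* Meaningful off the finitely many endpoints and break points of a piecewise
   C^1 curve; these do not contribute to the integral below. *)
Definition velocity g (t : R) : Cn := lim (diff_quot g t s @[s --> t^']).

Definition kobayashi_length D g : \bar R :=
  (\int[lebesgue_measure]_(t in `[0%R, 1%R])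
     kobayashi_royden D (g t) (velocity g t))%E.

Definition curve_in D z w g :=
  [/\ piecewise_C1 0 1 g, (forall t, t \in `[0, 1] -> D (g t)),
      g 0 = z & g 1 = w].

Definition kobayashi D z w : \bar R :=
  ereal_inf [set kobayashi_length D g | g in curve_in D z w].

Definition kobayashi_cauchy D (u : nat -> Cn) :=
  forall e : R, 0 < e -> exists N : nat, forall i j : nat,
    (N <= i)%N -> (N <= j)%N -> (kobayashi D (u i) (u j) < e%:E)%E.

(* The Kobayashi pseudodistance separates points and is complete. *)
Definition complete_hyperbolic D :=
  [/\ is_domain D,
      (forall z w, D z -> D w -> kobayashi D z w = 0%E -> z = w) &
      forall u : nat -> Cn, (forall k, D (u k)) -> kobayashi_cauchy D u ->
        exists2 x, D x & kobayashi D (u k) x @[k --> \oo] --> 0%E].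

Definition geodesic D (I : set R) (sigma : R -> Cn) :=
  [/\ is_interval I, {within I, continuous sigma},
      (forall t, I t -> D (sigma t)) &
      forall s t, I s -> I t ->
        kobayashi D (sigma s) (sigma t) = `|s - t|%:E].

Definition visible_geodesics G p q :=
  exists U V K : set Cn,
    [/\ nbhs p U, nbhs q V, closure U `&` closure V = set0,
        compact K /\ K `<=` G &
        forall (L : R) (gamma : R -> Cn), 0 <= L ->
          geodesic G `[0, L] gamma -> U (gamma 0) -> V (gamma L) ->
          (gamma @` `[0, L]) `&` K !=set0].

Definition visibility_property G :=
  complete_hyperbolic G /\
  forall p q, boundary G p -> boundary G q -> p <> q -> visible_geodesics G p q.

End Kobayashi.

(* Main.v *)
(* Write G for the intersection of D and U, k for its Kobayashi distance, o for
   a base point and h(x) = k(x, o).  Visibility has two consequences.  The closure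
   of G contains no affine complex disc through a boundary point; by convexity this
   yields entire peak functions at the boundary points of G in U, and a maximum
   principle then bounds the derivatives at 0 of the discs of D centred near such
   a point.  Moreover h(x) <= k(x, y) + C for x near the closure of V and y away
   from it, because a geodesic from x to y (Hopf-Rinow) meets a compact set.

   The derivative bound makes the Kobayashi-Royden metrics of D and G comparable
   near the boundary.  Following a disc of D centred at x until it leaves G, and
   using the second consequence of visibility, one improves this to
   kappa_G <= (1 + C / (1 + h(x))^2) kappa_D.
   Finally take a curve that is minimal for k_D up to 1.  Along a piece where the
   last estimate holds, h grows at least like half of the k_D-length measured from
   the point where h is minimal, so that the error term has a bounded integral and
   the k_G-length exceeds the k_D-length by a constant only.  Where the curve
   leaves that region, either h is bounded or the curve is away from V. *)

(* Nothing global is known about D: it need not be hyperbolic, so normal families of its discs are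
   out of reach, and every bound on such a disc must come from the boundary inside U. Entire peak
   functions make sense on all of C^n but are controlled only near the boundary point, while a disc
   may run far away. The remedy is a gluing: three functions, each used on one range of f - f(0),
   are arranged so that their maximum obeys the maximum principle on the whole disc. A high power of
   the peak function creates the gap that allows the passage to a constant far away.

   A bounded ratio of the two metrics would compare distances only up to a factor. An additive
   constant needs a ratio 1 + error with the error integrable in arc length; the error found is
   exponentially small in h, and the inverse square is a convenient integrable majorant. The growth
   of h comes from k_D <= k_G: an arc of an almost minimal curve has length at most k_G + 1, and the
   triangle inequality through o bounds k_G by values of h. Minimal curves for k_D may fail to
   exist, whence the tolerance 1. *)
Require Import Defs.
From HB Require Import structures.
From mathcomp Require Import all_boot all_order all_algebra.
From mathcomp Require Import complex.
From mathcomp Require Import all_classical all_reals all_analysis measurable_realfun.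
From mathcomp Require Import ring lra.

Set Implicit Arguments.
Unset Strict Implicit.
Unset Printing Implicit Defensive.

Import Order.TTheory GRing.Theory Num.Theory numFieldNormedType.Exports.

Local Open Scope classical_set_scope.
Local Open Scope ring_scope.
Local Open Scope complex_scope.

(** * Real-valued norms on complex spaces *)

Section RealPoints.
Context {R : realType}.
Implicit Types (a b d t : R).

Lemma pos_min a b : 0 < a -> 0 < b -> exists m : R, [/\ 0 < m, m <= a & m <= b].
Proof.
by move=> a0 b0; exists (Num.min a b); rewrite lt_min a0 b0 !ge_min !lexx orbT.
Qed.

Lemma left_near a t d : a < t -> 0 < d -> exists s, [/\ a <= s, s < t & `|s - t| < d].
Proof.
move=> at_ d0; have ta : 0 < t - a by rewrite subr_gt0.
have [m [m0 md ma]] := pos_min d0 ta; exists (t - m / 2).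
rewrite addrAC subrr add0r normrN ger0_norm; last by lra.
by split; lra.
Qed.

End RealPoints.

Section RealToComplex.
Context {R : realType}.
Implicit Types (a b : R).

Lemma RtoCD a b : (a + b)%:C = a%:C + b%:C :> cplx R.
Proof. exact: rmorphD. Qed.

Lemma RtoCN a : (- a)%:C = - a%:C :> cplx R.
Proof. exact: rmorphN. Qed.

Lemma RtoCB a b : (a - b)%:C = a%:C - b%:C :> cplx R.
Proof. exact: rmorphB. Qed.

Lemma RtoCM a b : (a * b)%:C = a%:C * b%:C :> cplx R.
Proof. exact: rmorphM. Qed.

Lemma RtoCV a : (a^-1)%:C = (a%:C)^-1 :> cplx R.
Proof. exact: fmorphV. Qed.

Lemma RtoCX a k : (a ^+ k)%:C = a%:C ^+ k :> cplx R.
Proof. exact: rmorphXn. Qed.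

Lemma RtoC_inj : injective (fun a => a%:C : cplx R).
Proof. exact: complexI. Qed.

Lemma RtoC_eq0 a : (a%:C == 0 :> cplx R) = (a == 0).
Proof. by rewrite -(inj_eq (@complexI R)). Qed.

End RealToComplex.

Section RealNorm.
Context {R : realType} {V : normedModType (cplx R)}.
Implicit Types (x y : V).

(* Norms over [cplx R] take their values in [cplx R]; [nm] is the same norm with
   values in [R]. *)
Definition nm x : R := complex.Re `|x|.

Lemma nmE x : `|x| = (nm x)%:C.
Proof. by rewrite /nm RRe_real // normr_real. Qed.

Lemma nm_ge0 x : 0 <= nm x.
Proof. by rewrite -ler0c -nmE. Qed.

Lemma nmD x y : nm (x + y) <= nm x + nm y.
Proof. by rewrite -lecR RtoCD -!nmE ler_normD. Qed.

Lemma nmN x : nm (- x) = nm x.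
Proof. by rewrite /nm normrN. Qed.

Lemma nmB x y : nm (x - y) = nm (y - x).
Proof. by rewrite -nmN opprB. Qed.

Lemma nm0 : nm 0 = 0.
Proof. by rewrite /nm normr0. Qed.

Lemma nm_eq0 x : (nm x == 0) = (x == 0).
Proof. by rewrite -[in RHS]normr_eq0 nmE RtoC_eq0. Qed.

Lemma nm_gt0 x : (0 < nm x) = (x != 0).
Proof. by rewrite lt_def nm_eq0 nm_ge0 andbT. Qed.

Lemma nmZR (a : R) x : nm (a%:C *: x) = `|a| * nm x.
Proof.
apply: RtoC_inj; rewrite RtoCM -!nmE normrZ; congr (_ * _).
by rewrite normc_def /= expr0n /= addr0 sqrtr_sqr.
Qed.

Lemma nm_triangle y x z : nm (x - z) <= nm (x - y) + nm (y - z).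
Proof. by rewrite -[x in nm (x - z)](subrK y) -addrA nmD. Qed.

Lemma nm_dist x y : `|nm x - nm y| <= nm (x - y).
Proof.
rewrite ler_norml lerNl opprB !lerBlDr; apply/andP; split.
  by rewrite nmB addrC -lerBlDl; have := nmD (y - x) x; rewrite subrK; lra.
by have := nmD (x - y) y; rewrite subrK.
Qed.

Lemma nbhs_nmP x (A : set V) :
  nbhs x A <-> exists2 e : R, 0 < e & forall y, nm (y - x) < e -> A y.
Proof.
split.
- move=> /nbhs_ballP[e /= e0 xA].
  have er : e = (complex.Re e)%:C by rewrite RRe_real // gtr0_real.
  exists (complex.Re e); first by rewrite -ltcR -er.
  by move=> y xy; apply: xA; rewrite -ball_normE /= distrC nmE er ltcR.
- case=> e e0 xA; apply/nbhs_ballP; exists e%:C => /=; first by rewrite ltcR.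
  by move=> y; rewrite -ball_normE /= distrC nmE ltcR; exact: xA.
Qed.

Lemma nbhs_nm x (e : R) : 0 < e -> nbhs x [set y | nm (y - x) < e].
Proof. by move=> e0; apply/nbhs_nmP; exists e. Qed.

Lemma cvg_nmP (T : Type) (F : set_system T) (FF : Filter F) (f : T -> V) x :
  f @ F --> x <-> forall e : R, 0 < e -> \forall t \near F, nm (f t - x) < e.
Proof.
split=> [fx e e0|fx A /nbhs_nmP[e e0 eA]].
  exact: (fx _ (nbhs_nm x e0)).
by have := fx _ e0; apply: (@filterS _ F) => t; exact: eA.
Qed.

Lemma nm_continuous : continuous nm.
Proof.
move=> x; apply/cvgrPdist_lt => e e0.
have := nbhs_nm x e0; apply: filterS => y /= yx.
by apply: le_lt_trans yx; rewrite nmB nm_dist.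
Qed.

Lemma nm_sub_continuous x : continuous (fun y => nm (y - x)).
Proof.
move=> y; apply/cvgrPdist_lt => e e0.
have := nbhs_nm y e0; apply: filterS => z /= zy.
apply: le_lt_trans (nm_dist _ _) _.
by rewrite opprB addrA subrK nmB.
Qed.

Lemma closure_nmP (A : set V) x :
  closure A x <-> forall e : R, 0 < e -> exists2 y, A y & nm (y - x) < e.
Proof.
split=> [Ax e e0|Ax B /nbhs_nmP[e e0 eB]].
  by have [y [Ay yx]] := Ax _ (nbhs_nm x e0); exists y.
by have [y Ay yx] := Ax _ e0; exists y; split => //; exact: eB.
Qed.

Lemma open_nmP (A : set V) :
  open A <-> forall x, A x -> exists2 e : R, 0 < e & forall y, nm (y - x) < e -> A y.
Proof.
rewrite openE; split=> H x Ax.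
  by apply/nbhs_nmP; exact: H.
by apply/nbhs_nmP; exact: H.
Qed.

Lemma closed_nm_ball x (e : R) : closed [set y | nm (y - x) <= e].
Proof.
move=> y /closure_nmP ycl /=; rewrite leNgt; apply/negP => ey.
have [|z /= ze zy] := ycl (nm (y - x) - e); first by rewrite subr_gt0.
by have := nm_triangle z y x; rewrite (nmB y z); lra.
Qed.

End RealNorm.

Section ComplexNumbers.
Context {R : realType}.
Implicit Types (z w : cplx R).

Lemma nm_normc z : nm z = Num.sqrt (complex.Re z ^+ 2 + complex.Im z ^+ 2).
Proof. by rewrite /nm normc_def. Qed.

Lemma nm_sqr z : nm z ^+ 2 = complex.Re z ^+ 2 + complex.Im z ^+ 2.
Proof. by rewrite nm_normc sqr_sqrtr // addr_ge0 // sqr_ge0. Qed.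

Lemma nmM z w : nm (z * w) = nm z * nm w.
Proof. by apply: RtoC_inj; rewrite RtoCM -!nmE normrM. Qed.

Lemma nmV z : nm z^-1 = (nm z)^-1.
Proof. by apply: RtoC_inj; rewrite RtoCV -!nmE normfV. Qed.

Lemma nmX z k : nm (z ^+ k) = nm z ^+ k.
Proof. by apply: RtoC_inj; rewrite RtoCX -!nmE normrX. Qed.

Lemma nm1 : nm (1 : cplx R) = 1.
Proof. by rewrite /nm normr1. Qed.

Lemma nmC (a : R) : nm (a%:C : cplx R) = `|a|.
Proof. by rewrite nm_normc /= expr0n addr0 sqrtr_sqr. Qed.

Lemma nmJ z : nm (z^* : cplx R)%C = nm z.
Proof. by rewrite /nm normcJ. Qed.

Lemma Re_le_nm z : `|complex.Re z| <= nm z.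
Proof. by rewrite -lecR -nmE normc_ge_Re. Qed.

Lemma Im_le_nm z : `|complex.Im z| <= nm z.
Proof.
rewrite -(@ler_pXn2r _ 2) ?nnegrE ?nm_ge0 ?normr_ge0 // nm_sqr real_normK ?num_real //.
by rewrite lerDr sqr_ge0.
Qed.

Lemma nm_le_ReIm z : nm z <= `|complex.Re z| + `|complex.Im z|.
Proof.
rewrite -(@ler_pXn2r _ 2) ?nnegrE ?nm_ge0 ?addr_ge0 // nm_sqr sqrrD.
rewrite !real_normK ?num_real // lerD2r lerDl.
by rewrite mulrn_wge0 // mulr_ge0.
Qed.

Lemma ReB z w : complex.Re (z - w) = complex.Re z - complex.Re w.
Proof. by case: z => a b; case: w => c d. Qed.

Lemma ImB z w : complex.Im (z - w) = complex.Im z - complex.Im w.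
Proof. by case: z => a b; case: w => c d. Qed.

Lemma ReD z w : complex.Re (z + w) = complex.Re z + complex.Re w.
Proof. by case: z => a b; case: w => c d. Qed.

Lemma ImD z w : complex.Im (z + w) = complex.Im z + complex.Im w.
Proof. by case: z => a b; case: w => c d. Qed.

Lemma ReM z w : complex.Re (z * w) =
  complex.Re z * complex.Re w - complex.Im z * complex.Im w.
Proof. by case: z => a b; case: w => c d. Qed.

Lemma ImM z w : complex.Im (z * w) =
  complex.Re z * complex.Im w + complex.Im z * complex.Re w.
Proof. by case: z => a b; case: w => c d. Qed.

Lemma Re_continuous : continuous (@complex.Re R : cplx R -> R).
Proof.
move=> z; apply/(@cvgrPdist_lt _ _ _ (nbhs z)) => e e0.
have := nbhs_nm z e0; apply: filterS => y /= yx.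
by apply: le_lt_trans yx; rewrite nmB -ReB Re_le_nm.
Qed.

Lemma Im_continuous : continuous (@complex.Im R : cplx R -> R).
Proof.
move=> z; apply/(@cvgrPdist_lt _ _ _ (nbhs z)) => e e0.
have := nbhs_nm z e0; apply: filterS => y /= yx.
by apply: le_lt_trans yx; rewrite nmB -ImB Im_le_nm.
Qed.

Lemma cvg_complex (T : Type) (F : set_system T) (FF : Filter F)
    (u v : T -> R) (a b : R) :
  u @ F --> a -> v @ F --> b -> (fun t => u t +i* v t : cplx R) @ F --> (a +i* b : cplx R).
Proof.
move=> /cvgrPdist_lt ua /cvgrPdist_lt vb; apply/cvg_nmP => e e0.
have e2 : 0 < e / 2 by rewrite divr_gt0.
near=> t; apply: le_lt_trans (nm_le_ReIm _) _; rewrite ReB ImB /= [ltRHS](splitr e).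
by apply: ltrD; rewrite distrC; near: t; [exact: ua|exact: vb].
Unshelve. all: by end_near. Qed.

Lemma compact_nm_disc (r : R) : compact [set z : cplx R | nm z <= r].
Proof.
pose f (x : R * R) := x.1 +i* x.2 : cplx R.
have fc : continuous f.
  by move=> x; apply: cvg_complex; [exact: cvg_fst|exact: cvg_snd].
have K : compact (f @` (`[- r, r]%classic `*` `[- r, r]%classic)).
  apply: continuous_compact; first exact: continuous_subspaceT.
  by apply: compact_setX; exact: segment_compact.
apply: subclosed_compact K _.
  by have := @closed_nm_ball R (cplx R) 0 r; under eq_set do rewrite subr0.
move=> z /= zr; exists (complex.Re z, complex.Im z) => /=; last by case: z {zr}.
by rewrite !in_itv /= -!ler_norml; split;
  apply: le_trans zr; [exact: Re_le_nm|exact: Im_le_nm].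
Qed.

End ComplexNumbers.

Section ComplexSpace.
Context {R : realType} {n : nat}.
Local Notation Cn := 'rV[cplx R]_n.
Implicit Types (x y v : Cn).

Lemma nm_coord x i j : nm (x i j) <= nm x.
Proof.
rewrite -lecR -!nmE; suff : `|x i j| <= mx_norm x by [].
rewrite mx_normE -[leLHS]nngE num_le.
exact: (@le_bigmax _ _ _ _ (fun ij : 'I_1 * 'I_n => `|x ij.1 ij.2|%:nng) (i, j)).
Qed.

Lemma nm_coord_eq x : x != 0 -> exists j, nm x = nm (x ord0 j).
Proof.
move=> x0; have : mx_norm x != 0 by rewrite -[mx_norm x]/(`|x|) normr_eq0.
move=> /mx_norm_neq0[[i j] /= e]; exists j; move: e; rewrite (ord1 i) => e.
by apply: RtoC_inj; rewrite -!nmE.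
Qed.

Lemma compact_nm_ball x (r : R) : compact [set y : Cn | nm (y - x) <= r].
Proof.
pose M := nm x + r.
have K := @rV_compact (cplx R) n (fun=> [set z | nm z <= M])
  (fun=> @compact_nm_disc R M).
apply: subclosed_compact K _; first exact: closed_nm_ball.
move=> y /= yr i; apply: le_trans (nm_coord _ _ _) _.
by rewrite -[y](subrK x); apply: le_trans (nmD _ _) _; rewrite /M; lra.
Qed.

End ComplexSpace.

Section ComplexDerivative.
Context {R : realType} {V : normedModType (cplx R)}.
Implicit Types (f g : cplx R -> V) (a h : cplx R) (l : V).

(** A first-order expansion with real error terms. Multiplied through by [nm h] it includes h = 0,
    so it composes with affine changes of variable without punctured neighbourhoods. *)
Definition cdiff f a l := forall e : R, 0 < e -> exists2 d : R, 0 < d &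
  forall h, nm h < d -> nm (f (a + h) - f a - h *: l) <= e * nm h.

Lemma nmZ a l : nm (a *: l) = nm a * nm l.
Proof. by apply: RtoC_inj; rewrite RtoCM -!nmE normrZ. Qed.

Lemma is_derive_cdiff f a l : is_derive a 1 f l -> cdiff f a l.
Proof.
case=> /cvg_ex[l' dl'] dl e e0.
have ll' : l' = l.
  by rewrite -dl; apply/esym/cvg_lim; [exact: norm_hausdorff|exact: dl'].
move: dl'; rewrite ll' => /cvg_nmP /(_ _ e0).
rewrite near_withinE => /nbhs_nmP[d d0 H]; exists d => // h hd.
have [->|h0] := eqVneq h 0; first by rewrite addr0 scale0r !subrr !nm0 mulr0.
have := H h; rewrite subr0 => /(_ hd h0).
rewrite /= [h *: 1]mulr1 [h + a]addrC => /ltW H1.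
have -> : f (a + h) - f a - h *: l = h *: (h^-1 *: (f (a + h) - f a) - l).
  by rewrite scalerBr scalerA divff // scale1r.
by rewrite nmZ mulrC ler_wpM2r // nm_ge0.
Qed.

Lemma cdiff_is_derive f a l : cdiff f a l -> is_derive a 1 f l.
Proof.
move=> H.
have C : (fun h => h^-1 *: (f (h *: 1 + a) - f a)) @ 0^' --> l.
  apply/cvg_nmP => e e0; have e2 : 0 < e / 2 by rewrite divr_gt0.
  have [d d0 {}H] := H _ e2.
  rewrite near_withinE; apply/nbhs_nmP; exists d => // h; rewrite subr0 => hd h0.
  rewrite /= [h *: 1]mulr1 [h + a]addrC; have := H h hd.
  have -> : f (a + h) - f a - h *: l = h *: (h^-1 *: (f (a + h) - f a) - l).
    by rewrite scalerBr scalerA divff // scale1r.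
  rewrite nmZ mulrC ler_pM2r ?nm_gt0 // => /le_lt_trans; apply; lra.
split; first by apply/cvg_ex; exists l.
by apply/cvg_lim; [exact: norm_hausdorff|exact: C].
Qed.

Lemma derivable_cdiff f a : derivable f a 1 -> cdiff f a ('D_1 f a).
Proof. by move=> H; apply: is_derive_cdiff; exact: derivableP. Qed.

Lemma cdiff_derivable f a l : cdiff f a l -> derivable f a 1.
Proof. by move=> /cdiff_is_derive[]. Qed.

Lemma cdiff_derive f a l : cdiff f a l -> 'D_1 f a = l.
Proof. by move=> /cdiff_is_derive[]. Qed.

Lemma derivable_continuous f a : derivable f a 1 -> {for a, continuous f}.
Proof. by move/derivable1_diffP/differentiable_continuous. Qed.

Lemma cdiff_near f g a l : (\forall x \near a, f x = g x) -> cdiff f a l -> cdiff g a l.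
Proof.
move=> fg; have fga : f a = g a := nbhs_singleton fg; move/nbhs_nmP: fg => [d d0 fg] H e e0.
have [d' d'0 {}H] := H e e0; exists (Num.min d d'); first by rewrite lt_min d0.
move=> h; rewrite lt_min => /andP[hd hd'].
have <- : f (a + h) = g (a + h) by apply: fg; rewrite addrAC subrr add0r.
by rewrite -fga; exact: H.
Qed.

Lemma cdiff_affine f b (r : cplx R) a l : cdiff f (a + r * b) l ->
  cdiff (fun z => f (a + r * z)) b (r *: l).
Proof.
move=> H e e0.
have r1 : 0 < nm r + 1 by rewrite ltr_wpDl ?nm_ge0.
have [|d d0 {}H] := H (e / (nm r + 1)); first by rewrite divr_gt0.
exists (d / (nm r + 1)); first by rewrite divr_gt0.
move=> h; rewrite ltr_pdivlMr // => hd.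
have rh : nm (r * h) <= nm h * (nm r + 1).
  by rewrite nmM mulrC ler_wpM2l ?nm_ge0 // lerDl.
rewrite mulrDr addrA scalerA [h * r]mulrC.
apply: le_trans (H (r * h) (le_lt_trans rh hd)) _.
by rewrite -mulrA ler_pM2l // mulrC ler_pdivrMr.
Qed.

Lemma cdiff_rescale f (r b : cplx R) l : cdiff f (r * b) l ->
  cdiff (fun z => f (r * z)) b (r *: l).
Proof.
have -> : (fun z => f (r * z)) = (fun z => f (0 + r * z)).
  by apply/funext => z; rewrite add0r.
by move=> H; apply: cdiff_affine; rewrite add0r.
Qed.

Lemma derivable_rescale f (r b : cplx R) : derivable f (r * b) 1 ->
  derivable (fun z => f (r * z)) b 1.
Proof. by move=> /derivable_cdiff/cdiff_rescale/cdiff_derivable. Qed.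

Lemma cdiffD f g a l m : cdiff f a l -> cdiff g a m ->
  cdiff (fun z => f z + g z) a (l + m).
Proof.
move=> /cdiff_is_derive Hf /cdiff_is_derive Hg; exact: is_derive_cdiff.
Qed.

Lemma cdiff_cst l a : cdiff (fun=> l) a 0.
Proof. by apply: is_derive_cdiff; exact: is_derive_cst. Qed.

Lemma cdiff_scale l a : cdiff (fun z => z *: l) a l.
Proof.
move=> e e0; exists 1 => // h _.
by rewrite scalerDl [X in nm (X - _)]addrAC subrr add0r subrr nm0 mulr_ge0 ?nm_ge0 // ltW.
Qed.

End ComplexDerivative.

Section ComplexDerivativeRow.
Context {R : realType} {n : nat}.

Lemma cdiff_coord (f : cplx R -> 'rV[cplx R]_n) a l j :
  cdiff f a l -> cdiff (fun z => f z ord0 j : (cplx R)^o) a (l ord0 j).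
Proof.
move=> H e e0; have [d d0 {}H] := H e e0; exists d => // h hd.
apply: le_trans (H h hd); apply: le_trans (nm_coord _ ord0 j).
by rewrite !mxE.
Qed.

End ComplexDerivativeRow.

(** * Integrals of complex functions and the theorem of Goursat *)

Section SegmentIntegrals.
Context {R : realType}.
Local Notation mu := (@lebesgue_measure R).
Implicit Types (a b c M : R) (u v : R -> R) (f g : R -> cplx R).

Definition rint a b u : R := \int[mu]_(x in `[a, b]) u x.

Lemma itv_integrable a b u : {in `[a, b], continuous u} ->
  mu.-integrable `[a, b] (EFin \o u).
Proof.
move=> uc; apply: continuous_compact_integrable; first exact: segment_compact.
by apply: continuous_in_subspaceT => x /set_mem; exact: uc.
Qed.

Lemma rint_split a b c u : a <= b -> b <= c -> {in `[a, c], continuous u} ->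
  rint a c u = rint a b u + rint b c u.
Proof.
move=> ab bc uc; have iu := itv_integrable uc.
have := @Rintegral_itvB R u (BLeft a) (BRight c) b iu.
rewrite !bnd_simp => /(_ ab bc) H; apply/eqP; rewrite addrC -subr_eq; apply/eqP.
rewrite /rint H Rintegral_itv_obnd_cbnd //.
apply: integrableS iu => //; apply: subset_itvr; rewrite bnd_simp //.
Qed.

Lemma rint_bound a b c M u : a <= b -> {in `[a, b], continuous u} ->
  (forall x, x \in `[a, b] -> `|u x - c| <= M) ->
  `|rint a b u - (b - a) * c| <= M * (b - a).
Proof.
move=> ab uc uM; have iu := itv_integrable uc.
have cst (k : R) : mu.-integrable `[a, b] (EFin \o cst k).
  by apply: itv_integrable => x _; exact: cst_continuous.
have Ic (k : R) : \int[mu]_(x in `[a, b]) k = k * (b - a).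
  rewrite Rintegral_cst //= lebesgue_measure_itv /= lte_fin.
  have [ab'|] := ltP a b; first by rewrite -EFinD.
  by rewrite -[(b <= a)%R]/(b <= a) => ba; rewrite (le_anti (_ : a <= b <= a)) ?ab // subrr.
have H1 : \int[mu]_(x in `[a, b]) (c - M) <= rint a b u.
  apply: le_Rintegral => //=; first exact: cst.
  move=> x xab; have := uM x xab; rewrite ler_norml; lra.
have H2 : rint a b u <= \int[mu]_(x in `[a, b]) (c + M).
  apply: le_Rintegral => //=; first exact: cst.
  move=> x xab; have := uM x xab; rewrite ler_norml; lra.
by rewrite !Ic in H1 H2; rewrite ler_norml; lra.
Qed.

Lemma rintB a b u v : {in `[a, b], continuous u} -> {in `[a, b], continuous v} ->
  rint a b (fun x => u x - v x) = rint a b u - rint a b v.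
Proof. by move=> uc vc; rewrite /rint RintegralB //; exact: itv_integrable. Qed.

Lemma rintZ a b k u : {in `[a, b], continuous u} ->
  rint a b (fun x => k * u x) = k * rint a b u.
Proof. by move=> uc; rewrite /rint RintegralZl //; exact: itv_integrable. Qed.

Definition cint a b f : cplx R :=
  rint a b (fun x => complex.Re (f x)) +i* rint a b (fun x => complex.Im (f x)).

Definition ccont a b f := forall x, x \in `[a, b] -> f @ x --> f x.

Lemma ccont_Re a b f : ccont a b f -> {in `[a, b], continuous (fun x => complex.Re (f x))}.
Proof. by move=> fc x /fc H; apply: (cvg_comp _ _ H); exact: Re_continuous. Qed.

Lemma ccont_Im a b f : ccont a b f -> {in `[a, b], continuous (fun x => complex.Im (f x))}.
Proof. by move=> fc x /fc H; apply: (cvg_comp _ _ H); exact: Im_continuous. Qed.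

Lemma cint_split a b c f : a <= b -> b <= c -> ccont a c f ->
  cint a c f = cint a b f + cint b c f.
Proof.
move=> ab bc fc; rewrite /cint (rint_split ab bc (ccont_Re fc)).
by rewrite (rint_split ab bc (ccont_Im fc)).
Qed.

(** The factor 2 is the price of bounding real and imaginary parts separately. *)
Lemma cint_bound a b (c : cplx R) M f : a <= b -> ccont a b f ->
  (forall x, x \in `[a, b] -> nm (f x - c) <= M) ->
  nm (cint a b f - (b - a)%:C * c) <= 2 * M * (b - a).
Proof.
move=> ab fc fM; apply: le_trans (nm_le_ReIm _) _.
rewrite ReB ImB ReM ImM /= !mul0r subr0 addr0.
have H1 : `|rint a b (fun x => complex.Re (f x)) - (b - a) * complex.Re c| <= M * (b - a).
  apply: rint_bound ab (ccont_Re fc) _ => x xab; rewrite -ReB.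
  exact: le_trans (Re_le_nm _) (fM x xab).
have H2 : `|rint a b (fun x => complex.Im (f x)) - (b - a) * complex.Im c| <= M * (b - a).
  apply: rint_bound ab (ccont_Im fc) _ => x xab; rewrite -ImB.
  exact: le_trans (Im_le_nm _) (fM x xab).
by lra.
Qed.

Lemma cintB a b f g : ccont a b f -> ccont a b g ->
  cint a b (fun x => f x - g x) = cint a b f - cint a b g.
Proof.
move=> fc gc; rewrite /cint.
under [in X in X +i* _]eq_fun do rewrite ReB.
under [in X in _ +i* X]eq_fun do rewrite ImB.
by rewrite !rintB //; [exact: ccont_Im|exact: ccont_Im|exact: ccont_Re|exact: ccont_Re].
Qed.

(** Applied with c the conjugate of the central value, this turns the mean value identity into one
    between real integrals, where pointwise bounds suffice. *)
Lemma Re_cint_mul a b (c : cplx R) f : ccont a b f ->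
  complex.Re (c * cint a b f) = rint a b (fun x => complex.Re (c * f x)).
Proof.
move=> fc; under [in RHS]eq_fun do rewrite ReM.
have Rc := ccont_Re fc; have Ic := ccont_Im fc.
rewrite ReM /= rintB; first by rewrite !rintZ.
- by move=> x /Rc H; apply: cvgM => //; exact: cvg_cst.
- by move=> x /Ic H; apply: cvgM => //; exact: cvg_cst.
Qed.

End SegmentIntegrals.

Lemma nmD4 {R : realType} {V : normedModType (cplx R)} (a b c d : V) :
  nm (a + b + c + d) <= nm a + nm b + nm c + nm d.
Proof.
by apply: le_trans (nmD _ _) _; rewrite lerD2r; apply: le_trans (nmD _ _) _;
  rewrite lerD2r nmD.
Qed.

(** * Bisection of rectangles *)

Section Bisection.
Context {R : realType}.
Variables (J : R -> R -> R -> cplx R) (A B x0 y0 : R).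
Hypotheses (A0 : 0 <= A) (B0 : 0 <= B).

Let inside x y s := [&& x0 <= x, x + A * s <= x0 + A, y0 <= y & y + B * s <= y0 + B].

Hypothesis J_split : forall x y s, 0 < s -> inside x y (2 * s) ->
  J x y (2 * s) = J x y s + J (x + A * s) y s + J x (y + B * s) s +
                  J (x + A * s) (y + B * s) s.

Hypothesis J_local : forall X Y, x0 <= X <= x0 + A -> y0 <= Y <= y0 + B ->
  forall e : R, 0 < e -> exists2 d : R, 0 < d & forall x y s, 0 < s < d ->
    inside x y s -> x <= X <= x + A * s -> y <= Y <= y + B * s ->
    nm (J x y s) <= e * s ^+ 2.

Let sc (k : nat) : R := 2^-1 ^+ k.

Let sc_gt0 k : 0 < sc k.
Proof. by rewrite exprn_gt0 // invr_gt0. Qed.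

Let scS k : sc k = 2 * sc k.+1.
Proof. by rewrite /sc exprS mulrA divff // mul1r. Qed.

Let inv c k (p : R * R) :=
  inside p.1 p.2 (sc k) /\ c * sc k ^+ 2 <= nm (J p.1 p.2 (sc k)).

Let nested k (p q : R * R) :=
  [/\ p.1 <= q.1, q.1 + A * sc k.+1 <= p.1 + A * sc k,
      p.2 <= q.2 & q.2 + B * sc k.+1 <= p.2 + B * sc k].

Let step c k p : inv c k p -> exists q, inv c k.+1 q /\ nested k p q.
Proof.
case: p => x y [/= xy H]; have s0 := sc_gt0 k.+1; set s := sc k.+1 in s0 *.
have As : 0 <= A * s by rewrite mulr_ge0 // ltW.
have Bs : 0 <= B * s by rewrite mulr_ge0 // ltW.
have sE : sc k = 2 * s := scS k.
rewrite sE in xy H; have /and4P[h1 h2 h3 h4] := xy.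
have in1 : inside x y s by apply/and4P; split; lra.
have in2 : inside (x + A * s) y s by apply/and4P; split; lra.
have in3 : inside x (y + B * s) s by apply/and4P; split; lra.
have in4 : inside (x + A * s) (y + B * s) s by apply/and4P; split; lra.
rewrite (J_split s0 xy) in H.
have [H1|H1] := leP (c * s ^+ 2) (nm (J x y s)).
  by exists (x, y); rewrite /inv /nested /= sE -/s; do 2 split => //; lra.
have [H2|H2] := leP (c * s ^+ 2) (nm (J (x + A * s) y s)).
  by exists (x + A * s, y); rewrite /inv /nested /= sE -/s; do 2 split => //; lra.
have [H3|H3] := leP (c * s ^+ 2) (nm (J x (y + B * s) s)).
  by exists (x, y + B * s); rewrite /inv /nested /= sE -/s; do 2 split => //; lra.
have [H4|H4] := leP (c * s ^+ 2) (nm (J (x + A * s) (y + B * s) s)).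
  by exists (x + A * s, y + B * s); rewrite /inv /nested /= sE -/s; do 2 split => //; lra.
exfalso; move: H; apply/negP; rewrite -ltNge exprMn mulrCA.
apply: le_lt_trans (nmD4 _ _ _ _) _; rewrite expr2; lra.
Qed.

(** If c = |J| were positive, one quarter at each scale s would keep |J| >= c s^2. The nested
    rectangles shrink to a point (X, Y), where [J_local] with e = c / 2 contradicts this. *)
Lemma bisection_zero : J x0 y0 1 = 0.
Proof.
apply/eqP; rewrite -nm_eq0; apply: contraT => J0.
set c := nm (J x0 y0 1).
have c0 : 0 < c by rewrite lt_def J0 nm_ge0.
have start : inv c 0 (x0, y0).
  by rewrite /inv /inside /sc expr0 expr1n !mulr1 /= !lexx.
(* The default p is never reached: [uinv] propagates the invariant. *)
pose next k p := if pselect (inv c k p) is left h then projT1 (cid (step h)) else p.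
pose u := fix u k := if k is k'.+1 then next k' (u k') else (x0, y0).
have uinv k : inv c k (u k).
  elim: k => [//|k ih] /=; rewrite /next; case: pselect => // h.
  by case: (cid _) => q /= [].
have unest k : nested k (u k) (u k.+1).
  rewrite /= /next; case: pselect => [h|/(_ (uinv k))//].
  by case: (cid _) => q /= [].
have ndx : nondecreasing_seq (fun k => (u k).1).
  by apply/nondecreasing_seqP => k; case: (unest k).
have ndy : nondecreasing_seq (fun k => (u k).2).
  by apply/nondecreasing_seqP => k; case: (unest k).
have nix : nonincreasing_seq (fun k => (u k).1 + A * sc k).
  by apply/nonincreasing_seqP => k; case: (unest k).
have niy : nonincreasing_seq (fun k => (u k).2 + B * sc k).
  by apply/nonincreasing_seqP => k; case: (unest k).
have le_nest (T : R) (a b : nat -> R) : (forall k, a k <= b k) ->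
    nondecreasing_seq a -> nonincreasing_seq b ->
    exists l, forall k, a k <= l <= b k.
  move=> ab nda nib; exists (sup (range a)) => k; apply/andP; split.
    apply: ub_le_sup; last by exists k.
    exists (b 0%N) => _ [m _ <-]; apply: le_trans (ab m) _; exact: nib.
  apply: ge_sup; first by exists (a 0%N), 0%N.
  move=> _ [m _ <-]; apply: le_trans (nda _ _ (leq_maxl m k)) _.
  by apply: le_trans (ab _) _; apply: nib; exact: leq_maxr.
have [||//|X HX] := le_nest 0 (fun k => (u k).1) (fun k => (u k).1 + A * sc k).
- by move=> k; rewrite lerDl mulr_ge0 // ltW.
- by [].
have [||//|Y HY] := le_nest 0 (fun k => (u k).2) (fun k => (u k).2 + B * sc k).
- by move=> k; rewrite lerDl mulr_ge0 // ltW.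
- by [].
have hX : x0 <= X <= x0 + A by have := HX 0%N; rewrite /= /sc expr0 mulr1.
have hY : y0 <= Y <= y0 + B by have := HY 0%N; rewrite /= /sc expr0 mulr1.
have c2 : 0 < c / 2 by rewrite divr_gt0.
have [d d0 H] := J_local hX hY c2.
have [k kd] : exists k, sc k < d.
  have : sc @ \oo --> 0.
    by apply: cvg_expr; rewrite ger0_norm ?invr_ge0 // invf_lt1 // ltr1n.
  move/cvgrPdist_lt => /(_ _ d0)[N _ HN]; exists N.
  by have := HN N (leqnn N); rewrite sub0r normrN gtr0_norm.
have [h1 h2] := uinv k.
have := H _ _ (sc k) _ h1 (HX k) (HY k); rewrite sc_gt0 kd => /(_ isT).
have : 0 < sc k ^+ 2 by rewrite exprn_gt0.
by move: h2; nra.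
Qed.

End Bisection.

Section Goursat.
Context {R : realType}.
Variables (g : cplx R -> cplx R) (x0 y0 A B : R).
Hypotheses (A0 : 0 <= A) (B0 : 0 <= B).

Let in_rect (z : cplx R) :=
  x0 <= complex.Re z <= x0 + A /\ y0 <= complex.Im z <= y0 + B.

Hypothesis g_derivable : forall z, in_rect z -> derivable g z 1.

Let g_continuous z : in_rect z -> {for z, continuous g}.
Proof. by move=> /g_derivable /derivable_continuous. Qed.

Let ccont_hor a b c : x0 <= a -> b <= x0 + A -> y0 <= c <= y0 + B ->
  ccont a b (fun t => g (t +i* c)).
Proof.
move=> ha hb hc t; rewrite in_itv /= => /andP[at_ tb].
apply: (@continuous_comp _ _ _ (fun t : R => t +i* c : cplx R) g).
  by apply: cvg_complex; [exact: cvg_id|exact: cvg_cst].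
by apply: g_continuous; split => //=; lra.
Qed.

Let ccont_ver a b c : y0 <= a -> b <= y0 + B -> x0 <= c <= x0 + A ->
  ccont a b (fun t => g (c +i* t)).
Proof.
move=> ha hb hc t; rewrite in_itv /= => /andP[at_ tb].
apply: (@continuous_comp _ _ _ (fun t : R => c +i* t : cplx R) g).
  by apply: cvg_complex; [exact: cvg_cst|exact: cvg_id].
by apply: g_continuous; split => //=; lra.
Qed.

Definition boundary_int a b c d : cplx R :=
  cint a b (fun t => g (t +i* c)) - cint a b (fun t => g (t +i* d)) +
  'i%C * (cint c d (fun t => g (b +i* t)) - cint c d (fun t => g (a +i* t))).

Let boundary_int_split a m b c k d :
  x0 <= a -> a <= m -> m <= b -> b <= x0 + A ->
  y0 <= c -> c <= k -> k <= d -> d <= y0 + B ->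
  boundary_int a b c d = boundary_int a m c k + boundary_int m b c k +
    boundary_int a m k d + boundary_int m b k d.
Proof.
move=> h1 h2 h3 h4 h5 h6 h7 h8; rewrite /boundary_int.
rewrite (@cint_split _ a m b (fun t => g (t +i* c))) //; last by apply: ccont_hor; lra.
rewrite (@cint_split _ a m b (fun t => g (t +i* d))) //; last by apply: ccont_hor; lra.
rewrite (@cint_split _ c k d (fun t => g (b +i* t))) //; last by apply: ccont_ver; lra.
rewrite (@cint_split _ c k d (fun t => g (a +i* t))) //; last by apply: ccont_ver; lra.
ring.
Qed.

(** The boundary integral is additive under bisection. On a rectangle of scale s it sees only the
    first-order remainder of g, of size o(s), over a perimeter O(s). *)
Lemma goursat : boundary_int x0 (x0 + A) y0 (y0 + B) = 0.
Proof.
pose J x y s := boundary_int x (x + A * s) y (y + B * s).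
suff : J x0 y0 1 = 0 by rewrite /J !mulr1.
apply: (@bisection_zero _ J A B) => //.
- move=> x y s s0 /and4P[h1 h2 h3 h4]; rewrite /J.
  have As : 0 <= A * s by rewrite mulr_ge0 // ltW.
  have Bs : 0 <= B * s by rewrite mulr_ge0 // ltW.
  have -> : x + A * (2 * s) = x + A * s + A * s by ring.
  have -> : y + B * (2 * s) = y + B * s + B * s by ring.
  by apply: boundary_int_split; lra.
move=> X Y hX hY e e0.
pose D := A + B + 1; have D0 : 0 < D by rewrite /D; lra.
(* The remainder is at most e' D s at each point. A difference of opposite sides doubles it,
   [cint_bound] doubles it again, and the sides have total length (A + B) s <= D s; the sum is 4 e'
   D^2 s^2 = e s^2. *)
pose e' := e / (4 * D ^+ 2).
have e'0 : 0 < e' by rewrite divr_gt0 // mulr_gt0 // exprn_gt0.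
have [d d0 Hd] := derivable_cdiff (g_derivable (conj hX hY : in_rect (X +i* Y))) e'0.
set l := 'D_1 g _ in Hd.
exists (d / D); first by rewrite divr_gt0.
move=> x y s /andP[s0]; rewrite ltr_pdivlMr // => sd /and4P[h1 h2 h3 h4] hx hy.
have As : 0 <= A * s by rewrite mulr_ge0 // ltW.
have Bs : 0 <= B * s by rewrite mulr_ge0 // ltW.
pose er (z : cplx R) := g z - g (X +i* Y) - (z - (X +i* Y)) * l.
have err z : x <= complex.Re z <= x + A * s -> y <= complex.Im z <= y + B * s ->
    nm (er z) <= e' * (D * s).
  move=> zx zy; pose h : cplx R := z - (X +i* Y).
  have hD : nm h <= D * s.
    apply: le_trans (nm_le_ReIm _) _; rewrite ReB ImB /= /D !mulrDl.
    have : `|complex.Re z - X| <= A * s by rewrite ler_norml; lra.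
    have : `|complex.Im z - Y| <= B * s by rewrite ler_norml; lra.
    by lra.
  have hd : nm h < d by apply: le_lt_trans hD _; rewrite mulrC.
  have zE : (X +i* Y) + h = z by rewrite /h addrC subrK.
  by have := Hd h hd; rewrite zE => /le_trans; apply; rewrite ler_pM2l.
rewrite /J /boundary_int.
(* Opposite sides are subtracted before integrating, so the affine part of g leaves a constant: -i A
   s B s l from the horizontal pair and, after multiplication by i, i A s B s l from the vertical
   one. They cancel in the end. *)
have bot : nm (cint x (x + A * s) (fun t => g (t +i* y)) -
    cint x (x + A * s) (fun t => g (t +i* (y + B * s))) -
    (A * s)%:C * (- ('i%C * (B * s)%:C * l))) <= 2 * (2 * (e' * (D * s))) * (A * s).
  rewrite -cintB; [|by apply: ccont_hor; lra|by apply: ccont_hor; lra].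
  have -> : (A * s)%:C = (x + A * s - x)%:C :> cplx R by congr _%:C; ring.
  have -> : 2 * (2 * (e' * (D * s))) * (A * s) =
      2 * (2 * (e' * (D * s))) * (x + A * s - x) by ring.
  apply: cint_bound; first lra.
    move=> t tx; apply: cvgB; first by apply: (ccont_hor _ _ _ tx); lra.
    by apply: (ccont_hor _ _ _ tx); lra.
  move=> t; rewrite in_itv /= => tx.
  have -> : g (t +i* y) - g (t +i* (y + B * s)) - - ('i%C * (B * s)%:C * l) =
      er (t +i* y) - er (t +i* (y + B * s)).
    rewrite /er.
    have -> : t +i* (y + B * s) = t +i* y + 'i%C * (B * s)%:C :> cplx R by simpc.
    by ring.
  have -> : 2 * (e' * (D * s)) = e' * (D * s) + e' * (D * s) by ring.
  by apply: le_trans (nmD _ _) _; rewrite nmN; apply: lerD; apply: err => /=; lra.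
have rig : nm (cint y (y + B * s) (fun t => g ((x + A * s) +i* t)) -
    cint y (y + B * s) (fun t => g (x +i* t)) -
    (B * s)%:C * ((A * s)%:C * l)) <= 2 * (2 * (e' * (D * s))) * (B * s).
  rewrite -cintB; [|by apply: ccont_ver; lra|by apply: ccont_ver; lra].
  have -> : (B * s)%:C = (y + B * s - y)%:C :> cplx R by congr _%:C; ring.
  have -> : 2 * (2 * (e' * (D * s))) * (B * s) =
      2 * (2 * (e' * (D * s))) * (y + B * s - y) by ring.
  apply: cint_bound; first lra.
    move=> t tx; apply: cvgB; first by apply: (ccont_ver _ _ _ tx); lra.
    by apply: (ccont_ver _ _ _ tx); lra.
  move=> t; rewrite in_itv /= => tx.
  have -> : g ((x + A * s) +i* t) - g (x +i* t) - (A * s)%:C * l =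
      er ((x + A * s) +i* t) - er (x +i* t).
    rewrite /er.
    have -> : (x + A * s) +i* t = x +i* t + (A * s)%:C :> cplx R by simpc.
    by ring.
  have -> : 2 * (e' * (D * s)) = e' * (D * s) + e' * (D * s) by ring.
  by apply: le_trans (nmD _ _) _; rewrite nmN; apply: lerD; apply: err => /=; lra.
set b := cint x _ _ - _ in bot *; set r := cint y _ _ - _ in rig *.
have -> : b + 'i%C * r = (b - (A * s)%:C * (- ('i%C * (B * s)%:C * l))) +
  'i%C * (r - (B * s)%:C * ((A * s)%:C * l)) by ring.
apply: le_trans (nmD _ _) _; rewrite nmM.
have -> : nm ('i%C : cplx R) = 1 by rewrite nm_normc /= expr0n expr1n add0r sqrtr1.
rewrite mul1r; apply: le_trans (lerD bot rig) _.
have -> : e * s ^+ 2 = 4 * e' * D ^+ 2 * s ^+ 2.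
  by rewrite /e'; field; rewrite lt0r_neq0.
have -> : 2 * (2 * (e' * (D * s))) * (A * s) + 2 * (2 * (e' * (D * s))) * (B * s) =
  4 * e' * D * s ^+ 2 * (A + B) by ring.
have -> : 4 * e' * D ^+ 2 * s ^+ 2 = 4 * e' * D * s ^+ 2 * D by ring.
rewrite ler_wpM2l //; last by rewrite /D; lra.
by rewrite mulr_ge0 ?sqr_ge0 // mulr_ge0 ?(ltW D0) // mulr_ge0 // ltW.
Qed.

End Goursat.

(** * The maximum principle *)

Section ComplexExponential.
Context {R : realType}.
Implicit Types (z w h : cplx R) (x y : R).

Definition cexp z : cplx R :=
  (expR (complex.Re z))%:C * (cos (complex.Im z) +i* sin (complex.Im z)).

Lemma Re_cexp z : complex.Re (cexp z) = expR (complex.Re z) * cos (complex.Im z).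
Proof. by rewrite ReM /= mul0r subr0. Qed.

Lemma Im_cexp z : complex.Im (cexp z) = expR (complex.Re z) * sin (complex.Im z).
Proof. by rewrite ImM /= mul0r addr0. Qed.

Lemma cexpD z w : cexp (z + w) = cexp z * cexp w.
Proof.
apply/eqP; rewrite eq_complex; apply/andP; split; apply/eqP.
  by rewrite Re_cexp ReM !Re_cexp !Im_cexp ReD ImD expRD cosD; ring.
by rewrite Im_cexp ImM !Re_cexp !Im_cexp ReD ImD expRD sinD; ring.
Qed.

Lemma nm_cexp z : nm (cexp z) = expR (complex.Re z).
Proof.
rewrite nmM nmC ger0_norm ?expR_ge0 // nm_normc /= cos2Dsin2 sqrtr1 mulr1 //.
Qed.

Lemma real_derive_expand (f : R -> R) x l : is_derive x 1 f l ->
  forall e : R, 0 < e -> exists2 d : R, 0 < d &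
    forall h : R, `|h| < d -> `|f (x + h) - f x - h * l| <= e * `|h|.
Proof.
case=> /cvg_ex[l' dl'] dl e e0.
have ll' : l' = l by rewrite -dl; apply/esym/cvg_lim => //; exact: dl'.
move: dl'; rewrite ll' => /cvgrPdist_le /(_ _ e0).
rewrite near_withinE => /nbhs_ballP[d /= d0 H]; exists d => // h hd.
have [->|h0] := eqVneq h 0; first by rewrite addr0 mul0r !subrr !normr0 mulr0.
have := H h; rewrite -ball_normE /= sub0r normrN => /(_ hd h0).
rewrite [h *: 1]mulr1 [h + x]addrC => H1.
have -> : f (x + h) - f x - h * l = h * (h^-1 * (f (x + h) - f x) - l).
  by rewrite mulrBr mulrA divff // mul1r.
by rewrite normrM mulrC ler_wpM2r // distrC.
Qed.

Lemma cdiff_cexp0 : cdiff cexp 0 (1 : cplx R).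
Proof.
move=> e e0.
(* The final bound e'|x| + 3e'|y| + 3e'|y| + 2|x||y|, with |x| <= e', is at most 9 e' |h|. *)
have [e' [e'0 e'1 e'e]] : exists e', [/\ 0 < e', e' <= 1 & e' <= e / 9].
  exists (Num.min 1 (e / 9)); split; last by rewrite ge_min lexx orbT.
    by rewrite lt_min ltr01 divr_gt0.
  by rewrite ge_min lexx.
have [d1 d10 H1] := real_derive_expand (is_derive_expR (0 : R)) e'0.
have [d2 d20 H2] := real_derive_expand (is_derive_cos (0 : R)) e'0.
have [d3 d30 H3] := real_derive_expand (is_derive_sin (0 : R)) e'0.
exists (Num.min e' (Num.min d1 (Num.min d2 d3))); first by rewrite !lt_min e'0 d10 d20.
move=> h; rewrite !lt_min => /and4P[hd hd1 hd2 hd3].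
have hx := Re_le_nm h; have hy := Im_le_nm h.
have {}H1 := H1 _ (le_lt_trans hx hd1).
have {}H2 := H2 _ (le_lt_trans hy hd2).
have {}H3 := H3 _ (le_lt_trans hy hd3).
rewrite add0r expR0 mulr1 in H1.
rewrite add0r cos0 sin0 oppr0 mulr0 subr0 in H2.
rewrite add0r sin0 subr0 cos0 mulr1 in H3.
rewrite add0r.
have -> : cexp 0 = 1 :> cplx R.
  by apply/eqP; rewrite eq_complex Re_cexp Im_cexp /= expR0 cos0 sin0 mulr0 mulr1 !eqxx.
rewrite [h *: 1]mulr1.
apply: le_trans (nm_le_ReIm _) _.
rewrite !ReB !ImB Re_cexp Im_cexp /= subr0.
set x := complex.Re h in H1 hx *; set y := complex.Im h in H2 H3 hy *; set r := nm h in hx hy hd *.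
set E := expR x in H1 *.
have E0 : 0 < E by exact: expR_gt0.
have x1 : `|x| <= 1 by apply: le_trans hx _; lra.
have xe : `|x| <= e' by apply: le_trans hx (ltW hd).
have E3 : E <= 3.
  have := le_trans (ler_norm _) H1; have := ler_norm x; have := normr_ge0 x; nra.
have E1 : `|E - 1| <= 2 * `|x|.
  have -> : E - 1 = (E - 1 - x) + x by ring.
  apply: le_trans (ler_normD _ _) _; have := normr_ge0 x; nra.
have R1 : `|E * cos y - 1 - x| <= e' * `|x| + 3 * (e' * `|y|).
  have -> : E * cos y - 1 - x = (E - 1 - x) + E * (cos y - 1) by ring.
  apply: le_trans (ler_normD _ _) _; apply: lerD => //.
  by rewrite normrM gtr0_norm // ler_pM // ltW.
have R2 : `|E * sin y - y| <= 3 * (e' * `|y|) + 2 * `|x| * `|y|.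
  have -> : E * sin y - y = E * (sin y - y) + (E - 1) * y by ring.
  apply: le_trans (ler_normD _ _) _; apply: lerD; last by rewrite normrM ler_wpM2r.
  by rewrite normrM gtr0_norm // ler_pM // ltW.
apply: le_trans (lerD R1 R2) _.
have y0 := normr_ge0 y; have x0 := normr_ge0 x; have r0 : 0 <= r := nm_ge0 h.
by nra.
Qed.

Lemma cdiff_cexp z : cdiff cexp z (cexp z).
Proof.
move=> e e0.
have c0 : 0 < nm (cexp z) by rewrite nm_cexp expR_gt0.
have [|d d0 H] := cdiff_cexp0 (e := e / nm (cexp z)); first by rewrite divr_gt0.
exists d => // h hd; have := H h hd; rewrite add0r.
have -> : cexp (0 : cplx R) = 1.
  by apply/eqP; rewrite eq_complex Re_cexp Im_cexp /= expR0 cos0 sin0 mulr0 mulr1 !eqxx.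
have -> : cexp (z + h) - cexp z - h *: cexp z =
    cexp z * (cexp h - 1 - h *: 1).
  by rewrite cexpD [h *: cexp z]mulrC [h *: 1]mulr1; ring.
by rewrite nmM mulrAC ler_pdivlMr // mulrC.
Qed.

Lemma cexp_period x : cexp (x +i* (pi *+ 2)) = cexp (x +i* 0).
Proof.
have -> : x +i* (pi *+ 2) = x +i* 0 + 0 +i* (pi *+ 2) :> cplx R.
  by apply/eqP; rewrite eq_complex /= addr0 add0r !eqxx.
rewrite cexpD [X in _ * X](_ : _ = 1) ?mulr1 //.
by apply/eqP; rewrite eq_complex Re_cexp Im_cexp /= expR0 cos2pi -[pi *+ 2]add0r sinD2pi sin0 mulr0 mulr1 !eqxx.
Qed.

End ComplexExponential.

(** * Mean values on circles and strict maxima *)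

Section MeanValue.
Context {R : realType}.
Variables (H : cplx R -> cplx R) (a : cplx R) (r : R).
Hypothesis H_cont : {for a, continuous H}.
Hypothesis H_derivable : forall z, 0 < nm (z - a) -> nm (z - a) < r -> derivable H z 1.

(** In logarithmic coordinates circles about a become vertical segments and the punctured disc a
    half-plane. Rectangles are then enough, and H need only be continuous at the centre. *)
Let g (z : cplx R) : cplx R := H (a + cexp z).

Let g_derivable z : expR (complex.Re z) < r -> derivable g z 1.
Proof.
move=> zr; apply/derivable1_diffP.
apply: (@differentiable_comp _ _ _ _ (fun w : cplx R => a + cexp w) H).
  apply/derivable1_diffP; apply: cdiff_derivable.
  by apply: cdiffD; [exact: cdiff_cst|exact: cdiff_cexp].
apply/derivable1_diffP; apply: H_derivable; rewrite addrAC subrr add0r nm_cexp //.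
exact: expR_gt0.
Qed.

Let circle_cont x u v : expR x < r -> ccont u v (fun t => g (x +i* t)).
Proof.
move=> xr t _; apply: (@continuous_comp _ _ _ (fun t : R => x +i* t : cplx R) g).
  by apply: cvg_complex; [exact: cvg_cst|exact: cvg_id].
by apply: derivable_continuous; exact: g_derivable.
Qed.

(** Goursat on a rectangle of height 2 pi: the horizontal sides cancel by periodicity. *)
Let circle_indep x0 x1 : x0 <= x1 -> expR x1 < r ->
  cint 0 (pi *+ 2) (fun t => g (x1 +i* t)) = cint 0 (pi *+ 2) (fun t => g (x0 +i* t)).
Proof.
move=> x01 x1r.
have pi2 : 0 <= pi *+ 2 :> R by rewrite mulrn_wge0 // pi_ge0.
have := @goursat R g x0 0 (x1 - x0) (pi *+ 2).
rewrite subr_ge0 => /(_ x01 pi2).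
have x1E : x0 + (x1 - x0) = x1 by rewrite addrC subrK.
rewrite /boundary_int add0r x1E.
have gE : (fun t => g (t +i* (pi *+ 2))) = (fun t => g (t +i* 0)).
  by apply/funext => t; rewrite /g cexp_period.
rewrite gE subrr add0r => G.
apply/eqP; rewrite -subr_eq0; apply/eqP.
have i0 : 'i%C != 0 :> cplx R by rewrite eq_complex /= oner_eq0 andbF.
apply: (mulfI i0); rewrite mulr0; apply: G => z [/andP[_ h] _].
by apply: g_derivable; apply: le_lt_trans x1r; rewrite ler_expR.
Qed.

Lemma mean_value x : expR x < r ->
  cint 0 (pi *+ 2) (fun t => H (a + cexp (x +i* t))) = (pi *+ 2)%:C * H a.
Proof.
move=> xr; apply/eqP; rewrite -subr_eq0 -nm_eq0; apply/eqP/le_anti.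
rewrite nm_ge0 andbT; apply/ler_addgt0Pl => e e0; rewrite addr0.
have pi2 : 0 < pi *+ 2 :> R by rewrite mulrn_wgt0 // pi_gt0.
pose e' := e / (2 * (pi *+ 2)).
have e'0 : 0 < e' by rewrite divr_gt0 // mulr_gt0.
have [d d0 Hd] : exists2 d : R, 0 < d & forall z, nm (z - a) < d -> nm (H z - H a) < e'.
  by move/cvg_nmP : H_cont => /(_ _ e'0) /nbhs_nmP.
pose x0 := Num.min x (ln (d / 2)).
have x0x : x0 <= x by rewrite ge_min lexx.
have x0d : expR x0 < d.
  apply: (@le_lt_trans _ _ (expR (ln (d / 2)))); first by rewrite ler_expR ge_min lexx orbT.
  by rewrite lnK ?posrE; lra.
have x0r : expR x0 < r by apply: le_lt_trans xr; rewrite ler_expR.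
rewrite -/(g _) (circle_indep x0x xr).
have := @cint_bound R 0 (pi *+ 2) (H a) e' (fun t => g (x0 +i* t)) (ltW pi2)
  (circle_cont x0r).
rewrite subr0 => B; apply: le_trans (B _) _.
  move=> t _; apply: ltW; apply: Hd.
  by rewrite addrAC subrr add0r nm_cexp.
rewrite le_eqVlt; apply/orP; left; apply/eqP; rewrite /e'.
by move: pi2; move: (pi *+ 2) => P P0; field; rewrite lt0r_neq0.
Qed.

(** On the circle of radius r / 2 every value is smaller than |H a| by a fixed factor q > 1, which
    contradicts the mean value. The quadratic gain in the hypothesis removes the equality case of
    the maximum principle. *)
Lemma no_strict_max (k : R) : 0 < r -> 0 < k ->
  (forall z, nm (z - a) < r -> nm (H z) * (1 + k * nm (z - a) ^+ 2) <= nm (H a)) ->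
  H a = 0.
Proof.
move=> r0 k0 Hmax; apply/eqP; rewrite -nm_eq0; apply: contraT => Ha.
have Ha0 : 0 < nm (H a) by rewrite lt_def Ha nm_ge0.
pose x := ln (r / 2).
have xE : expR x = r / 2 by rewrite lnK ?posrE //; lra.
have xr : expR x < r by rewrite xE; lra.
have pi2 : 0 < pi *+ 2 :> R by rewrite mulrn_wgt0 // pi_gt0.
pose c : cplx R := (H a)^*%C.
have cc : ccont 0 (pi *+ 2) (fun t => g (x +i* t)) by exact: circle_cont.
have := Re_cint_mul c cc; rewrite [cint _ _ _](mean_value xr).
have -> : complex.Re (c * ((pi *+ 2)%:C * H a)) = (pi *+ 2) * nm (H a) ^+ 2.
  by rewrite nm_sqr /c; case: (H a) => u v; rewrite !ReM !ImM /=; ring.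
move=> E; pose q := 1 + k * (r / 2) ^+ 2.
have q1 : 1 < q by rewrite /q ltrDl mulr_gt0 // exprn_gt0 // divr_gt0.
have q0 : 0 < q by apply: lt_trans q1.
have := @rint_bound R 0 (pi *+ 2) 0 (nm (H a) ^+ 2 / q) _ (ltW pi2)
   (ccont_Re (f := fun t => c * g (x +i* t)) _).
move=> /(_ _)/wrap[|].
  by move=> t /cc; apply: cvgM; exact: cvg_cst.
move=> /(_ _)/wrap[|].
  move=> t _; rewrite subr0; apply: le_trans (Re_le_nm _) _.
  rewrite nmM nmJ expr2 -mulrA ler_pM2l // ler_pdivlMr //.
  have zE : nm (a + cexp (x +i* t) - a) = r / 2.
    by rewrite addrAC subrr add0r nm_cexp.
  by have := Hmax (a + cexp (x +i* t)); rewrite zE; apply; lra.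
rewrite mulr0 subr0 -E subr0 ger0_norm; last by rewrite mulr_ge0 ?sqr_ge0 // ltW.
rewrite mulrC ler_pM2r // ler_pdivlMr // -[leRHS]mulr1 ler_pM2l ?exprn_gt0 //.
by rewrite leNgt q1.
Qed.

End MeanValue.

(** * The Kobayashi-Royden metric *)

Section CompactInOpen.
Context {R : realType} {V : normedModType (cplx R)}.

Lemma compact_open_dist (K D : set V) : compact K -> open D -> K `<=` D ->
  exists2 e : R, 0 < e & forall x y, K x -> nm (y - x) < e -> D y.
Proof.
move=> /compact_near_coveringP cK /open_nmP oD KD.
have [|e /= e0 H] := cK R (0:R)^'+ (fun e x => forall y, nm (y - x) < e -> D y) _.
  move=> x /KD /oD[e e0 xe].
  have e2 : 0 < e / 2 by rewrite divr_gt0.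
  exists ([set y | nm (y - x) < e / 2], [set t : R | t < e / 2]).
    by split; [exact: nbhs_nm|exact: nbhs_right_lt].
  move=> [x' t] [/= x'e te] y yx'; apply: xe.
  by have := nm_triangle x' y x; lra.
exists (e / 2); first by rewrite divr_gt0.
move=> x y Kx yx; apply: (H (e / 2)) yx => //=; last by rewrite divr_gt0.
by rewrite sub0r normrN gtr0_norm ?divr_gt0 //; move: e0 => /= e0; lra.
Qed.

End CompactInOpen.

Section KobayashiRoyden.
Context {R : realType} {n : nat}.
Local Notation Cn := 'rV[cplx R]_n.
Implicit Types (D G : set Cn) (z w v : Cn) (f : cplx R -> Cn).

Lemma holomorphic_discP D f : holomorphic_disc D f <->
  forall x : cplx R, nm x < 1 -> derivable f x 1 /\ D (f x).
Proof.
have E (x : cplx R) : (`|x| < 1) = (nm x < 1) by rewrite nmE -ltcR.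
by split=> H x x1; apply: H; rewrite ?E // -E.
Qed.

(** A strict upper bound amounts to a single disc, with room left to perturb it; the estimates of
    the metric below go through this form. *)
Lemma kr_ltP D z v (c : R) : (kobayashi_royden D z v < c%:E)%E <->
  exists a : R, [/\ 0 < a, a < c & exists f, [/\ holomorphic_disc D f, f 0 = z &
    exists2 l, cdiff f 0 l & a%:C *: l = v]].
Proof.
split.
  move=> /ereal_inf_lt[_ [a [a0 [f [Df f0 fl]]] <-]]; rewrite lte_fin => ac.
  exists a; split => //; exists f; split => //; exists ('D_1 f 0) => //.
  apply: derivable_cdiff; have /holomorphic_discP := Df.
  by move=> /(_ 0); rewrite nm0 ltr01 => /(_ isT)[].
move=> [a [a0 ac [f [Df f0 [l fl lv]]]]].
apply: le_lt_trans (_ : _ <= a%:E)%E _; last by rewrite lte_fin.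
apply: ereal_inf_lbound; exists a => //; split => //.
by exists f; split => //; rewrite (cdiff_derive fl).
Qed.

Lemma kr_ge0 D z v : (0 <= kobayashi_royden D z v)%E.
Proof. by apply: le_ereal_inf_tmp => _ [a [a0 _] <-]; rewrite lee_fin ltW. Qed.

(** Upper semicontinuity: shrunk to radius r < 1, the disc has an image in a compact part of D, so
    it can be translated by z' - z and tilted by x w, with w proportional to v' - v. This is the
    source of measurability along curves. *)
Lemma kr_usc D z v (c : R) : open D -> (kobayashi_royden D z v < c%:E)%E ->
  exists2 e : R, 0 < e & forall z' v', nm (z' - z) < e -> nm (v' - v) < e ->
    (kobayashi_royden D z' v' < c%:E)%E.
Proof.
move=> oD /kr_ltP[a [a0 ac [f [/holomorphic_discP Df f0 [l fl lv]]]]].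
have c0 : 0 < c by apply: lt_trans ac.
(* The mean of a / c and 1, so that b = a / r is still below c. *)
pose r := (a + c) / (2 * c).
have c2 : 0 < 2 * c by rewrite mulr_gt0.
have r0 : 0 < r by rewrite divr_gt0 // addr_gt0.
have r1 : r < 1 by rewrite ltr_pdivrMr //; lra.
have arc : a < r * c.
  have rE : r * (2 * c) = a + c by rewrite /r divfK // lt0r_neq0.
  by have : 2 * (r * c) = a + c; [rewrite mulrCA|lra].
pose b := a / r.
have b0 : 0 < b by rewrite divr_gt0.
have bc : b < c by rewrite ltr_pdivrMr // mulrC.
have nmr (x : cplx R) : nm (r%:C * x : cplx R) = r * nm x by rewrite nmM nmC gtr0_norm.
have fc : {within [set x : cplx R | nm x <= r], continuous f}.
  apply: continuous_in_subspaceT => x /set_mem /= xr.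
  by apply: derivable_continuous; apply: (Df x _).1; lra.
have cK := continuous_compact fc (@compact_nm_disc R r).
have [|e e0 He] := compact_open_dist cK oD.
  by move=> _ [x /= xr <-]; apply: (Df x _).2; lra.
have b1 : 0 < 1 + b^-1 by rewrite addr_gt0 // invr_gt0.
exists (e / (1 + b^-1)); first by rewrite divr_gt0.
move=> z' v' zz' vv'; apply/kr_ltP; exists b; split => //.
pose w := b^-1%:C *: (v' - v).
exists (fun x => f (r%:C * x) + ((z' - z) + x *: w)).
have nmw : nm w = b^-1 * nm (v' - v).
  by rewrite nmZR gtr0_norm // invr_gt0.
split.
- apply/holomorphic_discP => x x1; have nx := nm_ge0 x; split.
    have rx : nm (r%:C * x : cplx R) < 1 by rewrite nmr; nra.
    have [d _] := Df _ rx.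
    apply: cdiff_derivable; apply: cdiffD.
      exact: derivable_cdiff (derivable_rescale d).
    by apply: cdiffD; [exact: cdiff_cst|exact: cdiff_scale].
  apply: (He (f (r%:C * x))).
    by exists (r%:C * x) => //=; rewrite nmr; have := nm_ge0 x; nra.
  rewrite addrAC subrr add0r; apply: le_lt_trans (nmD _ _) _.
  rewrite nmZ nmw.
  have -> : e = e / (1 + b^-1) + b^-1 * (e / (1 + b^-1)).
    rewrite -[X in X + _]mul1r -mulrDl mulrC divfK //; exact: lt0r_neq0.
  apply: ltr_leD => //; have := nm_ge0 (v' - v).
  have bi : 0 < b^-1 by rewrite invr_gt0.
  move=> nv; apply: le_trans (_ : b^-1 * nm (v' - v) <= _); last by rewrite ler_pM2l // ltW.
  by rewrite ler_piMl ?(ltW x1) // mulr_ge0 // ltW.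
- by rewrite mulr0 f0 scale0r addr0 addrC subrK.
exists (r%:C *: l + (0 + w)).
  apply: cdiffD; first by apply: cdiff_rescale; rewrite mulr0.
  by apply: cdiffD; [exact: cdiff_cst|exact: cdiff_scale].
rewrite add0r scalerDr !scalerA -!RtoCM /b divfK ?lt0r_neq0 // divff ?lt0r_neq0 //.
by rewrite lv scale1r addrC subrK.
Qed.

Lemma kr_ball D z v (r : R) : 0 < r -> (forall y, nm (y - z) < r -> D y) ->
  (kobayashi_royden D z v <= (nm v / r)%:E)%E.
Proof.
move=> r0 rD; apply/lee_addgt0Pr => e e0; apply: ltW; rewrite -EFinD.
pose a := nm v / r + e / 2.
have v0 : 0 <= nm v / r by rewrite divr_ge0 ?nm_ge0 // ltW.
have a0 : 0 < a by rewrite /a; lra.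
apply/kr_ltP; exists a; split => //; first by rewrite /a; lra.
exists (fun x => z + x *: (a^-1%:C *: v)); split.
- apply/holomorphic_discP => x x1; split.
    apply: cdiff_derivable; apply: cdiffD; [exact: cdiff_cst|exact: cdiff_scale].
  apply: rD; rewrite addrAC subrr add0r nmZ nmZR gtr0_norm ?invr_gt0 //.
  have var : nm v < a * r by rewrite -ltr_pdivrMr // /a; lra.
  have : a^-1 * nm v < r by rewrite mulrC ltr_pdivrMr // mulrC.
  have : 0 <= a^-1 * nm v by rewrite mulr_ge0 ?nm_ge0 // invr_ge0 ltW.
  by have := nm_ge0 x; nra.
- by rewrite scale0r addr0.
exists (0 + a^-1%:C *: v).
  by apply: cdiffD; [exact: cdiff_cst|exact: cdiff_scale].
by rewrite add0r scalerA -RtoCM divff ?scale1r // lt0r_neq0.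
Qed.

Lemma kr_lty D z v : open D -> D z -> (kobayashi_royden D z v < +oo)%E.
Proof.
move=> /open_nmP oD /oD[r r0 rD].
by apply: le_lt_trans (kr_ball v r0 rD) _; rewrite ltry.
Qed.

Lemma kr_fin D z v : open D -> D z -> kobayashi_royden D z v \is a fin_num.
Proof. by move=> oD Dz; rewrite ge0_fin_numE ?kr_ge0 // kr_lty. Qed.

Lemma kr_scale_lt D z v (c b : R) : c != 0 -> (kobayashi_royden D z v < b%:E)%E ->
  (kobayashi_royden D z (c%:C *: v) < (`|c| * b)%:E)%E.
Proof.
move=> c0 /kr_ltP[a [a0 ab [f [/holomorphic_discP Df f0 [l fl lv]]]]].
have nc0 : 0 < `|c| by rewrite normr_gt0.
apply/kr_ltP; exists (`|c| * a); split; [by rewrite mulr_gt0|by rewrite ltr_pM2l|].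
pose s : R := c / `|c|.
have s1 : `|s| = 1 by rewrite normrM normfV normr_id divff // lt0r_neq0.
exists (fun x => f (s%:C * x)); split.
- apply/holomorphic_discP => x x1.
  have sx : nm (s%:C * x : cplx R) < 1 by rewrite nmM nmC s1 mul1r.
  by have [d Dx] := Df _ sx; split; [exact: (derivable_rescale d)|exact: Dx].
- by rewrite mulr0.
exists (s%:C *: l); first by apply: cdiff_rescale; rewrite mulr0.
rewrite -lv !scalerA -!RtoCM; congr (_%:C *: _).
by rewrite /s mulrAC [`|c| * _]mulrC divfK // lt0r_neq0.
Qed.

Lemma ereal_le_lt (x y : \bar R) : (forall b : R, (y < b%:E)%E -> (x <= b%:E)%E) ->
  (x <= y)%E.
Proof.
case: y => [y||] H; last 2 first.
- exact: leey.
- have -> : x = -oo%E; last by [].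
  case: x H => [x H|H|//]; last by have := H 0 (ltNyr _).
  by exfalso; have := H (x - 1) (ltNyr _); rewrite lee_fin; lra.
apply/lee_addgt0Pr => e e0; rewrite -EFinD; apply: H.
by rewrite lte_fin ltrDl.
Qed.

Lemma kr_scale D z v (c : R) : c != 0 ->
  kobayashi_royden D z (c%:C *: v) = (`|c|%:E * kobayashi_royden D z v)%E.
Proof.
have half (k : R) u : k != 0 ->
    (kobayashi_royden D z (k%:C *: u) <= `|k|%:E * kobayashi_royden D z u)%E.
  move=> k0; have nk0 : 0 < `|k| by rewrite normr_gt0.
  rewrite -lee_pdivrMl //; apply: ereal_le_lt => b ub.
  by rewrite lee_pdivrMl // -EFinM ltW // kr_scale_lt.
move=> c0; apply/le_anti; rewrite half //=.
have nc0 : 0 < `|c| by rewrite normr_gt0.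
rewrite -lee_pdivlMl // -normfV.
have := half c^-1 (c%:C *: v); rewrite invr_eq0 => /(_ c0).
by rewrite scalerA -RtoCM mulVf // scale1r.
Qed.

(* Royden's localization: restrict a disc in [D] to the disc of radius [rho] and rescale. *)
Lemma kr_royden D G z (rho : R) v : 0 < rho -> rho <= 1 ->
  (forall f, holomorphic_disc D f -> f 0 = z ->
     forall x, nm x < rho -> G (f x)) ->
  (kobayashi_royden G z v <= rho^-1%:E * kobayashi_royden D z v)%E.
Proof.
move=> r0 r1 H; rewrite -lee_pdivrMl ?invr_gt0 // invrK.
apply: ereal_le_lt => b /kr_ltP[a [a0 ab [f [Df f0 [l fl lv]]]]].
have {}H := H f Df f0; move/holomorphic_discP in Df.
rewrite -lee_pdivlMl // -EFinM mulrC ltW //.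
apply/kr_ltP; exists (a / rho); split; [by rewrite divr_gt0|by rewrite ltr_pM2r ?invr_gt0|].
have nmr (x : cplx R) : nm x < 1 -> nm (rho%:C * x : cplx R) < rho.
  by move=> x1; rewrite nmM nmC gtr0_norm // gtr_pMr.
exists (fun x => f (rho%:C * x)); split.
- apply/holomorphic_discP => x x1; split; last exact/H/nmr.
  by have [d _] := Df _ (lt_le_trans (nmr _ x1) r1); exact: (derivable_rescale d).
- by rewrite mulr0.
exists (rho%:C *: l); first by apply: cdiff_rescale; rewrite mulr0.
by rewrite scalerA -RtoCM divfK // lt0r_neq0.
Qed.

End KobayashiRoyden.

Section ChangeOfVariable.
Context {R : realType}.
Local Notation mu := (@lebesgue_measure R).
Implicit Types (a b d k : R) (f : R -> \bar R).

Lemma integral_neg a b f : measurable_fun `]a, b[ f ->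
  (forall t, t \in `]a, b[ -> (0 <= f t)%E) ->
  (\int[mu]_(t in `](- b)%R, (- a)%R[) f (- t)%R = \int[mu]_(t in `]a, b[) f t)%E.
Proof.
move=> mf f0.
rewrite (_ : `](- b), (- a)[%classic =
    (-%R : _ -> measurableTypeR R) @^-1` `]a, b[); last first.
  by rewrite opp_preimage_itvbndbnd.
rewrite -ge0_integral_pushforward //=; last by move=> t /[!inE] /= tab; exact: f0.
by apply: eq_measure_integral => //= A mA AS; exact: lebesgue_measureN.
Qed.

(** The pushforward of Lebesgue measure, scaled by k, agrees with it on half-open intervals, hence
    everywhere. The integrand is only measurable, as the metric is only semicontinuous. *)
Lemma integral_affine a b d k f : 0 < k -> measurable_fun `]a, b[ f ->
  (forall t, t \in `]a, b[ -> (0 <= f t)%E) ->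
  (\int[mu]_(t in `](((a - d) / k))%R, ((b - d) / k)%R[) (k%:E * f (k * t + d)%R) =
   \int[mu]_(t in `]a, b[) f t)%E.
Proof.
move=> k0 mf f0; pose phi t : measurableTypeR R := k * t + d.
have mphi : measurable_fun setT (phi : measurableTypeR R -> measurableTypeR R).
  apply: measurable_funD => //; exact: measurable_funM.
have preim (c1 c2 : bool) u v : phi @^-1` [set` Interval (BSide c1 u) (BSide c2 v)] =
    [set` Interval (BSide c1 ((u - d) / k)) (BSide c2 ((v - d) / k))].
  apply/seteqP; split=> t /=; case: c1; case: c2; rewrite !in_itv /= /phi
 ?ler_pdivrMr ?ltr_pdivrMr ?ler_pdivlMr ?ltr_pdivlMr // mulrC => /andP[h1 h2];
    apply/andP; split; lra.
rewrite -(preim false true).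
have mphi' : measurable_fun (phi @^-1` `]a, b[) (f \o phi).
  apply: (measurable_comp (F := `]a, b[%classic)) => //.
    by move=> _ [t tab <-].
  exact: measurable_funTS.
rewrite ge0_integralZl //=; last 3 first.
- rewrite -[X in measurable X]setTI; exact: mphi.
- by move=> t tab; exact: f0.
- by rewrite ltW.
pose nu : {measure set _ -> \bar R} := mscale (NngNum (ltW k0)) (pushforward mu phi).
transitivity (\int[nu mphi]_(t in `]a, b[) f t)%E.
  rewrite ge0_integral_mscale //=.
  congr (_ * _)%E; rewrite ge0_integral_pushforward //.
  by move=> t /[!inE] /= tab; exact: f0.
apply: eq_measure_integral => //= A mA AS; apply/esym.
apply: lebesgue_measure_unique => // _ [[u v]] _ <-.
transitivity (k%:E * mu (phi @^-1` `]u, v]))%E; last by [].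
rewrite preim !lebesgue_measure_itv /=.
rewrite !lte_fin ltr_pM2r ?invr_gt0 // ltrD2r.
case: ifPn => _; last by rewrite mule0.
by rewrite -EFinD -EFinM; congr _%:E; field; rewrite lt0r_neq0.
Qed.

End ChangeOfVariable.

(** * Piecewise smooth curves and the Kobayashi distance *)

Section Curves.
Context {R : realType} {n : nat}.
Local Notation Cn := 'rV[cplx R]_n.
Implicit Types (g h dg : R -> Cn) (a b c d k s t : R) (x v : Cn).

Definition C1d a b g dg :=
  (forall t, t \in `[a, b] -> forall e : R, 0 < e -> exists2 r : R, 0 < r &
     forall s, s \in `[a, b] -> `|s - t| < r -> nm (dg s - dg t) < e) /\
  (forall t, t \in `[a, b] -> forall e : R, 0 < e -> exists2 r : R, 0 < r &
     forall s, s \in `[a, b] -> `|s - t| < r -> s != t ->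
       nm (diff_quot g t s - dg t) < e).

Lemma near_within_itvP (P : R -> Prop) a b t :
  (\forall s \near within `[a, b]%classic (nbhs t), P s) <->
  exists2 r : R, 0 < r & forall s, s \in `[a, b] -> `|s - t| < r -> P s.
Proof.
rewrite near_withinE; split.
  move=> /nbhs_ballP[r /= r0 H]; exists r => // s sab st; apply: H => //.
  by rewrite -ball_normE /= distrC.
move=> [r r0 H]; apply/nbhs_ballP; exists r => //= s.
by rewrite -ball_normE /= distrC => st sab; exact: H.
Qed.

Lemma near_within_dnbhsP (P : R -> Prop) a b t :
  (\forall s \near within `[a, b]%classic t^', P s) <->
  exists2 r : R, 0 < r &
    forall s, s \in `[a, b] -> `|s - t| < r -> s != t -> P s.
Proof.
rewrite near_withinE near_withinE; split.
  move=> /nbhs_ballP[r /= r0 H]; exists r => // s sab st sNt; apply: H => //.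
  by rewrite -ball_normE /= distrC.
move=> [r r0 H]; apply/nbhs_ballP; exists r => //= s.
by rewrite -ball_normE /= distrC => st sNt sab; exact: H.
Qed.

Lemma C1_onP a b g : C1_on a b g <-> exists dg, C1d a b g dg.
Proof.
split=> [[dg [/subspace_continuousP dgc gd]]|[dg [dgc gd]]]; exists dg; split.
- move=> t tab e e0; apply/near_within_itvP.
  by have /cvg_nmP := dgc t tab; apply.
- move=> t tab e e0; apply/near_within_dnbhsP.
  by have /cvg_nmP := gd t tab; apply.
- apply/subspace_continuousP => t tab; apply/cvg_nmP => e e0.
  by apply/near_within_itvP; exact: dgc.
- move=> t tab; apply/cvg_nmP => e e0.
  by apply/near_within_dnbhsP; exact: gd.
Qed.

Lemma C1d_sub a b c d g dg : a <= c -> d <= b -> C1d a b g dg -> C1d c d g dg.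
Proof.
move=> ac db [H1 H2].
have sub s : s \in `[c, d] -> s \in `[a, b] by rewrite !in_itv /=; lra.
split=> t /sub tab e e0; [have [r r0 H] := H1 t tab e e0|have [r r0 H] := H2 t tab e e0];
  by exists r => // s /sub; exact: H.
Qed.

Lemma C1d_eq a b g h dg : {in `[a, b], g =1 h} -> C1d a b g dg -> C1d a b h dg.
Proof.
move=> gh [H1 H2]; split; first exact: H1.
move=> t tab e e0; have [r r0 H] := H2 t tab e e0; exists r; first exact: r0.
by move=> s sab; rewrite /diff_quot -(gh s sab) -(gh t tab); exact: H.
Qed.

Lemma diff_quot_affine g k d t s : k != 0 ->
  diff_quot (fun u => g (k * u + d)) t s =
  k%:C *: diff_quot g (k * t + d) (k * s + d).
Proof.
move=> k0; rewrite /diff_quot scalerA -RtoCM; congr (_%:C *: _).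
have -> : k * s + d - (k * t + d) = k * (s - t) by ring.
by rewrite invfM mulrA divff // mul1r.
Qed.

Lemma C1d_affine a b a' b' k d g dg : k != 0 ->
  (forall t, t \in `[a', b'] -> k * t + d \in `[a, b]) ->
  C1d a b g dg ->
  C1d a' b' (fun t => g (k * t + d)) (fun t => k%:C *: dg (k * t + d)).
Proof.
move=> k0 ab' [H1 H2].
have nk : 0 < `|k| by rewrite normr_gt0.
have aff s t r : `|s - t| < r / `|k| -> `|k * s + d - (k * t + d)| < r.
  rewrite ltr_pdivlMr // => st.
  have -> : k * s + d - (k * t + d) = k * (s - t) by ring.
  by rewrite normrM mulrC.
split=> t tab e e0.
  have [|r r0 H] := H1 _ (ab' t tab) (e / `|k|); first by rewrite divr_gt0.
  exists (r / `|k|); first by rewrite divr_gt0.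
  move=> s sab st; rewrite -scalerBr nmZR mulrC -ltr_pdivlMr //.
  by apply: H; [exact: ab'|exact: aff].
have [|r r0 H] := H2 _ (ab' t tab) (e / `|k|); first by rewrite divr_gt0.
exists (r / `|k|); first by rewrite divr_gt0.
move=> s sab st sNt; rewrite diff_quot_affine // -scalerBr nmZR mulrC -ltr_pdivlMr //.
apply: H; [exact: ab'|exact: aff|].
by apply: contra sNt => /eqP /addIr /(mulfI k0) ->.
Qed.

Lemma C1d_segment a b x v : C1d a b (fun t => x + t%:C *: v) (fun=> v).
Proof.
split=> t tab e e0; exists 1 => // s _ _; rewrite ?subrr ?nm0 // => sNt.
rewrite /diff_quot opprD addrACA subrr add0r -scalerBl -RtoCB scalerA -RtoCM.
by rewrite mulVf ?subr_eq0 // scale1r subrr nm0.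
Qed.

Lemma C1d_cst a b x : C1d a b (fun=> x) (fun=> 0).
Proof.
by apply: (C1d_eq _ (C1d_segment a b x 0)) => t _; rewrite scaler0 addr0.
Qed.

Lemma C1d_velocity a b g dg t : C1d a b g dg -> a < t -> t < b -> velocity g t = dg t.
Proof.
move=> [_ H] at_ tb; apply: cvg_lim; first exact: norm_hausdorff.
apply/cvg_nmP => e e0.
have [|r r0 {}H] := H t _ e e0; first by rewrite in_itv /= !ltW.
rewrite near_withinE; apply/nbhs_ballP.
have m0 : 0 < Num.min r (Num.min (t - a) (b - t)) by rewrite !lt_min r0 !subr_gt0 at_.
exists (Num.min r (Num.min (t - a) (b - t))) => // s.
rewrite -ball_normE /= distrC !lt_min => /and3P[st sa sb] sNt; apply: H => //.
by move: sa sb; rewrite !ltr_norml in_itv /=; lra.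
Qed.

Lemma C1d_continuous a b g dg t : C1d a b g dg -> t \in `[a, b] ->
  forall e : R, 0 < e -> exists2 r : R, 0 < r &
     forall s, s \in `[a, b] -> `|s - t| < r -> nm (g s - g t) < e.
Proof.
move=> [_ H] tab e e0; have [r r0 {}H] := H t tab 1 ltr01.
have M0 : 0 < nm (dg t) + 1 by rewrite ltr_wpDl ?nm_ge0.
exists (Num.min r (e / (nm (dg t) + 1))); first by rewrite lt_min r0 divr_gt0.
move=> s sab; rewrite lt_min => /andP[sr]; rewrite ltr_pdivlMr // => se.
have [->|sNt] := eqVneq s t; first by rewrite subrr nm0.
have {}H := H s sab sr sNt.
have Dq : nm (diff_quot g t s) <= nm (dg t) + 1.
  have := nmD (diff_quot g t s - dg t) (dg t); rewrite subrK; lra.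
have -> : g s - g t = (s - t)%:C *: diff_quot g t s.
  by rewrite /diff_quot scalerA -RtoCM divff ?subr_eq0 // scale1r.
by rewrite nmZR; apply: le_lt_trans se; rewrite ler_wpM2l.
Qed.

(** Piecewise smoothness as iterated concatenation: lengths are then treated by induction, without
    indices of a partition. *)
Inductive pw g : R -> R -> Prop :=
| pw_piece a b of a < b & C1_on a b g : pw g a b
| pw_cat a b c of pw g a b & pw g b c : pw g a c.

Lemma pw_lt g a b : pw g a b -> a < b.
Proof. by elim=> // {}a {}b c _ ab _ bc; exact: lt_trans bc. Qed.

Lemma piecewise_C1_pw a b g : a < b -> piecewise_C1 a b g -> pw g a b.
Proof.
move=> ab [s [+ H]]; elim: s a ab H => [a ab _ /itv_partition_nil e|c s IH a ab H].
  by rewrite e ltxx in ab.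
case=> /= /andP[ac cs] /eqP sb.
have ac1 : pw g a c by apply: pw_piece => //; exact: (H 0%N).
case: s => [|d s] in IH H cs sb *; first by rewrite -sb.
apply: (pw_cat ac1); apply: IH.
- have /allP/= h := order_path_min lt_trans cs.
  by have := h _ (mem_last d s); rewrite -sb.
- by move=> i si; apply: (H i.+1).
- by split=> //; apply/eqP.
Qed.

Lemma pw_piecewise_C1 a b g : pw g a b -> piecewise_C1 a b g.
Proof.
elim=> [{}a {}b ab gab|{}a {}b c _ [s [[/= sp /eqP sl] sH]] _ [s' [[/= s'p /eqP s'l] s'H]]].
  exists [:: b]; split; first by split => /=; rewrite ?ab.
  by case.
exists (s ++ s'); split.
  by split; rewrite ?cat_path ?last_cat sl ?sp ?s'l.
move=> i; rewrite size_cat => si.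
have [is_|si'] := ltnP i (size s).
  have := sH i is_; rewrite nth_cat is_ -cat_cons nth_cat /= ltnS (ltnW is_).
  by rewrite (set_nth_default c) ?(set_nth_default c b) //= ltnS ltnW.
have is' : (i - size s < size s')%N by rewrite ltn_subLR.
rewrite -(subnKC si'); move: is'; move: (i - size s)%N => j js'.
have -> : nth c (s ++ s') (size s + j) = nth c s' j.
  by rewrite nth_cat ltnNge leq_addr /= addKn.
have -> : nth c (a :: s ++ s') (size s + j) = nth c (b :: s') j.
  rewrite -cat_cons nth_cat /=; case: j {js'} => [|j]; last first.
    by rewrite addnS ltnS ltnNge leq_addr /= subSS addKn.
  by rewrite addn0 ltnSn -last_nth sl.
exact: s'H.
Qed.

Lemma pw_ind_C1d g (P : R -> R -> Prop) :
  (forall a b dg, a < b -> C1d a b g dg -> P a b) ->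
  (forall a b c, pw g a b -> P a b -> pw g b c -> P b c -> P a c) ->
  forall a b, pw g a b -> P a b.
Proof.
move=> H1 H2 a b; elim=> {a b} [a b ab /C1_onP[dg gdg]|a b c ab Pab bc Pbc].
  exact: (H1 _ _ _ ab gdg).
exact: H2 ab Pab bc Pbc.
Qed.

Lemma pw_C1d a b g dg : a < b -> C1d a b g dg -> pw g a b.
Proof. by move=> ab H; apply: pw_piece => //; apply/C1_onP; exists dg. Qed.

Lemma pw_eq a b g h : {in `[a, b], g =1 h} -> pw g a b -> pw h a b.
Proof.
move=> + gab; elim/pw_ind_C1d: gab => {a b} [a b dg ab gdg|a b c ab IHab bc IHbc] gh.
  exact: pw_C1d ab (C1d_eq gh gdg).
have ab' := pw_lt ab; have bc' := pw_lt bc.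
by apply: (@pw_cat _ a b c); [apply: IHab|apply: IHbc] => t;
  rewrite in_itv /= => tab; apply: gh; rewrite in_itv /=; lra.
Qed.

Lemma pw_affine a b k d g : 0 < k -> pw g a b ->
  pw (fun t => g (k * t + d)) ((a - d) / k) ((b - d) / k).
Proof.
move=> k0; have kN := lt0r_neq0 k0.
elim/pw_ind_C1d => {a b} [a b dg ab gdg|a b c ab IHab bc IHbc].
  apply: pw_C1d (C1d_affine (a := a) (b := b) kN _ gdg).
    by rewrite ltr_pM2r ?invr_gt0 // ltrD2r.
  move=> t; rewrite !in_itv /= ler_pdivrMr // ler_pdivlMr // [t * k]mulrC; lra.
exact: pw_cat IHab IHbc.
Qed.

Lemma pw_neg a b g : pw g a b -> pw (fun t => g (- t)) (- b) (- a).
Proof.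
elim/pw_ind_C1d => {a b} [a b dg ab gdg|a b c ab IHab bc IHbc].
  have H := C1d_affine (a := a) (b := b) (a' := - b) (b' := - a) (k := -1) (d := 0) _ _ gdg.
  apply: (@pw_C1d _ _ _ (fun t => (-1)%:C *: dg (-1 * t + 0))); first by rewrite ltrN2.
  apply: (C1d_eq _ (H _ _)) => //.
  - by move=> t _; rewrite mulN1r addr0.
  - by move=> t; rewrite !in_itv /=; lra.
exact: pw_cat IHbc IHab.
Qed.

Lemma pw_restrict a b s t g : pw g a b -> a <= s -> s < t -> t <= b -> pw g s t.
Proof.
move=> gab; elim/pw_ind_C1d: gab s t => {a b} [a b dg ab gdg|a b c ab IHab bc IHbc] s t as_ st tb.
  exact: pw_C1d st (C1d_sub as_ tb gdg).
have [tb'|bt] := leP t b; first exact: IHab.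
have [bs|sb] := leP b s; first exact: IHbc.
by apply: (@pw_cat _ s b t); [exact: IHab|apply: IHbc => //; exact: lexx].
Qed.

Lemma pw_continuous a b g : pw g a b -> forall t, t \in `[a, b] ->
  forall e : R, 0 < e -> exists2 r : R, 0 < r &
     forall s, s \in `[a, b] -> `|s - t| < r -> nm (g s - g t) < e.
Proof.
elim/pw_ind_C1d => {a b} [a b dg ab gdg t tab|a b c ab IHab bc IHbc t tac] e e0.
  exact: C1d_continuous gdg tab e e0.
have ab' := pw_lt ab; have bc' := pw_lt bc.
have [tb|bt|tb] := ltgtP t b.
- have [|r r0 H] := IHab t _ e e0; first by move: tac; rewrite !in_itv /=; lra.
  exists (Num.min r (b - t)); first by rewrite lt_min r0 subr_gt0.
  move=> s; rewrite in_itv /= => sac; rewrite lt_min => /andP[sr sb]; apply: H => //.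
  by move: sb; rewrite in_itv /= ltr_norml; lra.
- have [|r r0 H] := IHbc t _ e e0; first by move: tac; rewrite !in_itv /=; lra.
  exists (Num.min r (t - b)); first by rewrite lt_min r0 subr_gt0.
  move=> s; rewrite in_itv /= => sac; rewrite lt_min => /andP[sr sb]; apply: H => //.
  by move: sb; rewrite in_itv /= ltr_norml; lra.
- have [|r r0 H] := IHab t _ e e0; first by rewrite in_itv /=; lra.
  have [|r' r'0 H'] := IHbc t _ e e0; first by rewrite in_itv /=; lra.
  exists (Num.min r r'); first by rewrite lt_min r0.
  move=> s; rewrite in_itv /= => sac; rewrite lt_min => /andP[sr sr'].
  have [sb|bs] := leP s b; first by apply: H => //; rewrite in_itv /=; lra.
  by apply: H' => //; rewrite in_itv /=; lra.
Qed.

End Curves.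

Section KobayashiLength.
Context {R : realType} {n : nat}.
Local Notation Cn := 'rV[cplx R]_n.
Local Notation mu := (@lebesgue_measure R).
Implicit Types (D G : set Cn) (g h dg : R -> Cn) (a b c d k s t : R) (x y z w v : Cn).

Definition len D g a b : \bar R :=
  (\int[mu]_(t in `[a, b]) kobayashi_royden D (g t) (velocity g t))%E.

(** By [kr_usc], minus the integrand is lower semicontinuous. *)
Lemma measurable_kr_C1 D a b g dg : open D -> (forall t, t \in `[a, b] -> D (g t)) ->
  C1d a b g dg -> measurable_fun `]a, b[ (fun t => kobayashi_royden D (g t) (dg t)).
Proof.
move=> oD gD gdg.
(* The value -oo outside an open interval keeps lower semicontinuity on the whole line. *)
pose f t := if t \in `]a, b[ then (- kobayashi_royden D (g t) (dg t))%E else -oo%E.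
have mf : measurable_fun setT f.
  apply: lower_semicontinuous_measurable => t c; rewrite /f.
  case: ifPn => // tab; rewrite lteNr -EFinN => /(kr_usc oD)[e e0 He].
  have tcc : t \in `[a, b] by move: tab; rewrite !in_itv /=; lra.
  have [r1 r10 H1] := C1d_continuous gdg tcc e0.
  have [r2 r20 H2] := gdg.1 t tcc e e0.
  move: tab; rewrite in_itv /= => /andP[at_ tb].
  exists [set s | `|s - t| < Num.min (Num.min r1 r2) (Num.min (t - a) (b - t))].
    apply/nbhs_ballP; exists (Num.min (Num.min r1 r2) (Num.min (t - a) (b - t))) => /=.
      by rewrite !lt_min r10 r20 !subr_gt0 at_.
    by move=> s; rewrite -ball_normE /= distrC.
  move=> s /=; rewrite !lt_min => /andP[/andP[s1 s2] /andP[sa sb]].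
  have sab : s \in `]a, b[.
    by move: sa sb; rewrite in_itv /= !ltr_norml; lra.
  have scc : s \in `[a, b] by move: sab; rewrite !in_itv /=; lra.
  by rewrite sab lteNr -EFinN; apply: He; [exact: H1|exact: H2].
apply: (eq_measurable_fun (fun t => (- f t)%E)).
  by move=> t; rewrite inE /= /f => ->; rewrite oppeK.
by apply: measurable_funTS; exact: measurableT_comp.
Qed.

Lemma measurable_integrand D a b g : open D -> pw g a b ->
  (forall t, t \in `[a, b] -> D (g t)) ->
  measurable_fun `[a, b] (fun t => kobayashi_royden D (g t) (velocity g t)).
Proof.
move=> oD; elim/(@pw_ind_C1d R n g) => {a b} [a b dg ab gdg gD|a b c ab IHab bc IHbc gD].
  apply: (@emeasurable_fun_itv_cc _ _ _ false true).
  apply: eq_measurable_fun (measurable_kr_C1 oD gD gdg) => t.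
  by rewrite inE /= in_itv /= => /andP[at_ tb]; rewrite (C1d_velocity gdg).
have ab' := pw_lt ab; have bc' := pw_lt bc.
have -> : `[a, c]%classic = `[a, b] `|` `[b, c].
  apply/seteqP; split=> t /=; rewrite !in_itv /=; last by case; lra.
  by move=> tac; have [tb|bt] := leP t b; [left|right]; lra.
apply/measurable_funU => //; split; [apply: IHab|apply: IHbc] => t;
  rewrite in_itv /= => tab; apply: gD; rewrite in_itv /=; lra.
Qed.

(** The open interval is what matters: [velocity] is a two-sided limit and may be meaningless at the
    endpoints, which have measure zero. *)
Lemma len_C1 D a b g dg : open D -> a < b -> C1d a b g dg ->
  (forall t, t \in `[a, b] -> D (g t)) ->
  len D g a b = (\int[mu]_(t in `]a, b[) kobayashi_royden D (g t) (dg t))%E.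
Proof.
move=> oD ab gdg gD; have mf := measurable_integrand oD (pw_C1d ab gdg) gD.
rewrite /len -integral_itv_bndo_bndc; last first.
  by apply: measurable_funS mf => // t /=; rewrite !in_itv /=; lra.
rewrite -integral_itv_obnd_cbnd; last first.
  by apply: measurable_funS mf => // t /=; rewrite !in_itv /=; lra.
apply: eq_integral => t; rewrite inE /= in_itv /= => /andP[at_ tb].
by rewrite (C1d_velocity gdg).
Qed.

Lemma len_cat D a b c g : open D -> pw g a b -> pw g b c ->
  (forall t, t \in `[a, c] -> D (g t)) ->
  len D g a c = (len D g a b + len D g b c)%E.
Proof.
move=> oD ab bc gD; have ab' := pw_lt ab; have bc' := pw_lt bc.
have mf := measurable_integrand oD (pw_cat ab bc) gD.
have E : `[a, c]%classic = `[a, b[ `|` `[b, c].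
  apply/seteqP; split=> t /=; rewrite !in_itv /=; last by case; lra.
  by move=> tac; have [tb|bt] := ltP t b; [left|right]; lra.
rewrite /len E ge0_integral_setU //; last 3 first.
- by rewrite -E.
- by move=> t _; exact: kr_ge0.
- apply/disj_set2P; rewrite predeqE => t; split=> // -[/=].
  by rewrite !in_itv /=; lra.
congr (_ + _)%E; apply: integral_itv_bndo_bndc.
by apply: measurable_funS mf => // t /=; rewrite !in_itv /=; lra.
Qed.

Lemma len_ge0 D g a b : (0 <= len D g a b)%E.
Proof. by apply: integral_ge0 => t _; exact: kr_ge0. Qed.

Lemma kobayashi_lengthE D g : kobayashi_length D g = len D g 0 1.
Proof. by []. Qed.

(* Comparing two lengths by conversion would unfold the integrals. *)
Opaque len.

Lemma len_eq D a b g h : open D -> pw g a b -> {in `[a, b], g =1 h} ->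
  (forall t, t \in `[a, b] -> D (g t)) -> len D h a b = len D g a b.
Proof.
move=> oD; elim/(@pw_ind_C1d R n g) => {a b} [a b dg ab gdg gh gD|a b c ab IHab bc IHbc gh gD].
  rewrite (len_C1 oD ab gdg) // (len_C1 oD ab (C1d_eq gh gdg)); last first.
    by move=> t tab; have := gD t tab; rewrite (gh t tab).
  apply: eq_integral => t; rewrite inE /= in_itv /= => /andP[at_ tb].
  have tab : t \in `[a, b] by rewrite in_itv /= !ltW.
  by rewrite (gh t tab).
have ab' := pw_lt ab; have bc' := pw_lt bc.
have s1 t : t \in `[a, b] -> t \in `[a, c] by rewrite !in_itv /=; lra.
have s2 t : t \in `[b, c] -> t \in `[a, c] by rewrite !in_itv /=; lra.
have gh1 : {in `[a, b], g =1 h} by move=> t /s1; exact: gh.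
have gh2 : {in `[b, c], g =1 h} by move=> t /s2; exact: gh.
rewrite (len_cat oD (pw_eq gh1 ab) (pw_eq gh2 bc)); last first.
  by move=> t tac; have := gD t tac; rewrite (gh t tac).
have gD1 t : t \in `[a, b] -> D (g t) by move=> /s1; exact: gD.
have gD2 t : t \in `[b, c] -> D (g t) by move=> /s2; exact: gD.
have E1 := IHab gh1 gD1; have E2 := IHbc gh2 gD2; have E := len_cat oD ab bc gD.
by rewrite E E1 E2.
Qed.

Lemma len_affine D a b k d g : open D -> 0 < k -> pw g a b ->
  (forall t, t \in `[a, b] -> D (g t)) ->
  len D (fun t => g (k * t + d)) ((a - d) / k) ((b - d) / k) = len D g a b.
Proof.
move=> oD k0; have kN := lt0r_neq0 k0.
have itvP a' b' t : t \in `[(a' - d) / k, (b' - d) / k] -> k * t + d \in `[a', b'].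
  by rewrite !in_itv /= ler_pdivrMr // ler_pdivlMr // [t * k]mulrC; lra.
have lt' a' b' : a' < b' -> (a' - d) / k < (b' - d) / k.
  by move=> ab'; rewrite ltr_pM2r ?invr_gt0 // ltrD2r.
elim/(@pw_ind_C1d R n g) => {a b} [a b dg ab gdg gD|a b c ab IHab bc IHbc gD].
  rewrite (len_C1 oD ab gdg gD).
  rewrite (len_C1 oD (lt' _ _ ab) (C1d_affine kN (@itvP a b) gdg)); last first.
    by move=> t /itvP; exact: gD.
  rewrite -(@integral_affine R a b d k _ k0 (measurable_kr_C1 oD gD gdg)); last first.
    by move=> t _; exact: kr_ge0.
  by apply: eq_integral => t _; rewrite kr_scale // gtr0_norm.
have ab' := pw_lt ab; have bc' := pw_lt bc.
have s1 t : t \in `[a, b] -> t \in `[a, c] by rewrite !in_itv /=; lra.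
have s2 t : t \in `[b, c] -> t \in `[a, c] by rewrite !in_itv /=; lra.
rewrite (len_cat oD (pw_affine d k0 ab) (pw_affine d k0 bc)); last first.
  by move=> t /itvP; exact: gD.
have gD1 t : t \in `[a, b] -> D (g t) by move=> /s1; exact: gD.
have gD2 t : t \in `[b, c] -> D (g t) by move=> /s2; exact: gD.
have E1 := IHab gD1; have E2 := IHbc gD2; have E := len_cat oD ab bc gD.
by rewrite E E1 E2.
Qed.

Lemma len_neg D a b g : open D -> pw g a b ->
  (forall t, t \in `[a, b] -> D (g t)) ->
  len D (fun t => g (- t)) (- b) (- a) = len D g a b.
Proof.
move=> oD.
have itvP a' b' t : t \in `[- b', - a'] -> - t \in `[a', b'].
  by rewrite !in_itv /=; lra.
elim/(@pw_ind_C1d R n g) => {a b} [a b dg ab gdg gD|a b c ab IHab bc IHbc gD].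
  rewrite (len_C1 oD ab gdg gD).
  have N1 : -1 != 0 :> R by rewrite oppr_eq0 oner_eq0.
  have itvP' t : t \in `[- b, - a] -> -1 * t + 0 \in `[a, b].
    by rewrite mulN1r addr0; exact: itvP.
  have H : C1d (- b) (- a) (fun t => g (- t)) (fun t => (-1)%:C *: dg (-1 * t + 0)).
    by apply: C1d_eq (C1d_affine N1 itvP' gdg) => t _; rewrite mulN1r addr0.
  rewrite (len_C1 oD _ H) ?ltrN2 //; last by move=> t /itvP; exact: gD.
  rewrite -(integral_neg (measurable_kr_C1 oD gD gdg)); last first.
    by move=> t _; exact: kr_ge0.
  by apply: eq_integral => t _; rewrite kr_scale // normrN1 mul1e mulN1r addr0.
have ab' := pw_lt ab; have bc' := pw_lt bc.
have s1 t : t \in `[a, b] -> t \in `[a, c] by rewrite !in_itv /=; lra.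
have s2 t : t \in `[b, c] -> t \in `[a, c] by rewrite !in_itv /=; lra.
rewrite (len_cat oD (pw_neg bc) (pw_neg ab)); last first.
  by move=> t /itvP; exact: gD.
rewrite addeC; have gD1 t : t \in `[a, b] -> D (g t) by move=> /s1; exact: gD.
have gD2 t : t \in `[b, c] -> D (g t) by move=> /s2; exact: gD.
have E1 := IHab gD1; have E2 := IHbc gD2; have E := len_cat oD ab bc gD.
by rewrite E E1 E2.
Qed.

Lemma len_cst D a b x : open D -> D x -> a < b -> len D (fun=> x) a b = 0%E.
Proof.
move=> oD Dx ab; rewrite (len_C1 oD ab (C1d_cst a b x)) //.
have /open_nmP/(_ x Dx)[r r0 rD] := oD.
have -> : kobayashi_royden D x 0 = 0%E.
  apply/le_anti; rewrite kr_ge0 andbT.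
  by have := kr_ball 0 r0 rD; rewrite nm0 mul0r.
by rewrite integral0.
Qed.

End KobayashiLength.

Section KobayashiDistance.
Context {R : realType} {n : nat}.
Local Notation Cn := 'rV[cplx R]_n.
Local Notation mu := (@lebesgue_measure R).
Implicit Types (D G : set Cn) (g h dg : R -> Cn) (a b c d k s t : R) (x y z w v : Cn).

Lemma kob_ge0 D x y : (0 <= kobayashi D x y)%E.
Proof.
apply: le_ereal_inf_tmp => _ [g _ <-]; rewrite kobayashi_lengthE; exact: len_ge0.
Qed.

Lemma kob_ltP D x y (c : \bar R) : (kobayashi D x y < c)%E -> exists g,
  [/\ pw g 0 1, (forall t, t \in `[0, 1] -> D (g t)), g 0 = x, g 1 = y &
      (len D g 0 1 < c)%E].
Proof.
move=> /ereal_inf_lt[_ [g [pg gD g0 g1] <-]]; rewrite kobayashi_lengthE => gc.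
by exists g; split => //; exact: piecewise_C1_pw.
Qed.

Lemma kob_le_len D a b g : open D -> pw g a b -> (forall t, t \in `[a, b] -> D (g t)) ->
  (kobayashi D (g a) (g b) <= len D g a b)%E.
Proof.
move=> oD gab gD; have ab := pw_lt gab.
have k0 : 0 < b - a by rewrite subr_gt0.
have kN := lt0r_neq0 k0.
have e0 : (a - a) / (b - a) = 0 by rewrite subrr mul0r.
have e1 : (b - a) / (b - a) = 1 by rewrite divff.
have H := pw_affine a k0 gab; rewrite e0 e1 in H.
have L := len_affine a oD k0 gab gD; rewrite e0 e1 in L; rewrite -L.
rewrite -kobayashi_lengthE /kobayashi; apply: ereal_inf_lbound.
apply: imageP; split.
- exact: pw_piecewise_C1.
- by move=> t; rewrite in_itv /= => t01; apply: gD; rewrite in_itv /=; nra.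
- by rewrite mulr0 add0r.
- by rewrite mulr1 subrK.
Qed.

Lemma kob_refl D x : open D -> D x -> kobayashi D x x = 0%E.
Proof.
move=> oD Dx; apply/le_anti; rewrite kob_ge0 andbT.
rewrite -(len_cst oD Dx (ltr01 : (0 : R) < 1)).
apply: (kob_le_len (g := fun=> x) oD) => //.
exact: pw_C1d ltr01 (C1d_cst 0 1 x).
Qed.

Lemma kob_symm_le D x y : open D -> (kobayashi D y x <= kobayashi D x y)%E.
Proof.
move=> oD; apply: ereal_le_lt => b /kob_ltP[g [pg gD <- <- gb]]; apply: ltW.
have p := pw_neg pg; have L := len_neg oD pg gD; rewrite oppr0 in p L.
apply: le_lt_trans gb; rewrite -L.
have gD' t : t \in `[(-1), 0] -> D (g (- t)).
  by rewrite in_itv /= => t01; apply: gD; rewrite in_itv /=; lra.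
by have := kob_le_len oD p gD'; rewrite oppr0 opprK.
Qed.

Lemma kob_sym D x y : open D -> kobayashi D x y = kobayashi D y x.
Proof. by move=> oD; apply/le_anti; rewrite !kob_symm_le. Qed.

Lemma kob_triangle D y x z : open D ->
  (kobayashi D x z <= kobayashi D x y + kobayashi D y z)%E.
Proof.
move=> oD.
have [->|Nxy] := eqVneq (kobayashi D x y) +oo%E.
  by rewrite addye ?leey // gt_eqF // (lt_le_trans (ltNyr 0)) // kob_ge0.
have [->|Nyz] := eqVneq (kobayashi D y z) +oo%E.
  by rewrite addey ?leey // gt_eqF // (lt_le_trans (ltNyr 0)) // kob_ge0.
have f1 : kobayashi D x y \is a fin_num by rewrite ge0_fin_numE ?kob_ge0 // ltey.
have f2 : kobayashi D y z \is a fin_num by rewrite ge0_fin_numE ?kob_ge0 // ltey.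
apply/lee_addgt0Pr => e e0.
have [|g [pg gD g0 g1 gl]] := @kob_ltP D x y (kobayashi D x y + (e / 2)%:E)%E.
  by rewrite lteDl // lte_fin divr_gt0.
have [|h [ph hD h0 h1 hl]] := @kob_ltP D y z (kobayashi D y z + (e / 2)%:E)%E.
  by rewrite lteDl // lte_fin divr_gt0.
pose f t := if t <= 1 then g t else h (1 * t + (- 1)).
have gf : {in `[0, 1], g =1 f} by move=> t; rewrite in_itv /f /= => /andP[_ ->].
have p12 := pw_affine (-1) ltr01 ph.
have E0 : (0 - - 1) / 1 = 1 :> R by rewrite divr1 opprK add0r.
have E1 : (1 - - 1) / 1 = 2 :> R by rewrite divr1 opprK; ring.
rewrite E0 E1 in p12.
have hf : {in `[1, 2], (fun t => h (1 * t + (- 1))) =1 f}.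
  move=> t; rewrite in_itv /f /= => /andP[t1 _]; case: ifPn => // t1'.
  have -> : t = 1 by apply/le_anti; rewrite t1'.
  by rewrite mulr1 subrr h0 g1.
have hD' t : t \in `[1, 2] -> D (h (1 * t + (- 1))).
  by rewrite in_itv /= => t12; apply: hD; rewrite in_itv /=; lra.
have pf1 := pw_eq gf pg; have pf2 := pw_eq hf p12.
have fD t : t \in `[0, 2] -> D (f t).
  rewrite in_itv /f /= => t02; case: ifPn => [t1|].
    by apply: gD; rewrite in_itv /= t1 andbT; lra.
  by rewrite -ltNge => t1; apply: hD'; rewrite in_itv /=; lra.
have fz : f 2 = z.
  rewrite /f; have -> : ((2 : R) <= 1) = false by apply/negbTE; rewrite -ltNge; lra.
  by rewrite -h1; congr h; ring.
have fx : f 0 = x by rewrite /f ler01.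
have H := kob_le_len oD (pw_cat pf1 pf2) fD; rewrite fz fx in H.
apply: (le_trans H); rewrite (len_cat oD pf1 pf2 fD).
rewrite (len_eq oD pg gf gD) (len_eq oD p12 hf hD').
have := len_affine (-1) oD ltr01 ph hD; rewrite E0 E1 => ->.
apply: le_trans (leeD (ltW gl) (ltW hl)) _.
by rewrite addeACA -EFinD -splitr.
Qed.

Lemma kob_segment D x v (B : R) : open D ->
  (forall t, t \in `[0, 1] -> D (x + t%:C *: v)) ->
  (forall t, t \in `[0, 1] -> (kobayashi_royden D (x + t%:C *: v) v <= B%:E)%E) ->
  (kobayashi D x (x + v) <= B%:E)%E.
Proof.
move=> oD xD xB; have S := C1d_segment 0 1 x v.
have := kob_le_len oD (pw_C1d ltr01 S) xD.
rewrite scale0r addr0 scale1r => /le_trans; apply.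
rewrite (len_C1 oD ltr01 S xD).
have sub t : t \in `]0, 1[ -> t \in `[0, 1 : R] by rewrite !in_itv /=; lra.
apply: (@le_trans _ _ (\int[mu]_(t in `]0%R, 1%R[) (B%:E))%E).
  apply: ge0_le_integral => //=.
  - by move=> t _; exact: kr_ge0.
  - exact: measurable_kr_C1 S.
  - by move=> t /sub; exact: xB.
rewrite integral_cst //= lebesgue_measure_itv /= lte_fin ltr01 oppr0 adde0 mule1 //.
Qed.

(** F is the cumulative length of g for the metric of D. The last clause is the only access to it
    that later proofs need: a pointwise comparison of metrics with factor L on an arc bounds the
    distance for G by L times the increment of F. No integral appears from here on. *)
Definition param_curve D x y g (F : R -> R) :=
  [/\ (g 0 = x /\ g 1 = y), {within `[0, 1], continuous g},
      (forall t, t \in `[0, 1] -> D (g t)),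
      (F 0 = 0 /\ {within `[0, 1], continuous F}) &
      forall G (L : R) s t, 0 <= s -> s <= t -> t <= 1 -> open G -> 0 <= L ->
        (forall u, u \in `[s, t] -> G (g u) /\
          forall v, (kobayashi_royden G (g u) v <= L%:E * kobayashi_royden D (g u) v)%E) ->
        (kobayashi G (g s) (g t) <= (L * (F t - F s))%:E)%E].

Lemma kob_param D x y (l : \bar R) : open D -> (kobayashi D x y < l)%E ->
  exists g F, param_curve D x y g F /\ ((F 1)%:E < l)%E.
Proof.
move=> oD /kob_ltP[g [pg gD g0 g1 gl]].
have mphi := measurable_integrand oD pg gD.
set phi := (fun t => kobayashi_royden D (g t) (velocity g t)) in mphi.
have intphi : mu.-integrable `[0, 1] phi.
  apply/integrableP; split => //; apply: le_lt_trans (_ : _ <= len D g 0 1)%E _.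
    rewrite le_eqVlt; apply/orP; left; apply/eqP.
    transitivity (\int[mu]_(t in `[0%R, 1%R]) phi t)%E; last by [].
    by apply: eq_integral => t _; rewrite gee0_abs // kr_ge0.
  by apply: lt_le_trans gl _; exact: leey.
pose f t := fine (phi t).
have fphi t : t \in `[0, 1] -> (f t)%:E = phi t.
  by move=> t01; rewrite /f fineK // kr_fin //; exact: gD.
have intf : mu.-integrable `[0, 1] (EFin \o f).
  by apply: eq_integrable intphi => // t; rewrite inE /= => t01; rewrite fphi.
pose F t := \int[mu]_(u in `[0, t]) f u.
have lenF t : 0 < t -> t <= 1 -> len D g 0 t = (F t)%:E.
  move=> t0 t1.
  have sub : `[0, t]%classic `<=` `[0, 1 : R].
    by move=> u /=; rewrite !in_itv /=; lra.
  rewrite /F /Rintegral fineK; last first.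
    by apply: integrable_fin_num => //; apply: integrableS intf.
  transitivity (\int[mu]_(u in `[0%R, t]) phi u)%E; first by [].
  by apply: eq_integral => u; rewrite inE => /sub /fphi.
have F0 : F 0 = 0 by rewrite /F set_itv1 Rintegral_set1.
exists g, F; split; last by rewrite -lenF.
split => //.
- apply/subspace_continuousP => t t01; apply/cvg_nmP => e e0.
  by apply/near_within_itvP; exact: (pw_continuous pg).
- split=> //.
  exact: (@parameterized_integral_continuous R 0 1 f ler01 intf).
move=> G L s t s0 + t1 oG L0; rewrite le_eqVlt => /predU1P[<-|st] GL.
  have [|Gs _] := GL s; first by rewrite in_itv /= lexx.
  by rewrite subrr mulr0 kob_refl.
have Gg u : u \in `[s, t] -> G (g u) by move=> /GL[].
have pst := pw_restrict pg s0 st t1.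
have Dg u : u \in `[s, t] -> D (g u).
  by rewrite in_itv /= => ust; apply: gD; rewrite in_itv /=; lra.
apply: le_trans (kob_le_len oG pst Gg) _.
have -> : (L * (F t - F s))%:E = (L%:E * len D g s t)%E.
  rewrite EFinM; congr (_ * _)%E.
  have [s00|sN0] := eqVneq s 0; first by rewrite s00 F0 subr0 lenF // -s00.
  have s0' : 0 < s by rewrite lt_def sN0.
  have gD' u : u \in `[0, t] -> D (g u).
    by rewrite in_itv /= => ust; apply: gD; rewrite in_itv /=; lra.
  have := len_cat oD (pw_restrict pg (lexx 0) s0' (ltW (lt_le_trans st t1))) pst gD'.
  have t0 : 0 < t by lra.
  have s1 : s <= 1 by lra.
  rewrite (lenF t t0 t1) (lenF s s0' s1); move: (len D g s t) => [r||] //= [->].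
  by rewrite addrAC subrr add0r.
have -> : (L%:E * len D g s t)%E =
    (\int[mu]_(u in `[s, t]) (L%:E * kobayashi_royden D (g u) (velocity g u)))%E.
  by rewrite ge0_integralZl //; [exact: measurable_integrand|move=> u _; exact: kr_ge0].
apply: ge0_le_integral => //.
- by move=> u _; exact: kr_ge0.
- exact: measurable_integrand.
- by apply: measurable_funeM; exact: measurable_integrand.
- by move=> u /GL[_]; apply.
Qed.

End KobayashiDistance.

(** * Hopf-Rinow *)

Section CompactUniform.
Context {R : realType} {V : normedModType (cplx R)}.

(** A property monotone in e that holds locally for some e holds on a compact set for one e. A
    reciprocal e^-1 inside P serves to obtain uniform upper bounds as well. *)
Lemma compact_unif (K : set V) (P : R -> V -> Prop) : compact K ->
  (forall e e' y, 0 < e' -> e' <= e -> P e y -> P e' y) ->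
  (forall x, K x -> exists2 e : R, 0 < e & exists2 d : R, 0 < d &
     forall y, nm (y - x) < d -> P e y) ->
  exists2 e : R, 0 < e & forall y, K y -> P e y.
Proof.
move=> /compact_near_coveringP cK Pmono KP.
have [|e /= e0 H] := cK R (0:R)^'+ P _.
  move=> x /KP[e e0 [d d0 H]].
  exists ([set y | nm (y - x) < d], [set t : R | 0 < t /\ t <= e]).
    split; first exact: nbhs_nm.
    by near=> t; split; near: t; [exact: nbhs_right_gt|exact: nbhs_right_le].
  by move=> [y t] [/= yx [t0 te]]; exact: Pmono te (H y yx).
exists (e / 2); first by rewrite divr_gt0.
move=> y Ky; apply: (H (e / 2)) => //=; last by rewrite divr_gt0.
by rewrite sub0r normrN gtr0_norm ?divr_gt0 //; move: e0 => /= e0; lra.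
Unshelve. all: by end_near. Qed.

End CompactUniform.

Section ContinuousOnInterval.
Context {R : realType} {V : normedModType (cplx R)}.

Lemma continuous_itv_nmP (a b : R) (g : R -> V) :
  {within `[a, b], continuous g} <->
  forall t, t \in `[a, b] -> forall e : R, 0 < e -> exists2 r : R, 0 < r &
    forall s, s \in `[a, b] -> `|s - t| < r -> nm (g s - g t) < e.
Proof.
split.
  move=> /subspace_continuousP gc t tab e e0; apply/near_within_itvP.
  by have /cvg_nmP := gc t tab; apply.
move=> H; apply/subspace_continuousP => t tab; apply/cvg_nmP => e e0.
by apply/near_within_itvP; exact: H.
Qed.

Lemma continuous_itv_normP (a b : R) (f : R -> R) :
  {within `[a, b], continuous f} <->
  forall t, t \in `[a, b] -> forall e : R, 0 < e -> exists2 r : R, 0 < r &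
    forall s, s \in `[a, b] -> `|s - t| < r -> `|f s - f t| < e.
Proof.
split.
  move=> /subspace_continuousP gc t tab e e0; apply/near_within_itvP.
  have /cvgrPdist_lt/(_ e e0) := gc t tab.
  by apply: filterS => s; rewrite distrC.
move=> H; apply/subspace_continuousP => t tab; apply/cvgrPdist_lt => e e0.
apply/near_within_itvP; have [r r0 {}H] := H t tab e e0.
by exists r => // s sab st; rewrite distrC; exact: H.
Qed.

End ContinuousOnInterval.

Section KobayashiMetric.
Context {R : realType} {n : nat}.
Local Notation Cn := 'rV[cplx R]_n.
Variable G : set Cn.
Hypothesis oG : open G.
Hypothesis fin : forall x y, G x -> G y -> (kobayashi G x y < +oo)%E.
Implicit Types (x y z : Cn).

Definition kd x y : R := fine (kobayashi G x y).

Lemma kobE x y : G x -> G y -> kobayashi G x y = (kd x y)%:E.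
Proof. by move=> Gx Gy; rewrite /kd fineK // ge0_fin_numE ?kob_ge0 // fin. Qed.

Lemma kd_ge0 x y : 0 <= kd x y.
Proof. by rewrite /kd fine_ge0 // kob_ge0. Qed.

Lemma kd_sym x y : kd x y = kd y x.
Proof. by rewrite /kd kob_sym. Qed.

Lemma kd_refl x : G x -> kd x x = 0.
Proof. by move=> Gx; rewrite /kd kob_refl. Qed.

Lemma kd_triangle y x z : G x -> G y -> G z -> kd x z <= kd x y + kd y z.
Proof.
move=> Gx Gy Gz; rewrite -lee_fin EFinD -!kobE //; exact: kob_triangle.
Qed.

Lemma kd_local x : G x -> exists2 r : R, 0 < r &
  (forall y, nm (y - x) < r -> G y) /\
  forall y, nm (y - x) < r -> kd x y <= nm (y - x) / r.
Proof.
move=> Gx; have /open_nmP/(_ x Gx)[r r0 rG] := oG.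
exists (r / 2); first by rewrite divr_gt0.
have rG' y : nm (y - x) < r / 2 -> G y by move=> yx; apply: rG; lra.
split=> // y yx; rewrite -lee_fin -kobE //; last exact: rG'.
have -> : y = x + (y - x) by rewrite addrC subrK.
rewrite [X in nm (X - x)]addrC subrK.
have seg t w : t \in `[0, 1] -> nm (w - (x + t%:C *: (y - x))) < r / 2 -> nm (w - x) < r.
  rewrite in_itv /= => t01 H; apply: le_lt_trans (nm_triangle (x + t%:C *: (y - x)) _ _) _.
  rewrite addrAC subrr add0r nmZR ger0_norm; last lra.
  by have := nm_ge0 (y - x); nra.
apply: kob_segment => // t t01.
  by apply: rG; apply: (seg t) => //; rewrite subrr nm0 divr_gt0.
apply: kr_ball; first by rewrite divr_gt0.
by move=> w H; apply: rG; exact: (seg t).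
Qed.

Lemma kd_continuous x (e : R) : G x -> 0 < e -> exists2 d : R, 0 < d &
  (forall y, nm (y - x) < d -> G y) /\ forall y, nm (y - x) < d -> kd x y < e.
Proof.
move=> /kd_local[r r0 [rG rk]] e0; exists (Num.min r (r * e)); first by rewrite lt_min r0 mulr_gt0.
split=> y; rewrite lt_min => /andP[yr yre]; first exact: rG.
by apply: le_lt_trans (rk y yr) _; rewrite ltr_pdivrMr // mulrC.
Qed.

Lemma kd_le_param x y g F s t : param_curve G x y g F -> 0 <= s -> s <= t -> t <= 1 ->
  kd (g s) (g t) <= F t - F s.
Proof.
move=> [_ _ gG _ H] s0 st t1; have := H G 1 s t s0 st t1 oG ler01.
rewrite mul1r kobE ?lee_fin; first apply.
- by move=> u; rewrite in_itv /= => ust; split; [apply: gG; rewrite in_itv /=; lra|move=> v; rewrite mul1e].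
- by apply: gG; rewrite in_itv /=; lra.
- by apply: gG; rewrite in_itv /=; lra.
Qed.

Lemma param_exists x y (l : R) : G x -> G y -> kd x y < l ->
  exists g F, param_curve G x y g F /\ F 1 < l.
Proof.
move=> Gx Gy xyl; have [|g [F [H Fl]]] := @kob_param R n G x y l%:E oG.
  by rewrite kobE // lte_fin.
by exists g, F; split.
Qed.

Lemma nm_curve_continuous x y g F : param_curve G x y g F -> forall z,
  {within `[0, 1], continuous (fun t => nm (g t - z))}.
Proof.
move=> [_ gc _ _ _] z; apply/continuous_itv_normP => t t01 e e0.
have /continuous_itv_nmP/(_ t t01 e e0)[r r0 H] := gc.
exists r => // s s01 st; apply: le_lt_trans (nm_dist _ _) _.
by rewrite opprB addrA subrK; exact: H.
Qed.

Hypothesis sep : forall x y, G x -> G y -> kobayashi G x y = 0%E -> x = y.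

Lemma kd_eq0 x y : G x -> G y -> kd x y = 0 -> x = y.
Proof. by move=> Gx Gy xy; apply: sep => //; rewrite kobE // xy. Qed.

(** On a small sphere about x the distance to x is bounded below, by separation, continuity and
    compactness. A curve from x to a point outside crosses that sphere, so it cannot be short. *)
Lemma kd_topology x (e : R) : G x -> 0 < e -> exists2 d : R, 0 < d &
  forall y, G y -> kd x y < d -> nm (y - x) < e.
Proof.
move=> Gx e0; have /open_nmP/(_ x Gx)[r r0 rG] := oG.
pose e' := Num.min e (r / 2).
have e'0 : 0 < e' by rewrite lt_min e0 divr_gt0.
have e'e : e' <= e by rewrite ge_min lexx.
have e'r : e' < r by apply: (@le_lt_trans _ _ (r / 2)); [rewrite ge_min lexx orbT|lra].
pose S := [set y | nm (y - x) = e'].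
have SG y : S y -> G y by move=> /= Sy; apply: rG; rewrite Sy.
have cS : compact S.
  apply: (subclosed_compact _ (@compact_nm_ball R n x e')); last by move=> y /= ->.
  have -> : S = (fun y => nm (y - x)) @^-1` [set e'] by [].
  apply: preimage_closed; last exact: closed_eq.
  by move=> y _; exact: nm_sub_continuous.
have [||d d0 Hd] := @compact_unif R _ S (fun d y => d <= kd x y) cS.
- by move=> a b y _ ba ay; exact: le_trans ba ay.
- move=> y Sy; have Gy := SG y Sy.
  have k0 : 0 < kd x y.
    rewrite lt_def kd_ge0 andbT; apply/eqP => /(kd_eq0 Gx Gy) xy.
    by move: Sy e'0; rewrite /S /= -xy subrr nm0 => <-; rewrite ltxx.
  exists (kd x y / 2); first by rewrite divr_gt0.
  have [|d d0 [dG dk]] := @kd_continuous y (kd x y / 2) Gy; first by rewrite divr_gt0.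
  exists d => // z zy; have := @kd_triangle z x y Gx (dG z zy) Gy.
  by have := dk z zy; rewrite (kd_sym z y); lra.
exists d => // y Gy xyd; apply: lt_le_trans e'e; rewrite ltNge; apply/negP => ye'.
have [g [F [gF Fd]]] := param_exists Gx Gy xyd.
have [[g0 g1] gc gG [F0 Fc] _] := gF.
have [t t01 te] : exists2 t, t \in `[0, 1] & nm (g t - x) = e'.
  apply: IVT; [exact: ler01|exact: nm_curve_continuous gF _|].
  by rewrite g0 g1 subrr nm0 (min_l (nm_ge0 _)) (max_r (nm_ge0 _)) (ltW e'0) ye'.
move: (t01); rewrite in_itv /= => /andP[t0 t1].
have := Hd (g t) te; rewrite leNgt => /negP; apply.
rewrite -{1}g0; apply: le_lt_trans (kd_le_param gF (lexx 0) t0 t1) _.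
rewrite F0 subr0; apply: le_lt_trans Fd.
by have := kd_le_param gF t0 t1 (lexx 1); have := kd_ge0 (g t) (g 1); lra.
Qed.

End KobayashiMetric.

Section HopfRinow.
Context {R : realType} {n : nat}.
Local Notation Cn := 'rV[cplx R]_n.
Variable G : set Cn.
Hypothesis oG : open G.
Hypothesis fin : forall x y, G x -> G y -> (kobayashi G x y < +oo)%E.
Hypothesis sep : forall x y, G x -> G y -> kobayashi G x y = 0%E -> x = y.
Implicit Types (x y z : Cn).
Local Notation kd := (kd G).

Let tri y x z : G x -> G y -> G z -> kd x z <= kd x y + kd y z.
Proof. exact: kd_triangle. Qed.

Definition kball x (r : R) : set Cn := [set y | G y /\ kd x y <= r].

Lemma kball_compact_sub (K : set Cn) x (r : R) : compact K -> K `<=` G -> G x ->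
  kball x r `<=` K -> compact (kball x r).
Proof.
move=> cK KG Gx sub; apply: (subclosed_compact _ cK sub).
move=> y /closure_nmP ycl.
have Ky : K y.
  apply: (compact_closed _ cK); first exact: norm_hausdorff.
  by apply/closure_nmP => e /ycl[z /sub]; exists z.
split; first exact: KG.
apply/ler_addgt0Pr => e e0.
have [d d0 [dG dk]] := kd_continuous oG fin (KG y Ky) e0.
have [z [Gz xz] zy] := ycl d d0.
by have := tri Gx Gz (KG y Ky); have := dk z zy; rewrite (kd_sym oG y z); lra.
Qed.

Lemma kball_compact_local x : G x -> exists2 r : R, 0 < r & compact (kball x r).
Proof.
move=> Gx; have /open_nmP/(_ x Gx)[r r0 rG] := oG.
have [|d d0 Hd] := kd_topology oG fin sep (e := r / 2) Gx; first by rewrite divr_gt0.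
exists (d / 2); first by rewrite divr_gt0.
apply: (kball_compact_sub (K := [set y | nm (y - x) <= r / 2])) => //.
- exact: compact_nm_ball.
- by move=> y /= yx; apply: rG; lra.
- by move=> y [Gy xy] /=; apply: ltW; apply: Hd => //; lra.
Qed.

Lemma kball_compact_shift x y (r r' : R) : G x -> G y -> compact (kball x r) ->
  kd x y + r' <= r -> compact (kball y r').
Proof.
move=> Gx Gy cx xyr; apply: (kball_compact_sub cx) => //; first by move=> z [].
by move=> z [Gz yz]; split=> //; have := tri Gx Gy Gz; lra.
Qed.

Lemma kd_midpoint x y (a e : R) : G x -> G y -> 0 <= a -> a <= kd x y -> 0 < e ->
  exists z, [/\ G z, kd x z <= a & kd z y <= kd x y - a + e].
Proof.
move=> Gx Gy a0 axy e0.
have [|g [F [gF Fl]]] := @param_exists R n G oG fin x y (kd x y + e) Gx Gy.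
  by rewrite ltrDl.
have [[g0 g1] gc gG [F0 Fc] _] := gF.
have Fxy : kd x y <= F 1.
  by have := kd_le_param oG fin gF (lexx 0) ler01 (lexx 1); rewrite F0 g0 g1 subr0.
have [t t01 te] : exists2 t, t \in `[0, 1] & F t = a.
  apply: IVT => //; rewrite F0.
  have F10 : 0 <= F 1 by apply: le_trans Fxy; exact: kd_ge0.
  by rewrite (min_l F10) (max_r F10) a0 /=; lra.
move: (t01); rewrite in_itv /= => /andP[t0 t1].
exists (g t); split; first exact: gG.
  by have := kd_le_param oG fin gF (lexx 0) t0 t1; rewrite F0 g0 te subr0.
by have := kd_le_param oG fin gF t0 t1 (lexx 1); rewrite g1 te; lra.
Qed.

Lemma ultra_map (T U : Type) (f : T -> U) (F : set_system T) :
  UltraFilter F -> UltraFilter (f @ F).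
Proof.
move=> FU; split; first exact: fmap_proper_filter.
move=> H HP sub; apply/seteqP; split=> // A HA.
have [//|FnA] := in_ultra_setVsetC (f @^-1` A) FU.
have HnA : H (~` A) by apply: sub.
by have /filter_ex[z []] : H (A `&` ~` A) by exact: filterI.
Qed.

(* Points at distance at most [t + c/4] from [x] are within [c/2] of the compact
   ball of radius [t]; follow such nearby points along an ultrafilter. *)
Lemma kball_compact_extend x (t c : R) : G x -> 0 <= t -> 0 < c ->
  compact (kball x t) -> (forall y, kball x t y -> compact (kball y c)) ->
  compact (kball x (t + c / 4)).
Proof.
move=> Gx t0 c0; rewrite compact_ultra => ct cc F FU FB.
have FP : ProperFilter F by exact: ultra_proper.
have near_pt y : exists z, kball x (t + c / 4) y -> kball x t z /\ kd z y <= c / 2.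
  have [[Gy xy]|] := pselect (kball x (t + c / 4) y); last by exists x.
  have [xyt|txy] := leP (kd x y) t.
    by exists y => _; split => //; rewrite (kd_refl oG Gy) divr_ge0 // ltW.
  have [||z [Gz xz zy]] := kd_midpoint (a := t) (e := c / 4) Gx Gy t0.
  - exact: ltW.
  - by rewrite divr_gt0.
  - by exists z => _; split => //; lra.
have [q Hq] := choice near_pt.
have [|z [[Gz xz] qz]] := ct (q @ F) (ultra_map q FU).
  suff FQ : F (q @^-1` kball x t) by exact: FQ.
  by apply: filterS FB => y By; exact: (Hq y By).1.
have c4 : 0 < c / 4 by rewrite divr_gt0.
have [d d0 [dG dk]] := kd_continuous oG fin Gz c4.
have Fz : F (kball z c).
  have Fq : F (q @^-1` [set y | nm (y - z) < d]) := qz _ (nbhs_nm z d0).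
  apply: filterS (filterI FB Fq) => y [[Gy xy] /= qyz]; split=> //.
  have [[Gqy _] qy] := Hq y (conj Gy xy).
  by have := tri Gz Gqy Gy; have := dk _ qyz; lra.
have [p [[Gp zp] Fp]] : kball z c `&` [set p | F --> p] !=set0.
  by have := cc z (conj Gz xz); apply.
exists p; split=> //; split => //.
apply/ler_addgt0Pr => e e0.
have [r r0 [rG rk]] := kd_continuous oG fin Gp e0.
have Fr : F [set y | nm (y - p) < r] := Fp _ (nbhs_nm p r0).
have [y [[Gy xy] /= yp]] := filter_ex (filterI FB Fr).
by have := tri Gx Gy Gp; have := rk y yp; rewrite (kd_sym oG p y); lra.
Qed.

(** Starting from radius 0, eight extensions by s / 8 reach radius s; s / 8 is c / 4 for the
    hypothesis radius c = s / 2. *)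
Lemma kball_compact_half x (s : R) : G x -> 0 < s ->
  (forall y, kball x s y -> compact (kball y (s / 2))) -> compact (kball x s).
Proof.
move=> Gx s0 H.
have step k : compact (kball x (Num.min s (k%:R * (s / 8)))).
  elim: k => [|k IH].
    rewrite mul0r min_r ?ltW //.
    have Bx : kball x s x by split => //; rewrite (kd_refl oG Gx) ltW.
    by apply: (kball_compact_shift Gx Gx (H x Bx)); rewrite (kd_refl oG Gx) add0r ltW // divr_gt0.
  have [sk|ks] := leP s (k%:R * (s / 8)).
    have sk1 : s <= k.+1%:R * (s / 8).
      by apply: le_trans sk _; rewrite ler_pM2r ?divr_gt0 // ler_nat.
    by move: IH; rewrite (min_l sk) (min_l sk1).
  rewrite (min_r (ltW ks)) in IH.
  have k0 : 0 <= k%:R * (s / 8) by rewrite mulr_ge0 // divr_ge0 // ltW.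
  have := kball_compact_extend (c := s / 2) Gx k0 _ IH; rewrite divr_gt0 // => /(_ isT).
  move=> /(_ _)/wrap[|C].
    by move=> y [Gy xy]; apply: H; split => //; lra.
  apply: (kball_compact_shift Gx Gx C); rewrite (kd_refl oG Gx) add0r.
  by rewrite ge_min; apply/orP; right; rewrite -natr1; lra.
have := step 8%N; rewrite min_l //; lra.
Qed.

Hypothesis complete : forall u : nat -> Cn, (forall k, G (u k)) -> kobayashi_cauchy G u ->
  exists2 x, G x & kobayashi G (u k) x @[k --> \oo] --> 0%E.

(** A noncompact ball of radius r contains the centre of a noncompact ball of radius r / 2.
    Iterating gives a Cauchy sequence of centres; its limit has a compact ball of positive radius,
    which eventually contains the noncompact ones. *)
Theorem hopf_rinow x (r : R) : G x -> compact (kball x r).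
Proof.
move=> Gx; have [r0|r0] := leP r 0.
  have [s s0 cs] := kball_compact_local Gx.
  by apply: (kball_compact_shift Gx Gx cs); rewrite (kd_refl oG Gx); lra.
apply: contrapT => ncx.
pose inv (p : Cn * R) := [/\ G p.1, 0 < p.2 & ~ compact (kball p.1 p.2)].
have step (p : Cn * R) : exists q : Cn * R, inv p -> [/\ inv q, q.2 = p.2 / 2 & kd p.1 q.1 <= p.2].
  have [[Gp p0 np]|] := pselect (inv p); last by exists p.
  have [y [[Gy py] ny]] : exists y, kball p.1 p.2 y /\ ~ compact (kball y (p.2 / 2)).
    apply: contrapT => H; apply: np; apply: kball_compact_half => // y By.
    by apply: contrapT => ny; apply: H; exists y.
  by exists (y, p.2 / 2) => _; split => //; split => //=; rewrite divr_gt0.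
have [f Hf] := choice step.
pose u := fix u k := if k is k'.+1 then f (u k') else (x, r).
have uinv k : inv (u k) by elim: k => [//|k IH]; case: (Hf _ IH).
have u2 k : (u k).2 = r / 2 ^+ k.
  elim: k => [|k IH]; first by rewrite expr0 divr1.
  by have [_ -> _] := Hf _ (uinv k); rewrite -/(u k) IH exprSr invfM mulrA.
(* The geometric tail is written as a difference so that the induction telescopes. *)
have ukd k m : kd (u k).1 (u (k + m)%N).1 <= 2 * r / 2 ^+ k - 2 * r / 2 ^+ (k + m).
  elim: m => [|m IH].
    by rewrite addn0 subrr (kd_refl oG) //; case: (uinv k).
  have [_ _ D] := Hf _ (uinv (k + m)%N).
  have [G1 _ _] := uinv k; have [G2 _ _] := uinv (k + m)%N.
  have [G3 _ _] := uinv (k + m).+1.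
  rewrite addnS; apply: le_trans (tri G1 G2 G3) _.
  rewrite -[f _]/(u (k + m).+1) u2 in D.
  have -> : 2 * r / 2 ^+ (k + m).+1 = r / 2 ^+ (k + m).
    by rewrite exprS invfM mulrACA divff // mul1r.
  have E : 2 * r / 2 ^+ (k + m) = 2 * (r / 2 ^+ (k + m)) by rewrite mulrA.
  by rewrite E in IH; lra.
have pow_small (e : R) : 0 < e -> exists N, forall k, (N <= k)%N -> 2 * r / 2 ^+ k < e.
  move=> e0; have : (fun k => 2 * r * (2^-1) ^+ k) @ \oo --> (0 : R).
    have := @cvg_geometric R (2 * r) (2^-1); apply.
    by rewrite ger0_norm ?invr_ge0 // invf_lt1 // ltr1n.
  move/cvgrPdist_lt => /(_ _ e0)[N _ HN]; exists N => k Nk.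
  have := HN k Nk; rewrite sub0r normrN exprVn => /(le_lt_trans _); apply; exact: ler_norm.
have ukd' k m : (k <= m)%N -> kd (u k).1 (u m).1 <= 2 * r / 2 ^+ k.
  move=> km; rewrite -(subnKC km); apply: le_trans (ukd _ _) _.
  by rewrite lerBlDr lerDl divr_ge0 // ?exprn_ge0 // mulr_ge0 // ltW.
have Gu k : G (u k).1 by case: (uinv k).
have [|y Gy uy] := complete (u := fun k => (u k).1) Gu.
  move=> e e0; have [N HN] := pow_small e e0.
  exists N => i j Ni Nj; rewrite (kobE fin) // lte_fin.
  have [ij|ji] := leqP i j; first exact: le_lt_trans (ukd' _ _ ij) (HN _ Ni).
  by rewrite (kd_sym oG); exact: le_lt_trans (ukd' _ _ (ltnW ji)) (HN _ Nj).
have [c c0 cy] := kball_compact_local Gy.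
have c2 : 0 < c / 2 by rewrite divr_gt0.
have [N1 HN1] : exists N, forall k, (N <= k)%N -> kd (u k).1 y < c / 2.
  have uy' : kd (u k).1 y @[k --> \oo] --> 0.
    have := fine_cvg uy; apply.
  move/cvgrPdist_lt : uy' => /(_ _ c2)[N _ HN]; exists N => k Nk.
  by have := HN k Nk; rewrite sub0r normrN => /(le_lt_trans _); apply; exact: ler_norm.
have [N2 HN2] := pow_small c c0.
pose k := maxn N1 N2; have [_ _] := uinv k; apply.
apply: (kball_compact_shift Gy (Gu k) cy); rewrite (kd_sym oG) u2.
have := HN1 k (leq_maxl _ _); have := HN2 k (leq_maxr _ _).
by rewrite -mulrA; lra.
Qed.

(** Almost minimal curves, parametrized by length, stay in a compact ball and converge pointwise
    along an ultrafilter. *)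
Theorem geodesic_exists x y : G x -> G y ->
  exists g, [/\ geodesic G `[0, kd x y] g, g 0 = x & g (kd x y) = y].
Proof.
move=> Gx Gy; set L := kd x y.
have L0 : 0 <= L by exact: kd_ge0.
have [ei [ei0 ei1 eie]] : exists ei : nat -> R, [/\ forall k, 0 < ei k,
    forall k, ei k <= 1 & forall e : R, 0 < e -> \forall k \near \oo, ei k < e].
  exists (fun k => k.+1%:R^-1); split=> [k|k|e e0]; first by rewrite invr_gt0.
    by rewrite invf_le1 // ler1n.
  exact: near_infty_natSinv_lt (PosNum e0).
(* The point at parameter t is the one where the cumulative length equals t. Continuity of these
   curves in t is not claimed: the limit will be an isometry, hence continuous. *)
have almost (k : nat) : exists g, forall t, t \in `[0, L] ->
    [/\ G (g t), kd x (g t) <= t + ei k, kd (g t) y <= L - t + ei k &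
    forall s, s \in `[0, L] -> s <= t -> kd (g s) (g t) <= t - s + ei k].
  have k0 := ei0 k.
  have [|g [F [gF Fl]]] := @param_exists R n G oG fin x y (L + ei k) Gx Gy.
    by rewrite ltrDl.
  have [[g0 g1] gc gG [F0 Fc] _] := gF.
  have LF : L <= F 1.
    by have := kd_le_param oG fin gF (lexx 0) ler01 (lexx 1); rewrite F0 g0 g1 subr0.
  have F10 : 0 <= F 1 by exact: le_trans LF.
  have tau t : exists u, t \in `[0, L] -> u \in `[0, 1] /\ F u = t.
    have [tL|] := boolP (t \in `[0, L]); last by exists 0.
    have [|u u01 Fu] := @IVT R F 0 1 t ler01 Fc; last by exists u.
    rewrite F0 (min_l F10) (max_r F10); move: tL; rewrite in_itv /= => /andP[-> tL].
    exact: le_trans LF.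
  have [p Hp] := choice tau; exists (fun t => g (p t)) => t tL.
  have [pt Fp] := Hp t tL; move: (pt); rewrite in_itv /= => /andP[p0 p1].
  split; first exact: gG.
  - by have := kd_le_param oG fin gF (lexx 0) p0 p1; rewrite F0 g0 Fp; lra.
  - by have := kd_le_param oG fin gF p0 p1 (lexx 1); rewrite g1 Fp; lra.
  move=> s sL st; have [ps Fs] := Hp s sL.
  move: (ps); rewrite in_itv /= => /andP[s0 s1].
  have [spt|pts] := leP (p s) (p t).
    by have := kd_le_param oG fin gF s0 spt p1; rewrite Fp Fs; lra.
  have := kd_le_param oG fin gF p0 (ltW pts) s1; rewrite (kd_sym oG) Fp Fs.
  by have := kd_ge0 G (g (p s)) (g (p t)); lra.
have [g Hg] := choice almost.
(* One ultrafilter gives the limits for all t at once, in place of equicontinuity and a diagonal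
   subsequence. *)
have [U [UU sub]] := @ultraFilterLemma nat \oo _.
have UF : ProperFilter U by exact: ultra_proper.
have lim_ex t : exists z, t \in `[0, L] -> G z /\ (fun k => g k t) @ U --> z.
  have [tL|] := boolP (t \in `[0, L]); last by exists x.
  have := @hopf_rinow x (L + 1) Gx; rewrite compact_ultra.
  move=> /(_ ((fun k => g k t) @ U) (ultra_map _ UU) _)/wrap[|[z [[Gz _] gz]]]; last by exists z.
  suff UK : U ((fun k => g k t) @^-1` kball x (L + 1)) by exact: UK.
  apply: filterE => k; have [Ggt gt _ _] := Hg k t tL; split => //.
  have := ei1 k.
  by move: tL; rewrite in_itv /=; lra.
have [h Hh] := choice lim_ex.
have approx t (e : R) : t \in `[0, L] -> 0 < e -> U [set k | kd (h t) (g k t) < e].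
  move=> tL e0; have [Ght gh] := Hh t tL.
  have [d d0 [_ dk]] := kd_continuous oG fin Ght e0.
  have Ud : U ((fun k => g k t) @^-1` [set y | nm (y - h t) < d]) := gh _ (nbhs_nm (h t) d0).
  by apply: filterS Ud => k; exact: dk.
have small (e : R) : 0 < e -> U [set k | ei k < e].
  by move=> e0; apply: sub; exact: eie.
have hx t : t \in `[0, L] -> kd x (h t) <= t.
  move=> tL; have [Ght _] := Hh t tL; apply/ler_addgt0Pr => e e0.
  have e2 : 0 < e / 2 by rewrite divr_gt0.
  have [k [/= k1 k2]] := filter_ex (filterI (approx t _ tL e2) (small _ e2)).
  have [Gg xg _ _] := Hg k t tL.
  by have := tri Gx Gg Ght; rewrite (kd_sym oG (g k t) (h t)); lra.
have hy t : t \in `[0, L] -> kd (h t) y <= L - t.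
  move=> tL; have [Ght _] := Hh t tL; apply/ler_addgt0Pr => e e0.
  have e2 : 0 < e / 2 by rewrite divr_gt0.
  have [k [/= k1 k2]] := filter_ex (filterI (approx t _ tL e2) (small _ e2)).
  have [Gg _ gy _] := Hg k t tL.
  by have := tri Ght Gg Gy; lra.
have hle s t : s \in `[0, L] -> t \in `[0, L] -> s <= t -> kd (h s) (h t) <= t - s.
  move=> sL tL st; have [Ght _] := Hh t tL; have [Ghs _] := Hh s sL.
  apply/ler_addgt0Pr => e e0.
  have e3 : 0 < e / 3 by rewrite divr_gt0.
  have [k [/= [k1 k2] k3]] := filter_ex (filterI (filterI (approx t _ tL e3)
     (approx s _ sL e3)) (small _ e3)).
  have [Gg _ _ gst] := Hg k t tL; have [Gs _ _ _] := Hg k s sL.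
  have := gst s sL st; have := tri Ghs Gs Ght; have := tri Gs Gg Ght.
  by rewrite (kd_sym oG (g k t) (h t)); lra.
have hE s t : s \in `[0, L] -> t \in `[0, L] -> kd (h s) (h t) = `|s - t|.
  (* The upper bounds on the three legs x, h s', h t', y add up to L, the distance from x to y, so
     each of them is an equality. *)
  have half s' t' : s' \in `[0, L] -> t' \in `[0, L] -> s' <= t' -> kd (h s') (h t') = t' - s'.
    move=> sL tL st; apply/le_anti; rewrite hle //=.
    have [Ght _] := Hh t' tL; have [Ghs _] := Hh s' sL.
    have := tri Gx Ghs Gy; have := tri Ghs Ght Gy.
    by have := hx s' sL; have := hy t' tL; rewrite -/L; lra.
  move=> sL tL; have [st|ts] := leP s t.
    by rewrite half // distrC ger0_norm // subr_ge0.
  by rewrite (kd_sym oG) half ?(ltW ts) // ger0_norm // subr_ge0 ltW.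
have zL : 0 \in `[0, L] by rewrite in_itv /= lexx.
have LL : L \in `[0, L] by rewrite in_itv /= lexx L0.
exists h; split.
- split.
  + exact: interval_is_interval.
  + apply/continuous_itv_nmP => t tL e e0; have [Ght _] := Hh t tL.
    have [d d0 Hd] := kd_topology oG fin sep Ght e0.
    exists d => // s sL st; have [Ghs _] := Hh s sL.
    by apply: Hd => //; rewrite hE // distrC.
  + by move=> t /Hh[].
  + move=> s t sL tL; have [Ght _] := Hh t tL; have [Ghs _] := Hh s sL.
    by rewrite (kobE fin) // hE.
- have [Gh0 _] := Hh 0 zL; apply/esym; apply: (kd_eq0 fin sep) => //.
  by apply/le_anti; rewrite kd_ge0 hx.
- have [GhL _] := Hh L LL; apply: (kd_eq0 fin sep) => //.
  by apply/le_anti; rewrite kd_ge0 andbT; have := hy L LL; rewrite subrr.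
Qed.

End HopfRinow.

(** * Peak functions *)

Section EntireFunctions.
Context {R : realType} {n : nat}.
Local Notation Cn := 'rV[cplx R]_n.
Implicit Types (x y v m : Cn) (P Q : Cn -> cplx R).

Definition lin (a : 'I_n -> cplx R) x : cplx R := \sum_j x ord0 j * a j.

Lemma linB a x y : lin a (x - y) = lin a x - lin a y.
Proof. by rewrite /lin -sumrB; apply: eq_bigr => j _; rewrite !mxE mulrBl. Qed.

Lemma linZ a (c : cplx R) x : lin a (c *: x) = c * lin a x.
Proof. by rewrite /lin mulr_sumr; apply: eq_bigr => j _; rewrite !mxE mulrA. Qed.

Lemma lin0 a : lin a 0 = 0.
Proof. by rewrite /lin big1 // => j _; rewrite mxE mul0r. Qed.

Lemma nm_sum (I : finType) (f : I -> cplx R) : nm (\sum_i f i) <= \sum_i nm (f i).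
Proof.
elim/big_ind2 : _ => [|a b c d ab cd|//]; first by rewrite nm0.
exact: le_trans (nmD _ _) (lerD ab cd).
Qed.

Lemma lin_bound a x : nm (lin a x) <= (\sum_j nm (a j)) * nm x.
Proof.
apply: le_trans (nm_sum _) _; rewrite mulr_suml; apply: ler_sum => j _.
by rewrite nmM mulrC ler_wpM2l ?nm_ge0 // nm_coord.
Qed.

Lemma lin_continuous a : continuous (lin a).
Proof.
move=> x; apply/(@cvg_nmP _ _ _ (nbhs x)) => e e0.
pose C := \sum_j nm (a j).
have C0 : 0 < C + 1 by rewrite ltr_wpDl // sumr_ge0 // => j _; exact: nm_ge0.
have eC : 0 < e / (C + 1) by rewrite divr_gt0.
apply: filterS (nbhs_nm x eC) => y /=; rewrite ltr_pdivlMr // => yx.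
rewrite -linB; apply: le_lt_trans (lin_bound _ _) _; rewrite -/C.
by apply: le_lt_trans yx; rewrite mulrC ler_wpM2l ?nm_ge0 // lerDl.
Qed.

Lemma cdiff_lin a (f : cplx R -> Cn) z l : cdiff f z l ->
  cdiff (fun w => lin a (f w) : (cplx R)^o) z (lin a l).
Proof.
move=> H e e0; pose C := \sum_j nm (a j).
have C0 : 0 < C + 1 by rewrite ltr_wpDl // sumr_ge0 // => j _; exact: nm_ge0.
have eC : 0 < e / (C + 1) by rewrite divr_gt0.
have [d d0 {}H] := H _ eC; exists d => // h hd.
rewrite -linB -[h *: lin a l]linZ -linB.
apply: le_trans (lin_bound _ _) _; rewrite -/C.
have := H h hd; rewrite mulrAC ler_pdivlMr // => /le_trans H'.
rewrite mulrC; apply: le_trans (H' _ (lexx _)).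
by rewrite ler_wpM2l ?nm_ge0 // lerDl.
Qed.

(** Polynomials, generated so that continuity and holomorphy along discs follow by induction. *)
Inductive entire : (Cn -> cplx R) -> Prop :=
| entire_cst c : entire (fun=> c)
| entire_lin a : entire (lin a)
| entire_add P Q of entire P & entire Q : entire (fun x => P x + Q x)
| entire_mul P Q of entire P & entire Q : entire (fun x => P x * Q x).

Lemma entire_continuous P : entire P -> continuous P.
Proof.
elim=> [c|a|{}P Q _ IHP _ IHQ|{}P Q _ IHP _ IHQ] x.
- exact: cst_continuous.
- exact: lin_continuous.
- exact: (@cvgD _ _ _ (nbhs x) _ _ _ _ _ (IHP x) (IHQ x)).
- exact: (@cvgM _ _ (nbhs x) _ _ _ _ _ (IHP x) (IHQ x)).
Qed.

Lemma entire_derivable P (f : cplx R -> Cn) z : entire P -> derivable f z 1 ->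
  derivable (fun w => P (f w)) z 1.
Proof.
move=> eP fz; elim: eP => [c|a|{}P Q _ IHP _ IHQ|{}P Q _ IHP _ IHQ].
- exact: derivable_cst.
- exact: cdiff_derivable (cdiff_lin a (derivable_cdiff fz)).
- exact: (derivableD IHP IHQ).
- exact: (derivableM IHP IHQ).
Qed.

End EntireFunctions.

(** * Supporting functionals of slices of a convex set *)

Section SupportFunctional.
Context {R : realType} {n k : nat}.
Local Notation Cn := 'rV[cplx R]_n.
Implicit Types (x y v m u : Cn).

Definition cj m (j : 'I_n) : cplx R := (m ord0 j)^*%C.

Definition dot x m : cplx R := lin (cj m) x.

Lemma dotBr x m m' : dot x (m - m') = dot x m - dot x m'.
Proof.
rewrite /dot /lin -sumrB; apply: eq_bigr => j _.
by rewrite /cj !mxE rmorphB mulrBr.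
Qed.

Lemma Re_dot_sym x y : complex.Re (dot x y) = complex.Re (dot y x).
Proof.
rewrite /dot /lin !raddf_sum /=; apply: eq_bigr => j _; rewrite /cj.
by case: (x _ _) => a b; case: (y _ _) => c d /=; ring.
Qed.

Lemma dot_bound x m : nm (dot x m) <= n%:R * nm m * nm x.
Proof.
apply: le_trans (lin_bound _ _) _; rewrite ler_wpM2r ?nm_ge0 //.
apply: le_trans (_ : \sum_(j < n) nm m <= _); last first.
  by rewrite mulr_natl sumr_const card_ord lexx.
by apply: ler_sum => j _; rewrite /cj nmJ nm_coord.
Qed.

(** The squared Euclidean norm. The norm [nm] is the maximum over coordinates, which has no
    expansion like [sqnB] and so gives no normal vector at a nearest point. *)
Definition sqn x : R := complex.Re (dot x x).

Lemma sqnE x : sqn x = \sum_j nm (x ord0 j) ^+ 2.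
Proof.
rewrite /sqn /dot /lin raddf_sum /=; apply: eq_bigr => j _; rewrite nm_sqr /cj.
by case: (x _ _) => a b /=; ring.
Qed.

Lemma sqn_ge x : nm x ^+ 2 <= sqn x.
Proof.
have [->|x0] := eqVneq x 0.
  by rewrite nm0 expr0n /= sqnE sumr_ge0 // => j _; rewrite exprn_ge0 // nm_ge0.
have [j ->] := nm_coord_eq x0; rewrite sqnE (bigD1 j) //= lerDl.
by rewrite sumr_ge0 // => i _; rewrite exprn_ge0 // nm_ge0.
Qed.

Lemma sqnB x y (s : R) : sqn (x - s%:C *: y) =
  sqn x - 2 * s * complex.Re (dot y x) + s ^+ 2 * sqn y.
Proof.
rewrite /sqn {1}/dot linB linZ -!/(dot _ _) ReB dotBr ReB.
rewrite [dot y (x - _)]dotBr.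
have Z w : dot w (s%:C *: y) = s%:C * dot w y.
  rewrite /dot /lin mulr_sumr; apply: eq_bigr => j _.
  by rewrite /cj !mxE; case: (w _ _) => a b; case: (y _ _) => c d; apply/eqP;
    rewrite eq_complex /=; apply/andP; split; apply/eqP; ring.
by rewrite !Z !ReM ReB ReM /= (Re_dot_sym x y); ring.
Qed.

Lemma sqn_continuous : continuous sqn.
Proof.
move=> x; apply/(@cvgrPdist_lt _ _ _ (nbhs x)) => e e0.
pose C := n%:R * (2 * nm x + 1) : R.
have C0 : 0 <= C by rewrite mulr_ge0 // addr_ge0 // mulr_ge0 // nm_ge0.
have C1 : 0 < C + 1 by rewrite ltr_wpDl.
pose d := Num.min 1 (e / (C + 1)).
have d0 : 0 < d by rewrite lt_min ltr01 divr_gt0.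
apply: filterS (nbhs_nm x d0) => y /=; rewrite lt_min => /andP[y1].
rewrite ltr_pdivlMr // => ye.
have -> : sqn x - sqn y = complex.Re (dot (x - y) x) + complex.Re (dot y (x - y)).
  by rewrite /sqn dotBr ReB /dot linB ReB; ring.
apply: le_lt_trans (ler_normD _ _) _.
have h1 := le_trans (Re_le_nm _) (dot_bound (x - y) x).
have h2 := le_trans (Re_le_nm _) (dot_bound y (x - y)).
rewrite nmB in h1; rewrite (nmB x y) in h2.
have ny : nm y <= nm x + 1 by have := nmD (y - x) x; rewrite subrK; lra.
apply: le_lt_trans (lerD h1 h2) _; apply: le_lt_trans ye.
have n0 : 0 <= n%:R :> R by [].
have nx := nm_ge0 x; have nyx := nm_ge0 (y - x).
have -> : nm (y - x) * (C + 1) = n%:R * nm (y - x) * (2 * nm x + 1) + nm (y - x).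
  by rewrite /C; ring.
have : 0 <= n%:R * nm (y - x) by rewrite mulr_ge0.
by nra.
Qed.

Variables (F : set Cn) (A : 'M[cplx R]_(n, k)).
Hypotheses (cF : compact F) (convF : convexC F) (F0 : F 0).

Let FA : set Cn := [set x | F x /\ x *m A = 0].

Lemma closed_ker : closed [set x : Cn | x *m A = 0].
Proof.
have -> : [set x : Cn | x *m A = 0] = \bigcap_j (lin (fun i => A i j) @^-1` [set 0]).
  apply/seteqP; split=> x /=.
    move=> xA j _ /=; have /matrixP/(_ ord0 j) := xA; rewrite !mxE => <-.
    by apply: eq_bigr.
  move=> H; apply/matrixP => i j; rewrite (ord1 i) !mxE.
  exact: (H j Logic.I).
apply: closed_bigI => j _; apply: preimage_closed; last first.
  exact/accessible_closed_set1/hausdorff_accessible/norm_hausdorff.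
by move=> x _; exact: lin_continuous.
Qed.

Let compact_FA : compact FA.
Proof.
rewrite /FA; have -> : [set x | F x /\ x *m A = 0] = F `&` [set x | x *m A = 0] by [].
apply: compact_closedI => //; exact: closed_ker.
Qed.

Let FA0 : FA 0. Proof. by split; rewrite ?mul0mx. Qed.

Let nearest_normal (w : Cn) : w *m A = 0 -> exists x, [/\ FA x,
  sqn (w - x) <= sqn w & forall y, FA y -> complex.Re (dot (y - x) (w - x)) <= 0].
Proof.
move=> wA; have [||x /set_mem Fx xmin] :=
  @compact_EVT_min _ R (fun x => sqn (w - x)) FA _ compact_FA; first by exists 0.
  apply: continuous_subspaceT => x; apply: (@continuous_comp _ _ _ (fun x => w - x) sqn).
    by apply: (@cvgB _ _ _ (nbhs x)); [exact: cvg_cst|exact: cvg_id].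
  exact: sqn_continuous.
exists x; split => //.
  by have := xmin 0; rewrite subr0; apply; exact/mem_set.
move=> y Fy; set c := complex.Re _; rewrite leNgt; apply/negP => c0.
have N0 : 0 <= sqn (y - x) by apply: le_trans (sqn_ge _); rewrite exprn_ge0 // nm_ge0.
pose s := Num.min 1 (c / (sqn (y - x) + 1)).
have N1 : 0 < sqn (y - x) + 1 by rewrite ltr_wpDl.
have s0 : 0 < s by rewrite lt_min ltr01 divr_gt0.
have s1 : s <= 1 by rewrite ge_min lexx.
have sc : s * (sqn (y - x) + 1) <= c.
  by rewrite -ler_pdivlMr // ge_min lexx orbT.
have zF : FA (s%:C *: y + (1 - s)%:C *: x).
  split; first by apply: convF => //; [exact: Fy.1|exact: Fx.1|exact: ltW].
  by rewrite mulmxDl -!scalemxAl Fy.2 Fx.2 !scaler0 addr0.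
have := xmin _ (mem_set zF).
have -> : w - (s%:C *: y + (1 - s)%:C *: x) = (w - x) - s%:C *: (y - x).
  by apply/matrixP => i j; rewrite RtoCB !mxE; ring.
by rewrite sqnB -/c; nra.
Qed.

(** The points u / (i + 1) lie outside F and tend to 0. Their projections p i to the slice also tend
    to 0, so a cluster point of the unit normals supports the slice at 0 itself. Working in the
    slice keeps m in the kernel of A. *)
Lemma support_functional u : u *m A = 0 -> u != 0 ->
  (forall t : R, 0 < t -> ~ F (t%:C *: u)) ->
  exists m, [/\ m != 0, m *m A = 0 & forall x, FA x -> complex.Re (dot x m) <= 0].
Proof.
move=> uA uN Fu.
pose w (i : nat) : Cn := (i.+1%:R^-1)%:C *: u.
have wA i : w i *m A = 0 by rewrite -scalemxAl uA scaler0.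
have [p Hp] := choice (fun i => nearest_normal (wA i)).
have ei0 (i : nat) : 0 < i.+1%:R^-1 :> R by rewrite invr_gt0.
have nN i : w i - p i != 0.
  apply/negP => /eqP/subr0_eq wp; have [[Fp _] _ _] := Hp i.
  by apply: (Fu _ (ei0 i)); rewrite -/(w i) wp.
pose q i : Cn := ((nm (w i - p i))^-1)%:C *: (w i - p i).
have q1 i : nm (q i) = 1.
  have p0 : 0 < nm (w i - p i) by rewrite nm_gt0.
  by rewrite nmZR ger0_norm ?invr_ge0 ?nm_ge0 // mulVf // lt0r_neq0.
pose C := Num.sqrt (sqn u) + nm u.
have C0 : 0 <= C by rewrite addr_ge0 ?sqrtr_ge0 ?nm_ge0.
(* As 0 is in the slice, the Euclidean distance from w i to p i is at most the Euclidean norm of w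
   i. *)
have pC i : nm (p i) <= C * i.+1%:R^-1.
  have [_ Hs _] := Hp i.
  have -> : p i = w i - (w i - p i) by rewrite opprB addrC subrK.
  apply: le_trans (nmD _ _) _; rewrite nmN /C mulrDl addrC; apply: lerD; last first.
    by rewrite /w nmZR ger0_norm ?(ltW (ei0 i)) // mulrC.
  have S0 : 0 <= Num.sqrt (sqn u) * i.+1%:R^-1.
    by apply: mulr_ge0; [exact: sqrtr_ge0|exact: ltW].
  rewrite -(@ler_pXn2r _ 2) ?nnegrE ?nm_ge0 ?S0 //.
  apply: le_trans (sqn_ge _) _; apply: le_trans Hs _.
  have -> : w i = 0 - (- i.+1%:R^-1)%:C *: u by rewrite RtoCN scaleNr opprK add0r.
  have d0 y : dot y 0 = 0.
    by rewrite /dot /lin big1 // => j _; rewrite /cj mxE conjc0 mulr0.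
  rewrite sqnB d0 /= mulr0 subr0 /sqn d0 /= add0r sqrrN exprMn mulrC sqr_sqrtr //.
  by apply: le_trans (sqn_ge u); rewrite exprn_ge0 // nm_ge0.
have qle i y : FA y -> complex.Re (dot y (q i)) <= n%:R * C * i.+1%:R^-1.
  move=> Fy; have [Fp _ Hn] := Hp i.
  have p0 : 0 < nm (w i - p i) by rewrite nm_gt0.
  have Z x : complex.Re (dot x (q i)) = (nm (w i - p i))^-1 * complex.Re (dot x (w i - p i)).
    rewrite /q /dot /lin !raddf_sum mulr_sumr; apply: eq_bigr => j _ /=.
    set D := w i - p i; rewrite /cj mxE /D {D}; case: (x _ _) => a b.
    by case: ((w i - p i) _ _) => c d; rewrite /=; ring.
  have : complex.Re (dot (y - p i) (q i)) <= 0.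
    by rewrite Z mulr_ge0_le0 ?invr_ge0 ?nm_ge0 // Hn.
  rewrite {1}/dot linB ReB -!/(dot _ _) subr_le0 => /le_trans; apply.
  apply: le_trans (ler_norm _) _; apply: le_trans (Re_le_nm _) _.
  apply: le_trans (dot_bound _ _) _; rewrite q1 mulr1 -mulrA.
  by rewrite ler_wpM2l.
pose S : set Cn := [set m | nm m = 1] `&` [set m | m *m A = 0].
have cS : compact S.
  apply: compact_closedI; last exact: closed_ker.
  apply: (subclosed_compact _ (@compact_nm_ball R n 0 1)); last first.
    by move=> m /= m1; rewrite subr0 m1.
  have -> : [set m : Cn | nm m = 1] = nm @^-1` [set 1] by [].
  by apply: preimage_closed; [move=> m _; exact: nm_continuous|exact: closed_eq].
have Sq i : S (q i).
  split; first exact: q1.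
  have [[_ pA] _ _] := Hp i.
  by rewrite /= /q -scalemxAl mulmxBl wA pA subrr scaler0.
have [m [[m1 mA] qm]] : S `&` cluster (q @ \oo) !=set0.
  by apply: (cS (q @ \oo) _); exists 0%N => // i _; exact: Sq.
exists m; split => //; first by rewrite -nm_gt0 m1.
move=> y Fy; rewrite leNgt; apply/negP => c0; set c := complex.Re _ in c0.
pose d := c / (2 * (n%:R * nm y + 1)).
have n0 : 0 <= n%:R * nm y :> R by rewrite mulr_ge0 // nm_ge0.
have d0 : 0 < d by rewrite divr_gt0 // mulr_gt0 // ltr_wpDl.
have c2 : 0 < c / (2 * (n%:R * C + 1)).
  by rewrite divr_gt0 // mulr_gt0 // ltr_wpDl // mulr_ge0.
have near_q : (q @ \oo) [set x | complex.Re (dot y x) <= c / 2].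
  have : \forall i \near \oo, complex.Re (dot y (q i)) <= c / 2; last by [].
  near=> i; apply: le_trans (qle i y Fy) _.
  have h : i.+1%:R^-1 < c / (2 * (n%:R * C + 1)).
    by near: i; exact: near_infty_natSinv_lt (PosNum c2).
  have nC : 0 <= n%:R * C :> R by rewrite mulr_ge0.
  move: h; rewrite ltr_pdivlMr; last by rewrite mulr_gt0 // ltr_wpDl.
  by move: nC (ei0 i); move: (n%:R * C) (_^-1) => N e; nra.
have [x [/= xc xm]] := qm _ _ near_q (nbhs_nm m d0).
have : c - complex.Re (dot y x) <= n%:R * nm (m - x) * nm y.
  rewrite /c -ReB -dotBr; apply: le_trans (ler_norm _) _.
  exact: le_trans (Re_le_nm _) (dot_bound _ _).
rewrite nmB; move: xm; rewrite /d ltr_pdivlMr; last by rewrite mulr_gt0 // ltr_wpDl.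
by have := nm_ge0 (x - m); nra.
Unshelve. all: by end_near. Qed.

End SupportFunctional.

Section PeakFunction.
Context {R : realType} {n : nat}.
Local Notation Cn := 'rV[cplx R]_n.
Implicit Types (x y v m u q : Cn) (P Q : Cn -> cplx R).

(** Near a zero of g the strict sign of f suffices, elsewhere a large multiple of g dominates;
    compactness gives one M, found here as e^-1. *)
Lemma compact_neg_sum (K : set Cn) (f g : Cn -> R) : compact K ->
  continuous f -> continuous g -> (forall x, K x -> g x <= 0) ->
  (forall x, K x -> g x = 0 -> f x < 0) ->
  exists2 M : R, 0 < M & forall x, K x -> f x + M * g x < 0.
Proof.
move=> cK cf cg g0 fg.
have [||e e0 He] := @compact_unif R Cn K (fun e y => g y <= 0 -> f y + e^-1 * g y < 0) cK.
- move=> e e' y e'0 e'e H gy; apply: le_lt_trans (H gy).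
  by rewrite lerD2l ler_wnM2r // lef_pV2 // posrE (lt_le_trans e'0).
- move=> x Kx.
  have ex (h : Cn -> R) : continuous h -> h x < 0 ->
      exists2 d : R, 0 < d & forall y, nm (y - x) < d -> h y < 0.
    move=> ch hx; have /nbhs_nmP[d d0 H] : nbhs x (h @^-1` [set t | t < 0]).
      by apply: ch; apply: open_nbhs_nbhs; split; [exact: open_lt|exact: hx].
    by exists d.
  have [gx|gx] := eqVneq (g x) 0.
    exists 1 => //; have [d d0 H] := ex f cf (fg _ Kx gx); exists d => // y yd gy.
    by rewrite invr1 mul1r; have := H _ yd; lra.
  have gx0 : g x < 0 by rewrite lt_neqAle gx g0.
  pose e := - g x / (`|f x| + 1).
  have f1 : 0 < `|f x| + 1 by rewrite ltr_wpDl.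
  have e0 : 0 < e by rewrite divr_gt0 // oppr_gt0.
  exists e => //; have [||d d0 H] := ex (fun y => f y + e^-1 * g y).
  + move=> y; apply: (@cvgD _ _ _ (nbhs y)); first exact: cf.
    by apply: (@cvgM _ _ (nbhs y)); [exact: cst_continuous|exact: cg].
  + have -> : e^-1 * g x = - (`|f x| + 1) by rewrite /e; field; rewrite gx lt0r_neq0.
    by have := ler_norm (f x); lra.
  by exists d => // y yd _; exact: H.
- by exists e^-1; [rewrite invr_gt0|move=> x Kx; apply: He => //; exact: g0].
Qed.

Section Barrier.
Variables (F : set Cn) (d0 : R).
Hypotheses (cF : compact F) (convF : convexC F) (F0 : F 0) (d0_gt0 : 0 < d0).
Hypothesis nodisc : forall v (r : R), v != 0 -> 0 < r ->
  exists2 l : cplx R, nm l <= r & ~ F (l *: v).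

(** Otherwise F contains short segments from 0 in the directions v, -v, iv and -iv, and by convexity
    a complex disc in the direction v. *)
Let escape v : v != 0 -> exists2 c : cplx R, c != 0 &
  forall t : R, 0 < t -> ~ F (t%:C *: (c *: v)).
Proof.
move=> vN; apply: contrapT => H.
have star x (s t : R) : F (t%:C *: x) -> 0 <= s -> s <= t -> F (s%:C *: x).
  move=> Ft s0 st; have [t0|t0] := ltP 0 t; last first.
    by have -> : s = 0; [lra|rewrite scale0r].
  have -> : s%:C *: x = (s / t)%:C *: (t%:C *: x) + (1 - s / t)%:C *: 0.
    by rewrite scaler0 addr0 scalerA -RtoCM divfK // lt0r_neq0.
  by apply: convF => //; [rewrite divr_ge0 // ltW|rewrite ler_pdivrMr // mul1r].
have dir (c : cplx R) : c != 0 -> exists2 t : R, 0 < t & F (t%:C *: (c *: v)).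
  move=> c0; apply: contrapT => Ht; apply: H; exists c => // t t0 Ft.
  by apply: Ht; exists t.
have [|t1 t10 F1] := dir 1; first exact: oner_neq0.
have [|t2 t20 F2] := dir (-1); first by rewrite oppr_eq0 oner_neq0.
have iN : 'i != 0 :> cplx R by rewrite eq_complex /= (oner_eq0 R) andbF.
have [|t3 t30 F3] := dir 'i; first exact: iN.
have [|t4 t40 F4] := dir (- 'i); first by rewrite oppr_eq0.
pose t := Num.min (Num.min t1 t2) (Num.min t3 t4).
have t0 : 0 < t by rewrite !lt_min t10 t20 t30 t40.
have [T1 T2 T3 T4] : [/\ t <= t1, t <= t2, t <= t3 & t <= t4].
  by rewrite !ge_min !lexx !orbT.
have seg (c : cplx R) (a : R) (s1 s2 : R) : F (s1%:C *: (c *: v)) ->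
    F (s2%:C *: (- c *: v)) -> `|a| <= s1 -> `|a| <= s2 -> F (a%:C *: (c *: v)).
  move=> Fs1 Fs2 as1 as2; have [a0|a0] := leP 0 a.
    by apply: (star _ _ s1) => //; rewrite -(ger0_norm a0).
  have -> : a%:C *: (c *: v) = (- a)%:C *: (- c *: v).
    by rewrite RtoCN !scalerA mulrNN.
  by apply: (star _ _ s2) => //; [rewrite oppr_ge0 ltW|rewrite -(ltr0_norm a0)].
have [[a b] lr] := nodisc vN (divr_gt0 t0 (ltr0Sn _ 1)); apply.
have Ha := le_trans (Re_le_nm (a +i* b)) lr.
have Hb := le_trans (Im_le_nm (a +i* b)) lr; rewrite /= in Ha Hb.
(* The point (a + ib) v is the midpoint of 2a v and 2b iv, which explains the radius t / 2. *)
have -> : (a +i* b) *: v = (2^-1)%:C *: ((2 * a)%:C *: (1 *: v)) +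
    (1 - 2^-1)%:C *: ((2 * b)%:C *: ('i *: v)).
  rewrite !scalerA -scalerDl; congr (_ *: _); apply/eqP; rewrite eq_complex /=.
  by apply/andP; split; apply/eqP; field.
have nn (c : R) : `|c| <= t / 2 -> `|2 * c| <= t.
  by rewrite normrM (ger0_norm (_ : 0 <= 2)) // ler_pdivlMr // mulrC.
have na := nn _ Ha; have nb := nn _ Hb.
apply: convF.
- by apply: seg F1 F2 _ _; exact: le_trans na _.
- by apply: seg F3 F4 _ _; exact: le_trans nb _.
- by rewrite invr_ge0.
- by rewrite invf_le1 // ler1n.
Qed.

(* Induction on the dimension of the slice: if Re l <= 0 on the slice of F, then
   Re (l + l^2 / K) < 0 off ker l for K large, and the induction hypothesis
   applies to ker l. *)
Let barrier_ker r : forall k (A : 'M[cplx R]_(n, k)), (\rank (kermx A) <= r)%N ->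
  exists P, [/\ entire P, P 0 = 0 & forall x, F x -> x *m A = 0 -> nm x = d0 ->
    complex.Re (P x) < 0].
Proof.
elim: r => [|r IH] k A rA.
  exists (fun=> 0); split => // [|x Fx xA]; first exact: entire_cst.
  have /sub_kermxP := xA; move: rA; rewrite leqn0 mxrank_eq0 => /eqP ->.
  by rewrite submx0 => /eqP ->; rewrite nm0 => d00; move: d0_gt0; rewrite -d00 ltxx.
have [[v [vN vA]]|noA] := pselect (exists v, v != 0 /\ v *m A = 0); last first.
  exists (fun=> 0); split => // [|x Fx xA xd]; first exact: entire_cst.
  by case: noA; exists x; split => //; rewrite -nm_gt0 xd.
have [c cN Hc] := escape vN.
have [||m [mN mA Hm]] := @support_functional R n k F A cF convF F0 (c *: v) _ _ Hc.
- by rewrite -scalemxAl vA scaler0.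
- by rewrite scaler_eq0 negb_or cN.
(* One more column cuts the slice by the complex hyperplane orthogonal to m. Since m itself is in
   the kernel of A, the dimension drops. *)
pose A' := row_mx A (\col_j cj m j : 'M[cplx R]_(n, 1)).
have A'P x : x *m A = 0 -> dot x m = 0 -> x *m A' = 0.
  move=> xA xm; rewrite /A' mul_mx_row xA.
  have -> : x *m (\col_j cj m j : 'M[cplx R]_(n, 1)) = 0; last by rewrite row_mx0.
  apply/matrixP => i j; rewrite (ord1 i) !mxE -[RHS]xm.
  by apply: eq_bigr => l _; rewrite mxE.
have A'm : m *m A' != 0.
  apply/negP => /eqP; rewrite /A' mul_mx_row -row_mx0 => /eq_row_mx[_].
  move=> /matrixP/(_ ord0 ord0); rewrite !mxE => H.
  have : sqn m = 0.
    rewrite /sqn /dot /lin; have -> : 0 = complex.Re (0 : cplx R) by [].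
    rewrite -[X in _ = complex.Re X]H; congr complex.Re.
    by apply: eq_bigr => l _; rewrite mxE.
  move=> s0; have := sqn_ge m; rewrite s0 leNgt exprn_gt0 //.
  by rewrite nm_gt0.
have rA' : (\rank (kermx A') <= r)%N.
  rewrite -ltnS; apply: leq_trans rA; apply: rank_ltmx.
  rewrite ltmxE; apply/andP; split.
    apply/sub_kermxP; have : kermx A' *m A' = 0 by exact: mulmx_ker.
    by rewrite {2}/A' mul_mx_row -row_mx0 => /eq_row_mx[].
  apply/negP => /(submx_trans _) H; have /sub_kermxP/H/sub_kermxP mA' := mA.
  by move: A'm; rewrite mA' eqxx.
have [P [eP P0 HP]] := IH _ _ rA'.
(* On the sphere |l| <= K / 2, so with l = a + ib and a <= 0 one has a^2 / K <= -a / 2. Hence Re (l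
   + l^2 / K) <= a / 2 - b^2 / K, which vanishes only for l = 0. *)
pose K := 2 * (n%:R * nm m * d0) + 1.
have B0 : 0 <= n%:R * nm m * d0 by rewrite !mulr_ge0 ?nm_ge0 // ltW.
have K0 : 0 < K by rewrite ltr_wpDl // mulr_ge0.
pose L x : cplx R := dot x m + (K^-1)%:C * (dot x m * dot x m).
have eL : entire L.
  apply: entire_add; first exact: entire_lin.
  by apply: entire_mul; [exact: entire_cst|apply: entire_mul; exact: entire_lin].
pose S := F `&` [set x | x *m A = 0] `&` [set x | nm x = d0].
have cS : compact S.
  apply: compact_closedI; first by apply: compact_closedI => //; exact: closed_ker.
  have -> : [set m : Cn | nm m = d0] = nm @^-1` [set d0] by [].
  by apply: preimage_closed; [move=> x _; exact: nm_continuous|exact: closed_eq].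
have cRe Q : entire Q -> continuous (fun x => complex.Re (Q x)).
  move=> eQ x; apply: (@continuous_comp _ _ _ Q (@complex.Re R)).
    exact: entire_continuous.
  exact: Re_continuous.
have LS x : S x -> complex.Re (L x) <= 0 /\ (complex.Re (L x) = 0 -> dot x m = 0).
  move=> [[Fx xA] xd]; have Hx := Hm _ (conj Fx xA).
  have := dot_bound x m; rewrite xd => /(le_trans (Re_le_nm _)).
  rewrite /L; case: (dot x m) Hx => a b /= a0; rewrite ler0_norm // => aB.
  have -> : K^-1 * (a * a - b * b) - 0 * (a * b + b * a) = K^-1 * (a * a - b * b) by ring.
  have Ki : 0 < K^-1 by rewrite invr_gt0.
  have KK : K^-1 * K = 1 by rewrite mulVf // lt0r_neq0.
  have aK : K^-1 * (a * a) <= - a / 2.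
    have h : - a <= K / 2 by rewrite /K; lra.
    have -> : - a / 2 = K^-1 * (- a * (K / 2)) by rewrite -[LHS]mul1r -[X in X * _]KK; ring.
    rewrite ler_pM2l //; nra.
  have bK : 0 <= K^-1 * (b * b) by rewrite -expr2 mulr_ge0 ?sqr_ge0 // ltW.
  rewrite mulrBr; split; first by lra.
  move=> E; have a00 : a = 0 by lra.
  have : K^-1 * (b * b) = 0 by lra.
  move/eqP; rewrite mulf_eq0 gt_eqF //= mulf_eq0 orbb => /eqP ->.
  by rewrite a00.
have [||M M0 HM] := @compact_neg_sum S (fun x => complex.Re (P x))
  (fun x => complex.Re (L x)) cS (cRe _ eP) (cRe _ eL).
- by move=> x /LS[].
- by move=> x Sx; have [[Fx xA] xd] := Sx; move=> /(LS x Sx).2 xm; apply: HP => //; exact: A'P.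
exists (fun x => P x + M%:C * L x); split.
- by apply: entire_add => //; apply: entire_mul => //; exact: entire_cst.
- have L0 : L 0 = 0.
    by rewrite /L (_ : dot 0 m = 0) ?mul0r ?mulr0 ?addr0 //; exact: lin0.
  by rewrite P0 L0 mulr0 addr0.
- move=> x Fx xA xd; have := HM x (conj (conj Fx xA) xd).
  by rewrite ReD ReM /= mul0r subr0.
Qed.

(** A barrier P with Re P < 0 becomes a peak function 1 + P / M, as |1 + P / M|^2 = 1 + (|P|^2 + 2 M
    Re P) / M^2 and the bracket is negative for M large. *)
Lemma peak0 : exists P, [/\ entire P, P 0 = 1 & exists2 th : R, th < 1 &
  forall x, F x -> nm x = d0 -> nm (P x) <= th].
Proof.
have [P [eP P0 HP]] := @barrier_ker _ n (0 : 'M[cplx R]_(n, n)) (rank_leq_row _).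
pose S := F `&` [set x | nm x = d0].
have cS : compact S.
  apply: compact_closedI => //.
  have -> : [set m : Cn | nm m = d0] = nm @^-1` [set d0] by [].
  by apply: preimage_closed; [move=> x _; exact: nm_continuous|exact: closed_eq].
have cP := entire_continuous eP.
have [||||M M0 HM] := @compact_neg_sum S (fun x => nm (P x) * nm (P x))
  (fun x => 2 * complex.Re (P x)) cS.
- move=> x; have cn : {for x, continuous (fun x => nm (P x))}.
    apply: (@continuous_comp _ _ _ P nm); [exact: cP|exact: nm_continuous].
  exact: (@cvgM _ _ (nbhs x) _ _ _ _ _ cn cn).
- move=> x; apply: (@cvgM _ _ (nbhs x)); first exact: cst_continuous.
  apply: (@continuous_comp _ _ _ P (@complex.Re R)); [exact: cP|exact: Re_continuous].
- by move=> x [Fx xd]; have := HP x Fx (mulmx0 _ _) xd; lra.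
- by move=> x [Fx xd]; have := HP x Fx (mulmx0 _ _) xd; lra.
pose Q x : cplx R := 1 + (M^-1)%:C * P x.
have eQ : entire Q.
  apply: entire_add; first exact: entire_cst.
  by apply: entire_mul => //; exact: entire_cst.
exists Q; split => //; first by rewrite /Q P0 mulr0 addr0.
have Q1 x : S x -> nm (Q x) < 1.
  move=> Sx; have := HM x Sx.
  rewrite -expr2 => h; rewrite -(@ltr_pXn2r _ 2) ?nnegrE ?nm_ge0 //; move: h.
  rewrite expr1n !nm_sqr /Q.
  case: (P x) => a b /= H; have Mi : 0 < M^-1 by rewrite invr_gt0.
  have MM : M^-1 * M = 1 by rewrite mulVf // lt0r_neq0.
  have -> : (1 + (M^-1 * a - 0 * b)) ^+ 2 + (0 + (M^-1 * b + 0 * a)) ^+ 2 =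
    1 + M^-1 ^+ 2 * (a ^+ 2 + b ^+ 2 + M * (2 * a)).
    have -> : M^-1 ^+ 2 * (a ^+ 2 + b ^+ 2 + M * (2 * a)) =
      M^-1 ^+ 2 * (a ^+ 2 + b ^+ 2) + (M^-1 * M) * (M^-1 * (2 * a)) by ring.
    by rewrite MM; ring.
  by rewrite gtrDl pmulr_rlt0 // exprn_gt0.
have [||e e0 He] := @compact_unif R Cn S (fun e y => nm (Q y) <= 1 - e) cS.
- by move=> e e' y _ e'e /le_trans; apply; lra.
- move=> x Sx; pose e := (1 - nm (Q x)) / 2.
  have e0 : 0 < e by have := Q1 x Sx; rewrite /e; lra.
  exists e => //; have /nbhs_nmP[d dd H] : nbhs x (Q @^-1` [set z | nm (z - Q x) < e]).
    by apply: entire_continuous => //; exact: nbhs_nm.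
  exists d => // y yd; have /= h := H y yd.
  have := nmD (Q y - Q x) (Q x); rewrite subrK; move: h; rewrite /e; lra.
by exists (1 - e); [lra|move=> x Fx xd; exact: He].
Qed.

End Barrier.

Lemma entire_translate P q : entire P -> entire (fun x => P (x - q)).
Proof.
elim=> [c|a|{}P Q _ IHP _ IHQ|{}P Q _ IHP _ IHQ].
- exact: entire_cst.
- have -> : (fun x => lin a (x - q)) = (fun x => lin a x + - lin a q).
    by apply/funext => x; exact: linB.
  by apply: entire_add; [exact: entire_lin|exact: entire_cst].
- exact: entire_add.
- exact: entire_mul.
Qed.

Lemma peak_function (F : set Cn) q (d0 : R) : compact F -> convexC F -> F q -> 0 < d0 ->
  (forall v (r : R), v != 0 -> 0 < r -> exists2 l : cplx R, nm l <= r & ~ F (q + l *: v)) ->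
  exists P, [/\ entire P, P q = 1 & exists2 th : R, th < 1 &
    forall x, F x -> nm (x - q) = d0 -> nm (P x) <= th].
Proof.
move=> cF convF Fq d00 nodisc.
have [|||||P [eP P0 [th th1 HP]]] := @peak0 [set x | F (x + q)] d0.
- have -> : [set x | F (x + q)] = (fun y => y - q) @` F.
    apply/seteqP; split=> x /=; last by move=> [y Fy <-]; rewrite subrK.
    by move=> Fx; exists (x + q); rewrite // addrK.
  apply: continuous_compact => //; apply: continuous_subspaceT => x.
  by apply: (@cvgB _ _ _ (nbhs x)); [exact: cvg_id|exact: cst_continuous].
- move=> x y t /= Fx Fy t0 t1.
  have -> : t%:C *: x + (1 - t)%:C *: y + q =
      t%:C *: (x + q) + (1 - t)%:C *: (y + q).
    by apply/matrixP => i j; rewrite RtoCB !mxE; ring.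
  exact: convF.
- by rewrite /= add0r.
- exact: d00.
- by move=> v r vN r0; have [l lr H] := nodisc v r vN r0; exists l; rewrite //= addrC.
exists (fun x => P (x - q)); split; first exact: entire_translate.
  by rewrite subrr.
by exists th => // x Fx xd; apply: HP => //=; rewrite subrK.
Qed.

End PeakFunction.

(** * Discs centred near a peak point *)

Section ScalarDerivable.
Context {R : realType}.
Implicit Types (f g : cplx R -> cplx R) (z : cplx R).

Lemma cderivableD f g z : derivable f z 1 -> derivable g z 1 ->
  derivable (fun w => f w + g w) z 1.
Proof. exact: derivableD. Qed.

Lemma cderivableM f g z : derivable f z 1 -> derivable g z 1 ->
  derivable (fun w => f w * g w) z 1.
Proof. by move=> fz gz; exact: (derivableM fz gz). Qed.

Lemma cderivableV z : z != 0 -> derivable (fun w : cplx R => w^-1) z 1.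
Proof. by move=> z0; apply: (@derivableV _ _ id) => //; exact: derivable_id. Qed.

Lemma cderivable_cst (c z : cplx R) : derivable (fun=> c : cplx R) z 1.
Proof. exact: derivable_cst. Qed.

Lemma cderivableX f k z : derivable f z 1 -> derivable (fun w => f w ^+ k) z 1.
Proof.
move=> fz; elim: k => [|k IH]; first exact: cderivable_cst.
have -> : (fun w => f w ^+ k.+1) = (fun w => f w * f w ^+ k).
  by apply/funext => w; rewrite exprS.
exact: cderivableM.
Qed.

End ScalarDerivable.

Section CompactMax.
Context {R : realType}.
Implicit Types (K : set (cplx R)) (g : cplx R -> R).

Lemma compact_superlevel K g (c : R) : compact K ->
  (forall x, K x -> {for x, continuous g}) -> compact (K `&` [set x | c <= g x]).
Proof.
move=> cK cg; set S := _ `&` _.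
have -> : S = K `&` closure S; last by apply: compact_closedI => //; exact: closed_closure.
apply/seteqP; split=> [x Sx|x [Kx Sx]]; first by split; [exact: Sx.1|exact: subset_closure].
split => //=; rewrite leNgt; apply/negP => gx.
have gc : nbhs x (g @^-1` [set t | t < c]).
  by apply: (cg x Kx); apply: open_nbhs_nbhs; split; [exact: open_lt|exact: gx].
by have [y [[_ /= cy] /=]] := Sx _ gc; rewrite ltNge cy.
Qed.

Lemma compact_sublevel K g (c : R) : compact K ->
  (forall x, K x -> {for x, continuous g}) -> compact (K `&` [set x | g x <= c]).
Proof.
move=> cK cg; have := @compact_superlevel K (fun x => - g x) (- c) cK _.
have -> : [set x | - c <= - g x] = [set x | g x <= c].
  by apply/seteqP; split=> x /=; rewrite lerN2.
by apply=> x Kx; apply: (@cvgN _ _ _ (nbhs x)); exact: cg.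
Qed.

(** Raises a candidate maximum A0 by the values of g and records whether g attains it; chained, it
    gives the maximum of several functions on different compact sets, possibly empty. *)
Lemma compact_max_extend K g (A0 : R) : compact K ->
  (forall x, K x -> {for x, continuous g}) ->
  exists A, [/\ A0 <= A, forall x, K x -> g x <= A & A = A0 \/ exists2 x, K x & g x = A].
Proof.
move=> cK cg; have [[x [Kx gx]]|H] := pselect (exists x, K x /\ A0 < g x); last first.
  exists A0; split => //; last by left.
  by move=> x Kx; rewrite leNgt; apply/negP => gx; apply: H; exists x.
have [||c /set_mem Kc Hc] := @compact_EVT_max _ R g K _ cK.
- by exists x.
- by apply: continuous_in_subspaceT => y /set_mem; exact: cg.
exists (g c); split; last by right; exists c.
- by apply: le_trans (ltW gx) _; apply: Hc; exact/mem_set.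
- by move=> y Ky; apply: Hc; exact/mem_set.
Qed.

(* The factor (1 + conj a z)^2 compares the weight 1 + |z|^2 with its value at
   the maximum point a, as (1+|a|^2)(1+|z|^2) = |1 + conj a z|^2 + |z - a|^2. *)
Lemma no_weighted_max (h : cplx R -> cplx R) (a : cplx R) (r A : R) :
  {for a, continuous h} ->
  (forall z, 0 < nm (z - a) -> nm (z - a) < r -> derivable h z 1) ->
  0 < r -> nm a + r <= 1 ->
  (forall z, nm (z - a) < r -> nm (h z) * (1 + nm z ^+ 2) <= A) ->
  nm (h a) * (1 + nm a ^+ 2) = A -> A = 0.
Proof.
move=> ch dh r0 ar hA hAa.
pose p (z : cplx R) : cplx R := 1 + a^*%C * z.
have dp z : derivable p z 1.
  apply: (@cderivableD _ (fun=> 1) (fun z => a^*%C * z)); first exact: cderivable_cst.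
  apply: (@cderivableM _ (fun=> a^*%C) id); [exact: cderivable_cst|exact: derivable_id].
have dpp z : derivable (fun z => p z * p z) z 1 by exact: (cderivableM (dp z) (dp z)).
have wE z : nm (p z) ^+ 2 + nm (z - a) ^+ 2 = (1 + nm a ^+ 2) * (1 + nm z ^+ 2).
  by rewrite /p !nm_sqr; move: (a) (z) => [a1 a2] [z1 z2] /=; ring.
have pa : nm (p a) ^+ 2 = (1 + nm a ^+ 2) ^+ 2.
  by have := wE a; rewrite subrr nm0 expr0n addr0 => ->; rewrite expr2.
have H : h a * (p a * p a) = 0.
  apply: (@no_strict_max R (fun z => h z * (p z * p z)) a r _ _ 4^-1).
  - apply: (@cvgM _ _ (nbhs a)); first exact: ch.
    exact: (derivable_continuous (dpp a)).
  - by move=> z z0 zr; exact: (cderivableM (dh z z0 zr) (dpp z)).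
  - exact: r0.
  - by rewrite invr_gt0.
  - move=> z zr; rewrite !nmM -!expr2 pa; set d := nm (z - a).
    have pz : nm (p z) ^+ 2 <= 4.
      have z1 : nm z <= 1.
        by have := nmD (z - a) a; rewrite subrK; lra.
      have a1 : nm a <= 1 by lra.
      have : nm (p z) <= 2.
        apply: le_trans (nmD _ _) _; rewrite nm1 nmM nmJ.
        by have := nm_ge0 a; have := nm_ge0 z; nra.
      by have := nm_ge0 (p z); nra.
    have hz := nm_ge0 (h z); have a2 := sqr_ge0 (nm a).
    apply: (@le_trans _ _ (nm (h z) * (nm (p z) ^+ 2 + d ^+ 2))).
      rewrite -mulrA; apply: ler_wpM2l; first exact: hz.
      rewrite mulrDr mulr1 lerD2l.
      by have := sqr_ge0 d; nra.
    have -> : nm (h a) * (1 + nm a ^+ 2) ^+ 2 = A * (1 + nm a ^+ 2) by rewrite -hAa; ring.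
    rewrite wE mulrCA mulrC.
    by apply: ler_wpM2r; [lra|exact: hA].
have p0 : p a != 0.
  apply/negP => /eqP E; move: pa; rewrite E nm0 expr0n /= => /esym/eqP.
  by rewrite sqrf_eq0 gt_eqF // ltr_wpDr // sqr_ge0.
move/eqP: H; rewrite !mulf_eq0 (negbTE p0) !orbF => /eqP h0.
by rewrite -hAa h0 nm0 mul0r.
Qed.

(** The functions in question are quotients by x. The radius is chosen to avoid 0 unless x = 0,
    where continuity of h is enough. *)
Lemma interior_max (h : cplx R -> cplx R) (x : cplx R) (A : R) : nm x < 2^-1 ->
  {for x, continuous h} ->
  (forall y : cplx R, nm y < 1 -> y != 0 -> derivable h y 1) ->
  (\forall y \near x, nm y <= 2^-1 -> nm (h y) * (1 + nm y ^+ 2) <= A) ->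
  nm (h x) * (1 + nm x ^+ 2) = A -> A = 0.
Proof.
move=> xh ch dh /nbhs_nmP[d d0 Hd] hA.
have [e [e0 ed eh ex]] : exists e : R, [/\ 0 < e, e <= d, e + nm x <= 2^-1 &
    forall y : cplx R, 0 < nm (y - x) -> nm (y - x) < e -> y != 0].
  have [x0|x0] := eqVneq x 0.
    exists (Num.min d 2^-1); split; rewrite ?lt_min ?d0 ?ge_min ?lexx ?orbT //.
    - by rewrite /= invr_gt0.
    - by rewrite x0 nm0 addr0 ge_min lexx orbT.
    - by move=> y; rewrite x0 subr0 nm_gt0.
  exists (Num.min d (Num.min (nm x) (2^-1 - nm x))); split.
  - by rewrite !lt_min d0 nm_gt0 x0 subr_gt0.
  - by rewrite ge_min lexx.
  - by rewrite -lerBrDr !ge_min lexx !orbT.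
  - move=> y _; rewrite !lt_min => /and3P[_ yx _]; apply/negP => /eqP y0.
    by move: yx; rewrite y0 sub0r nmN ltxx.
have le_half (y : cplx R) : nm (y - x) < e -> nm y <= 2^-1.
  by move=> ye; have := nmD (y - x) x; rewrite subrK; lra.
apply: (@no_weighted_max h x e A ch _ e0 _ _ hA).
- move=> y y0 ye; have := le_half _ ye; move: (ex y y0 ye) => yN yh.
  by apply: dh; [lra|exact: yN].
- by lra.
- by move=> y ye; apply: Hd; [exact: lt_le_trans ed|exact: le_half].
Qed.

End CompactMax.

(** * The glued function on a disc and its maximum *)

Section LocalBound.
Context {R : realType} {n : nat}.
Local Notation Cn := 'rV[cplx R]_n.
Variables (D : set Cn) (q : Cn) (P : Cn -> cplx R) (d0 s t B : R) (N : nat).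
Variable f : cplx R -> Cn.
(** Compare 8 m / s with 1 + M m^2: at m = s / 4 these are 2 and 3/2, at m = s they are 8 and 9. So
    the first piece wins at the inner radius and the second at the outer one. *)
Let M := 8 / s ^+ 2.
Hypotheses (s0 : 0 < s) (sd : 2 * s < d0) (eP : entire P) (t0 : 0 < t).
Hypothesis P_low : forall x : Cn, nm (x - q) <= 2 * s -> t <= nm (P x) ^+ N.
Hypothesis P_sphere : forall x, D x -> nm (x - q) = d0 ->
  (1 + M * (2 * d0) ^+ 2) * nm (P x) ^+ N < t.
Hypothesis P_up : forall x : Cn, nm (x - q) <= d0 -> nm (P x) ^+ N <= B.
Hypothesis f_disc : forall x : cplx R, nm x < 1 -> derivable f x 1 /\ D (f x).
Hypothesis f0q : nm (f 0 - q) < s.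

Let m (x : cplx R) := nm (f x - f 0).
Let Pn (x : cplx R) := nm (P (f x)) ^+ N.
Let sl (x : cplx R) : Cn := if x == 0 then 'D_1 f 0 else x^-1 *: (f x - f 0).
Let w (x : cplx R) := (nm x)^-1 * (1 + nm x ^+ 2).

(** Each piece is w = (1 + |x|^2) / |x| times a factor with subharmonic logarithm: 8 m |P|^N / s
    near the centre, (1 + M m^2) |P|^N up to the sphere of radius d0 about q, and the constant t
    without bound on f. At x = 0 only [va] is needed, and its value there carries the derivative of
    f. *)
Let va (x : cplx R) := 8 / s * nm (sl x) * Pn x * (1 + nm x ^+ 2).
Let vb x := (1 + M * m x ^+ 2) * Pn x * w x.
Let vc x := t * w x.

Let K0 : set (cplx R) := [set x | nm x <= 2^-1].
Let Ka := K0 `&` [set x | m x <= s].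
Let Kc := K0 `&` [set x | s / 4 <= m x].
Let Kb := Kc `&` [set x | nm (f x - q) <= d0].

Let d00 : 0 < d0. Proof. by apply: lt_trans sd; rewrite mulr_gt0. Qed.

Let M0 : 0 < M. Proof. by rewrite divr_gt0 // exprn_gt0. Qed.

Let Ms2 : M * s ^+ 2 = 8. Proof. by rewrite /M divfK // expf_neq0 // lt0r_neq0. Qed.

Let fcont x : nm x < 1 -> {for x, continuous f}.
Proof. by move=> /f_disc[df _]; exact: derivable_continuous. Qed.

Let half_lt x : K0 x -> nm x < 1. Proof. by rewrite /K0 /=; lra. Qed.

Let f_far x (y : Cn) : nm x < 1 -> {for x, continuous (fun x => nm (f x - y))}.
Proof.
move=> x1; apply: (@continuous_comp _ _ _ f (fun z => nm (z - y))); first exact: fcont.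
exact: nm_sub_continuous.
Qed.

Let m_cont x : nm x < 1 -> {for x, continuous m}.
Proof. exact: f_far. Qed.

Let dPf x : nm x < 1 -> derivable (fun x => P (f x) ^+ N) x 1.
Proof.
by move=> x1; apply: cderivableX; apply: entire_derivable => //; have [] := f_disc x1.
Qed.

Let PnE x : Pn x = nm (P (f x) ^+ N). Proof. by rewrite nmX. Qed.

Let Pn_cont x : nm x < 1 -> {for x, continuous Pn}.
Proof.
move=> x1; rewrite (_ : Pn = fun x => nm (P (f x) ^+ N)); last exact/funext.
apply: (@continuous_comp _ _ _ (fun x => P (f x) ^+ N) nm); last exact: nm_continuous.
exact: derivable_continuous (dPf x1).
Qed.

Let mE x : m x = nm x * nm (sl x).
Proof.
rewrite /m /sl; have [->|x0] := eqVneq x 0; first by rewrite subrr !nm0 mul0r.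
by rewrite nmZ nmV mulrA mulfV ?mul1r // nm_eq0.
Qed.

Let vaE x : x != 0 -> va x = 8 / s * m x * Pn x * w x.
Proof.
move=> x0; have nx : nm x != 0 by rewrite nm_eq0.
by rewrite /va /w mE; field; rewrite nx lt0r_neq0.
Qed.

Let sl0_cont : {for 0, continuous sl}.
Proof.
have [df _] : derivable f 0 1 /\ D (f 0) by apply: f_disc; rewrite nm0.
have H := derivable_cdiff df.
apply/(@cvg_nmP _ _ _ (nbhs (0 : cplx R))) => e e0.
have e2 : 0 < e / 2 by rewrite divr_gt0.
have [d dd Hd] := H _ e2; apply/nbhs_nmP; exists d => // x; rewrite subr0 => xd /=.
rewrite /sl eqxx; have [x0|x0] := eqVneq x 0; first by rewrite subrr nm0.
have := Hd x xd; rewrite add0r.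
have -> : f x - f 0 - x *: 'D_1 f 0 = x *: (x^-1 *: (f x - f 0) - 'D_1 f 0).
  by rewrite scalerBr scalerA divff // scale1r.
rewrite nmZ mulrC ler_pM2r ?nm_gt0 // => /le_lt_trans; apply; lra.
Qed.

Let slj j : cplx R -> cplx R := fun x => sl x ord0 j.

Let sl_deriv x j : nm x < 1 -> x != 0 -> derivable (slj j) x 1.
Proof.
move=> x1 x0; have [df _] := f_disc x1.
pose fj : cplx R -> cplx R := fun y => f y ord0 j.
have dj : derivable fj x 1 by exact: cdiff_derivable (cdiff_coord j (derivable_cdiff df)).
have dc : derivable (fun=> - fj 0 : cplx R) x 1 by exact: cderivable_cst.
have /derivable_cdiff H := cderivableM (cderivableV x0) (cderivableD dj dc).
apply: cdiff_derivable (cdiff_near _ H).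
have nx : 0 < nm x by rewrite nm_gt0.
apply: filterS (nbhs_nm x nx) => y /= yx; rewrite /slj /sl.
have [y0|y0] := eqVneq y 0; last by rewrite !mxE.
by move: yx; rewrite y0 sub0r nmN ltxx.
Qed.

Let slj_cont x j : nm x < 1 -> {for x, continuous (slj j)}.
Proof.
move=> x1; have [->|x0] := eqVneq x 0; last first.
  by have H := @sl_deriv x j x1 x0; exact: (derivable_continuous H).
apply: (@continuous_comp _ _ _ sl (fun y : Cn => y ord0 j)); first exact: sl0_cont.
exact: coord_continuous.
Qed.

Let nsl_cont x : nm x < 1 -> {for x, continuous (fun y => nm (sl y))}.
Proof.
move=> x1; have [->|x0] := eqVneq x 0.
  apply: (@continuous_comp _ _ _ sl nm); first exact: sl0_cont.
  exact: nm_continuous.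
have nx : nm x != 0 by rewrite nm_eq0.
have H : {for x, continuous (fun y => (nm y)^-1 * m y)}.
  apply: (@cvgM _ _ (nbhs x)); last exact: m_cont.
  by apply: (@cvgV _ _ (nbhs x)) => //; exact: nm_continuous.
have nx0 : 0 < nm x by rewrite nm_gt0.
have E : \forall y \near x, (nm y)^-1 * m y = nm (sl y) :> R.
  apply: filterS (nbhs_nm x nx0) => y /= yx; rewrite mE.
  have [y0|y0] := eqVneq y 0; first by move: yx; rewrite y0 sub0r nmN ltxx.
  by rewrite mulrA mulVf ?mul1r // nm_eq0.
rewrite /prop_for /continuous_at -(nbhs_singleton E); apply: cvg_trans H.
exact: (near_eq_cvg E).
Qed.

Let w1_cont x : {for x, continuous (fun y : cplx R => 1 + nm y ^+ 2)}.
Proof.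
apply: (@cvgD _ _ _ (nbhs x)); first exact: cst_continuous.
by apply: (@cvgM _ _ (nbhs x)); exact: nm_continuous.
Qed.

Let w_cont x : x != 0 -> {for x, continuous w}.
Proof.
move=> x0; apply: (@cvgM _ _ (nbhs x)); last exact: w1_cont.
by apply: (@cvgV _ _ (nbhs x)); [rewrite nm_eq0|exact: nm_continuous].
Qed.

Let va_cont x : nm x < 1 -> {for x, continuous va}.
Proof.
move=> x1; apply: (@cvgM _ _ (nbhs x)); last exact: w1_cont.
apply: (@cvgM _ _ (nbhs x)); last exact: Pn_cont.
by apply: (@cvgM _ _ (nbhs x)); [exact: cst_continuous|exact: nsl_cont].
Qed.

Let vb_cont x : nm x < 1 -> x != 0 -> {for x, continuous vb}.
Proof.
move=> x1 x0; apply: (@cvgM _ _ (nbhs x)); last exact: w_cont.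
apply: (@cvgM _ _ (nbhs x)); last exact: Pn_cont.
apply: (@cvgD _ _ _ (nbhs x)); first exact: cst_continuous.
apply: (@cvgM _ _ (nbhs x)); first exact: cst_continuous.
by apply: (@cvgM _ _ (nbhs x)); exact: m_cont.
Qed.

Let vc_cont x : x != 0 -> {for x, continuous vc}.
Proof.
by move=> x0; apply: (@cvgM _ _ (nbhs x)); [exact: cst_continuous|exact: w_cont].
Qed.

Let Kc_neq0 x : Kc x -> x != 0.
Proof.
move=> [_ /= mx]; apply/negP => /eqP x0; move: mx.
by rewrite x0 /m subrr nm0; move: s0; lra.
Qed.

Let near_q x : m x <= s -> nm (f x - q) < 2 * s.
Proof. by move=> mx; have := nm_triangle (f 0) (f x) q; rewrite -/(m x); move: f0q; lra. Qed.

Let Pn_ge x : m x <= s -> t <= Pn x.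
Proof. by move=> /near_q/ltW; exact: P_low. Qed.

Let w_gt0 x : x != 0 -> 0 < w x.
Proof.
move=> x0; rewrite mulr_gt0 ?invr_gt0 ?nm_gt0 // ltr_wpDr //.
by rewrite exprn_ge0 // nm_ge0.
Qed.

(* The three pieces are arranged so that where a piece stops being available,
   another one is available and strictly larger. *)
Lemma exists_piece_max : exists A : R, [/\ 0 <= A,
  forall x, Ka x -> va x <= A, forall x, Kb x -> vb x <= A, forall x, Kc x -> vc x <= A &
  [\/ A = 0, exists2 x, Ka x /\ (nm x < 2^-1 -> m x < s) & va x = A,
   exists2 x, Kb x /\ (s / 4 < m x /\ nm (f x - q) < d0) & vb x = A |
   exists2 x, Kc x /\ s / 4 < m x & vc x = A]].
Proof.
have s0' := s0; have sd' := sd; have t0' := t0; have f0q' := f0q; have d00' := d00.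
have M0' := M0; have cK0 : compact K0 by exact: compact_nm_disc.
have mc x : K0 x -> {for x, continuous m} by move=> /half_lt; exact: m_cont.
have cKa : compact Ka by exact: compact_sublevel.
have cKc : compact Kc by exact: compact_superlevel.
have cKb : compact Kb.
  by apply: compact_sublevel => // x [/half_lt x1 _]; exact: f_far.
have [|A1 [A1_ge HA1 EA1]] := @compact_max_extend _ Ka va 0 cKa.
  by move=> x [/half_lt x1 _]; exact: va_cont.
have [|A2 [A2_ge HA2 EA2]] := @compact_max_extend _ Kb vb A1 cKb.
  by move=> x [Kcx _]; apply: vb_cont; [exact: half_lt Kcx.1|exact: Kc_neq0].
have [|A3 [A3_ge HA3 EA3]] := @compact_max_extend _ Kc vc A2 cKc.
  by move=> x Kcx; apply: vc_cont; exact: Kc_neq0.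
have HA2' x : Kb x -> vb x <= A3 by move=> /HA2/le_trans; exact.
have HA1' x : Ka x -> va x <= A3.
  by move=> /HA1/le_trans; apply; exact: le_trans A2_ge A3_ge.
have ab x : Kc x -> m x = s / 4 -> vb x < va x.
  move=> Kcx mx; rewrite vaE ?Kc_neq0 // mx /vb mx.
  have ms : m x <= s by rewrite mx; lra.
  rewrite ltr_pM2r ?w_gt0 ?Kc_neq0 // ltr_pM2r ?(lt_le_trans t0 (Pn_ge ms)) //.
  have -> : 8 / s * (s / 4) = 2 by field; rewrite lt0r_neq0.
  by rewrite exprMn mulrA Ms2; lra.
exists A3; split => //; first by apply: le_trans A1_ge (le_trans A2_ge A3_ge).
have low x : Kc x -> m x = s / 4 -> Ka x /\ Kb x.
  move=> Kcx mx; have ms : m x <= s by rewrite mx; lra.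
  by split; [split => //; exact: Kcx.1|split => //=; apply: ltW; have := near_q ms; lra].
case: EA3 => [EA3|[x Kcx vx]]; last first.
  have := Kcx.2; rewrite /= le_eqVlt => /orP[/eqP/esym mx|mx]; last first.
    by constructor 4; exists x.
  have [Kax Kbx] := low x Kcx mx; have := HA2' x Kbx; rewrite -vx /vb /vc.
  rewrite ler_pM2r ?w_gt0 ?Kc_neq0 // => H.
  have := Pn_ge (Kax.2); have : M * m x ^+ 2 * t <= M * m x ^+ 2 * Pn x.
    by apply: ler_wpM2l (Pn_ge Kax.2); rewrite mulr_ge0 ?exprn_ge0 ?nm_ge0 // ltW.
  have mx0 : 0 < m x by rewrite mx; lra.
  have : 0 < M * m x ^+ 2 * t.
    by apply: mulr_gt0 => //; apply: mulr_gt0 => //; rewrite exprn_gt0.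
  by move: H; rewrite mulrDl; lra.
case: EA2 => [EA2|[x Kbx vx]]; last first.
  have [Kcx /= xd] := Kbx; have xA : vb x = A3 by rewrite vx EA3.
  constructor 3; exists x => //; split => //; split.
    have := Kcx.2; rewrite /= le_eqVlt => /orP[/eqP/esym mx|//].
    have [Kax _] := low x Kcx mx; have := HA1' x Kax; rewrite -xA leNgt.
    by rewrite ab.
  rewrite lt_neqAle xd andbT; apply/negP => /eqP xd0.
  have := HA3 x Kcx; rewrite -xA /vb /vc ler_pM2r ?w_gt0 ?Kc_neq0 // leNgt => /negP; apply.
  have x1 := half_lt Kcx.1; apply: le_lt_trans (P_sphere (f_disc x1).2 xd0).
  apply: ler_wpM2r; first by rewrite exprn_ge0 // nm_ge0.
  rewrite lerD2l ler_wpM2l ?(ltW M0) // ler_pXn2r ?nnegrE ?nm_ge0 //; last by lra.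
  by have := nm_triangle q (f x) (f 0); rewrite nmB xd0 (nmB q) -/(m x) nmB -/(m x); lra.
case: EA1 => [EA1|[x Kax vx]]; first by constructor 1; rewrite EA3 EA2.
have xA : va x = A3 by rewrite vx EA3.
constructor 2; exists x => //; split => // xh.
have [Kx /= xs] := Kax; rewrite lt_neqAle xs andbT; apply/negP => /eqP xse.
have Kcx : Kc x by split => //=; rewrite xse; lra.
have Kbx : Kb x by split => //=; apply: ltW; have := near_q xs; lra.
have := HA2' x Kbx; rewrite -xA vaE ?Kc_neq0 // /vb ler_pM2r ?w_gt0 ?Kc_neq0 //.
rewrite ler_pM2r ?(lt_le_trans t0 (Pn_ge xs)) // xse Ms2 divfK ?lt0r_neq0 //.
by lra.
Qed.

Let fjN j x : nm (f x ord0 j - f 0 ord0 j) <= m x.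
Proof. by have := nm_coord (f x - f 0) ord0 j; rewrite !mxE. Qed.

Let cauchy (a b : cplx R) : nm (1 + M%:C * a^*%C * b : cplx R) ^+ 2 <=
  (1 + M * nm a ^+ 2) * (1 + M * nm b ^+ 2).
Proof.
rewrite -subr_ge0 [X in 0 <= X](_ : _ = M * nm (a - b) ^+ 2).
  by apply: mulr_ge0; [exact: ltW M0|exact: sqr_ge0].
by rewrite !nm_sqr; case: a b => [a1 a2] [b1 b2] /=; move: M => N'; ring.
Qed.

Let near_lt x (g : cplx R -> R) c : {for x, continuous g} -> g x < c ->
  \forall y \near x, g y < c.
Proof.
move=> cg gx; have : nbhs x (g @^-1` [set u | u < c]); last by [].
by apply: cg; apply: open_nbhs_nbhs; split; [exact: open_lt|exact: gx].
Qed.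

Let near_gt x (g : cplx R -> R) c : {for x, continuous g} -> c < g x ->
  \forall y \near x, c < g y.
Proof.
move=> cg gx; have : nbhs x (g @^-1` [set u | c < u]); last by [].
by apply: cg; apply: open_nbhs_nbhs; split; [exact: open_gt|exact: gx].
Qed.

(** At x the maximum norm of the slope is attained by a coordinate j. That coordinate is holomorphic
    and nowhere exceeds the norm, so it inherits the maximum. *)
Let max_a x A : nm x < 2^-1 -> (forall x, Ka x -> va x <= A) -> m x < s -> va x = A -> A = 0.
Proof.
move=> xh HA mx vx; have x1 : nm x < 1 by lra.
have [slx|slx] := eqVneq (sl x) 0.
  by rewrite -vx /va slx nm0 mulr0 !mul0r.
have [j slj_x] := nm_coord_eq slx.
pose h (y : cplx R) : cplx R := (8 / s)%:C * (slj j y * P (f y) ^+ N).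
have s8 : 0 <= 8 / s by rewrite divr_ge0 // ltW.
have hE y : nm (h y) = 8 / s * nm (slj j y) * Pn y.
  by rewrite /h !nmM nmC ger0_norm // PnE mulrA.
apply: (@interior_max _ h x A xh).
- apply: (@cvgM _ _ (nbhs x)); first exact: cst_continuous.
  apply: (@cvgM _ _ (nbhs x)); first exact: slj_cont.
  exact: (derivable_continuous (dPf x1)).
- move=> y y1 y0; have H1 : derivable (fun=> (8 / s)%:C : cplx R) y 1 by exact: cderivable_cst.
  exact: (cderivableM H1 (cderivableM (@sl_deriv y j y1 y0) (dPf y1))).
- apply: filterS (near_lt (m_cont x1) mx) => y /= my yh.
  apply: le_trans (HA y _); last by split => //=; exact: ltW.
  rewrite hE /va; apply: ler_wpM2r; first by rewrite addr_ge0 // sqr_ge0.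
  apply: ler_wpM2r; first by rewrite exprn_ge0 // nm_ge0.
  by apply: ler_wpM2l => //; exact: nm_coord.
- by rewrite hE -vx /va slj_x.
Qed.

(* By Cauchy-Schwarz, (1 + M |g|^2) dominates the modulus of a square of a
   holomorphic function, with equality at x. *)
Let max_b x A : nm x < 2^-1 -> (forall x, Kb x -> vb x <= A) ->
  s / 4 < m x -> nm (f x - q) < d0 -> vb x = A -> A = 0.
Proof.
move=> xh HA mx xd vx; have x1 : nm x < 1 by lra.
have s0' := s0; have fxN : f x - f 0 != 0 by rewrite -nm_gt0 -/(m x); lra.
have x0 : x != 0 by apply/negP => /eqP x0; move: fxN; rewrite x0 subrr eqxx.
have [j fxj] := nm_coord_eq fxN.
pose fj : cplx R -> cplx R := fun y => f y ord0 j.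
have dj y : nm y < 1 -> derivable fj y 1.
  by move=> /f_disc[df _]; exact: cdiff_derivable (cdiff_coord j (derivable_cdiff df)).
pose g (y : cplx R) : cplx R := fj y + - fj 0.
have dg y : nm y < 1 -> derivable g y 1.
  move=> y1; have dc : derivable (fun=> - fj 0 : cplx R) y 1 by exact: cderivable_cst.
  exact: (cderivableD (dj y y1) dc).
have gE y : nm (g y) <= m y by exact: fjN.
have gx : nm (g x) = m x by rewrite [RHS]fxj !mxE.
pose c : R := 1 + M * m x ^+ 2.
have c0 : 0 < c by rewrite ltr_wpDr // mulr_ge0 ?sqr_ge0 // ltW // M0.
pose k (y : cplx R) : cplx R := 1 + M%:C * (g x)^*%C * g y.
have dk y : nm y < 1 -> derivable k y 1.
  move=> y1; have d1 : derivable (fun=> 1 : cplx R) y 1 by exact: cderivable_cst.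
  have dc : derivable (fun=> M%:C * (g x)^*%C : cplx R) y 1 by exact: cderivable_cst.
  exact: (cderivableD d1 (cderivableM dc (dg y y1))).
pose h (y : cplx R) : cplx R := (c^-1)%:C * (k y ^+ 2 * (P (f y) ^+ N * y^-1)).
have hE y : nm (h y) = c^-1 * (nm (k y) ^+ 2 * (Pn y * (nm y)^-1)).
  rewrite /h nmM nmC ger0_norm ?invr_ge0 ?(ltW c0) // nmM (nmX (k y)) nmM nmV.
  by rewrite -PnE.
have dh y : nm y < 1 -> y != 0 -> derivable h y 1.
  move=> y1 y0; have dc : derivable (fun=> (c^-1)%:C : cplx R) y 1 by exact: cderivable_cst.
  have dk2 := @cderivableX R k 2 y (dk y y1).
  exact: (cderivableM dc (cderivableM dk2 (cderivableM (dPf y1) (cderivableV y0)))).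
apply: (@interior_max _ h x A xh).
- exact: (derivable_continuous (dh x x1 x0)).
- exact: dh.
- have N1 := near_gt (m_cont x1) mx; have N2 := near_lt (@f_far x q x1) xd.
  apply: filterS (filterI N1 N2) => y /= [my yd] yh.
  apply: le_trans (HA y _); last by split; [split => //=; exact: ltW|exact: ltW].
  have kc : nm (k y) ^+ 2 <= c * (1 + M * m y ^+ 2).
    apply: le_trans (cauchy _ _) _; rewrite gx -/c; apply: ler_wpM2l; first exact: ltW.
    rewrite lerD2l; apply: ler_wpM2l; first exact: ltW M0.
    by rewrite ler_pXn2r ?nnegrE ?nm_ge0 // gE.
  pose T := Pn y * (nm y)^-1 * (1 + nm y ^+ 2).
  have T0 : 0 <= T.
    apply: mulr_ge0; last by rewrite addr_ge0 // sqr_ge0.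
    by apply: mulr_ge0; [rewrite exprn_ge0 // nm_ge0|rewrite invr_ge0 nm_ge0].
  have -> : vb y = (1 + M * m y ^+ 2) * T by rewrite /vb /w /T !mulrA.
  have -> : nm (h y) * (1 + nm y ^+ 2) = c^-1 * nm (k y) ^+ 2 * T.
    by rewrite hE /T !mulrA.
  by apply: ler_wpM2r => //; rewrite ler_pdivrMl.
- rewrite hE -vx /vb /w -/c; have -> : nm (k x) = c.
    rewrite /k -mulrA; have -> : (g x)^*%C * g x = (nm (g x) ^+ 2)%:C.
      by rewrite nm_sqr; case: (g x) => a b; apply/eqP; rewrite eq_complex /=;
        apply/andP; split; apply/eqP; ring.
    by rewrite gx -RtoCM -[1](_ : 1%:C = 1) // -RtoCD nmC gtr0_norm.
  have -> : c^-1 * (c ^+ 2 * (Pn x / nm x)) = c * (Pn x / nm x).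
    by rewrite expr2 !mulrA mulVf ?mul1r // lt0r_neq0.
  by rewrite !mulrA.
Qed.

Let max_c x A : nm x < 2^-1 -> (forall x, Kc x -> vc x <= A) ->
  s / 4 < m x -> vc x = A -> A = 0.
Proof.
move=> xh HA mx vx; have x1 : nm x < 1 by lra.
have s0' := s0; have fxN : f x - f 0 != 0 by rewrite -nm_gt0 -/(m x); lra.
have x0 : x != 0 by apply/negP => /eqP x0; move: fxN; rewrite x0 subrr eqxx.
pose h (y : cplx R) : cplx R := t%:C * y^-1.
have hE y : nm (h y) = t * (nm y)^-1 by rewrite nmM nmC nmV gtr0_norm.
have dh y : y != 0 -> derivable h y 1.
  move=> y0; have dc : derivable (fun=> t%:C : cplx R) y 1 by exact: cderivable_cst.
  exact: (cderivableM dc (cderivableV y0)).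
apply: (@interior_max _ h x A xh).
- exact: (derivable_continuous (dh x x0)).
- by move=> y _; exact: dh.
- apply: filterS (near_gt (m_cont x1) mx) => y /= my yh.
  apply: le_trans (HA y _); last by split => //=; exact: ltW.
  by rewrite hE /vc /w mulrA.
- by rewrite hE -vx /vc /w mulrA.
Qed.

(** A maximum with |x| < 1/2 forces A = 0, so it sits on |x| = 1/2, where w = 5/2: the pieces are at
    most 8 B * 5/2, and 5/2 rounded up to 3 times the other two. On the left is a lower bound of
    [va] at 0. *)
Lemma local_bound : nm ('D_1 f 0) * (8 / s * t) <=
  20 * B + 3 * ((1 + M * (2 * d0) ^+ 2) * B) + 3 * t.
Proof.
have s0' := s0; have sd' := sd; have t0' := t0; have f0q' := f0q; have d00' := d00.
have M0' := M0; have [A [A0 HA HB HC EA]] := exists_piece_max.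
have m00 : m 0 = 0 by rewrite /m subrr nm0.
have K00 : K0 0 by rewrite /K0 /= nm0 invr_ge0.
have B0 : 0 <= B.
  have ms : m 0 <= s by rewrite m00 ltW.
  by apply: le_trans (P_up (ltW (lt_trans (near_q ms) sd))); rewrite exprn_ge0 // nm_ge0.
pose C1 := (1 + M * (2 * d0) ^+ 2) * B.
have C10 : 0 <= C1.
  by rewrite mulr_ge0 // addr_ge0 // mulr_ge0 ?sqr_ge0 // ltW.
have M1 : 0 < 8 / s by rewrite divr_gt0.
suff AC : A <= 20 * B + 3 * C1 + 3 * t.
  apply: le_trans AC; have := HA 0; rewrite /va {1}/sl eqxx nm0 expr0n addr0 mulr1.
  have ms : m 0 <= s by rewrite m00 ltW.
  move=> /(_ (conj K00 ms)); apply: le_trans; rewrite mulrA [nm _ * _]mulrC.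
  by apply: ler_wpM2l (Pn_ge ms); apply: mulr_ge0; [exact: ltW|exact: nm_ge0].
have w_half x : nm x = 2^-1 -> w x = 5 / 2 by move=> xh; rewrite /w xh; field.
have Pn0 x : 0 <= Pn x by rewrite exprn_ge0 // nm_ge0.
have A00 : A = 0 -> A <= 20 * B + 3 * C1 + 3 * t by move=> ->; lra.
have Pn_up x : nm (f x - q) <= d0 -> Pn x <= B by exact: P_up.
have half x : K0 x -> nm x < 2^-1 \/ nm x = 2^-1.
  by rewrite /K0 /= le_eqVlt => /orP[/eqP|]; [right|left].
have halfN x : nm x = 2^-1 -> x != 0.
  by move=> xh; apply/negP => /eqP x0; move: xh; rewrite x0 nm0; lra.
case: EA => [A00'|[x [Kx ms] vx]|[x [Kx [mx xd]] vx]|[x [Kx mx] vx]].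
- exact: A00.
- have [xh|xh] := half _ Kx.1; first by apply: A00; apply: max_a HA (ms xh) vx.
  rewrite -vx vaE ?halfN // w_half //.
  have h1 : 8 / s * m x <= 8 by rewrite mulrAC ler_pdivrMr // ler_pM2l //; exact: Kx.2.
  have h2 : Pn x <= B by apply: Pn_up; apply: ltW (lt_trans (near_q Kx.2) sd).
  have h3 : 0 <= 8 / s * m x by rewrite mulr_ge0 ?nm_ge0 // ltW.
  have := ler_pM h3 (Pn0 x) h1 h2; lra.
- have [xh|xh] := half _ Kx.1.1; first by apply: A00; apply: max_b HB mx xd vx.
  rewrite -vx /vb w_half //.
  have h2 : Pn x <= B by apply: Pn_up; exact: ltW.
  have h1 : 1 + M * m x ^+ 2 <= 1 + M * (2 * d0) ^+ 2.
    rewrite lerD2l; apply: ler_wpM2l; first exact: ltW.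
    rewrite ler_pXn2r ?nnegrE ?nm_ge0 //; last by lra.
    have := nm_triangle q (f x) (f 0); rewrite (nmB q) -/(m x); lra.
  have h3 : 0 <= 1 + M * m x ^+ 2 by rewrite addr_ge0 // mulr_ge0 ?sqr_ge0 // ltW.
  by have := ler_pM h3 (Pn0 x) h1 h2; rewrite -/C1; lra.
- have [xh|xh] := half _ Kx.1; first by apply: A00; apply: max_c HC mx vx.
  by rewrite -vx /vc w_half //; lra.
Qed.

End LocalBound.

(** A large power N makes the peak function so much smaller on the sphere than near q that the
    factor K = 1 + M (2 d0)^2 is absorbed. The constants depend on P and q but not on the disc. *)
Lemma local_derivative_bound (R : realType) (n : nat) (D : set 'rV[cplx R]_n)
    (q : 'rV[cplx R]_n) (d0 th : R) (P : 'rV[cplx R]_n -> cplx R) :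
  0 < d0 -> entire P -> P q = 1 -> th < 1 ->
  (forall x, D x -> nm (x - q) = d0 -> nm (P x) <= th) ->
  exists r C : R, 0 < r /\ forall f, holomorphic_disc D f -> nm (f 0 - q) < r ->
    nm ('D_1 f 0) <= C.
Proof.
move=> d00 eP Pq th1 HP.
have [t' [t'0 t'1 HP']] : exists t' : R, [/\ 0 <= t', t' < 1 &
    forall x, D x -> nm (x - q) = d0 -> nm (P x) <= t'].
  have [th0|th0] := leP 0 th; first by exists th.
  by exists 0; split => // x Dx xd; apply: le_trans (HP x Dx xd) (ltW th0).
(* Halfway between the bound on the sphere and P q = 1, so |P| >= t2 near q. *)
pose t2 := (1 + t') / 2.
have t20 : 0 < t2 by rewrite /t2; lra.
have t2t : t' < t2 by rewrite /t2; lra.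
have cP x : {for x, continuous (fun y => nm (P y))}.
  apply: (@continuous_comp _ _ _ P nm); first exact: entire_continuous.
  exact: nm_continuous.
have [e [e0 He]] : exists e : R, 0 < e /\ forall x, nm (x - q) < e -> t2 <= nm (P x).
  have : nbhs q ((fun y => nm (P y)) @^-1` [set u | t2 < u]).
    apply: cP; apply: open_nbhs_nbhs; split; first exact: open_gt.
    by rewrite /= Pq nm1 /t2; lra.
  by move=> /nbhs_nmP[e e0 He]; exists e; split => // x /He/ltW.
have [s [s0 sd se]] : exists s : R, [/\ 0 < s, 2 * s < d0 & 2 * s < e].
  have [de|de] := leP d0 e; first by exists (d0 / 4); split; lra.
  by exists (e / 4); split; lra.
pose M := 8 / s ^+ 2; pose K := 1 + M * (2 * d0) ^+ 2.
have K0 : 0 < K.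
  by rewrite ltr_wpDr // mulr_ge0 ?sqr_ge0 // divr_ge0 // sqr_ge0.
pose k := t' / t2.
have k1 : `|k| < 1.
  rewrite ger0_norm; first by rewrite /k ltr_pdivrMr // mul1r.
  by rewrite /k divr_ge0 // ltW.
(* With t = t2^N this says that K |P|^N < t on the sphere, the condition for the constant piece to
   win there. *)
have [N HN] : exists N : nat, K * k ^+ N < 1.
  have Ki : 0 < K^-1 by rewrite invr_gt0.
  have /cvgrPdist_lt /(_ _ Ki) [N _ HN] := cvg_expr k1.
  exists N; have := HN N (leqnn N); rewrite /= sub0r normrN => h.
  by rewrite -ltr_pdivlMl // mulr1; apply: le_lt_trans h; exact: ler_norm.
pose t := t2 ^+ N.
have t0 : 0 < t by rewrite exprn_gt0.
have Plow x : nm (x - q) <= 2 * s -> t <= nm (P x) ^+ N.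
  by move=> xs; apply: lerXn2r; rewrite ?nnegrE ?nm_ge0 ?(ltW t20) //; apply: He; lra.
have Psph x : D x -> nm (x - q) = d0 -> K * nm (P x) ^+ N < t.
  move=> Dx xd; have h : nm (P x) ^+ N <= t' ^+ N.
    by apply: lerXn2r; rewrite ?nnegrE ?nm_ge0 //; exact: HP'.
  apply: le_lt_trans (ler_wpM2l (ltW K0) h) _.
  have -> : t' = k * t2 by rewrite /k divfK // lt0r_neq0.
  by rewrite exprMn mulrA gtr_pMl.
have [B HB] : exists B : R, forall x, nm (x - q) <= d0 -> nm (P x) ^+ N <= B.
  have [||c _ Hc] := @compact_EVT_max _ R (fun y => nm (P y)) _ _ (@compact_nm_ball R n q d0).
  - by exists q => /=; rewrite subrr nm0 ltW.
  - by apply: continuous_subspaceT => x; exact: cP.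
  exists (nm (P c) ^+ N) => x xd; apply: lerXn2r; rewrite ?nnegrE ?nm_ge0 //.
  by apply: Hc; exact/mem_set.
exists s, ((20 * B + 3 * (K * B) + 3 * t) / (8 / s * t)); split => // f /holomorphic_discP Hf fq.
rewrite ler_pdivlMr; last by rewrite !mulr_gt0 // invr_gt0.
exact: (@local_bound R n D q P d0 s t B N f s0 sd eP t0 Plow Psph HB Hf fq).
Qed.

(** * Visibility *)

Section RealInduction.
Context {R : realType}.

(** The supremum of the initial intervals on which S holds belongs to them and equals b. It replaces
    the integration of differential inequalities along a disc. *)
Lemma real_induction (S : R -> Prop) (a b : R) : a <= b -> S a ->
  (forall t, a <= t -> t < b -> (forall s, a <= s -> s <= t -> S s) ->
     exists2 d : R, 0 < d & forall s, t < s -> s < t + d -> s <= b -> S s) ->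
  (forall t, a < t -> t <= b -> (forall s, a <= s -> s < t -> S s) -> S t) ->
  S b.
Proof.
move=> ab Sa step lim.
pose E := [set t | a <= t <= b /\ forall s, a <= s -> s <= t -> S s].
have Ea : E a.
  split=> [|s as_ sa]; first by rewrite lexx ab.
  by have -> : s = a by apply/eqP; rewrite eq_le sa as_.
have hE : has_sup E.
  by split; [exists a|exists b => t [/andP[_ tb] _]].
set T := sup E.
have aT : a <= T by exact: sup_upper_bound hE _ Ea.
have Tb : T <= b by apply: ge_sup; [exists a|move=> t [/andP[_ tb] _]].
have below s : a <= s -> s < T -> S s.
  move=> as_ sT; have sT0 : 0 < T - s by rewrite subr_gt0.
  have [t [_ Et] st] := sup_adherent sT0 hE.
  by apply: Et => //; move: st; rewrite -/T; lra.
have ST : S T.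
  have [aT'|] := ltP a T; first exact: lim.
  by move=> Ta; have <- : a = T by apply/eqP; rewrite eq_le aT Ta.
have upto s : a <= s -> s <= T -> S s.
  by move=> as_; rewrite le_eqVlt => /orP[/eqP ->//|]; exact: below.
have [Tb'|bT] := ltP T b; last by have <- : T = b by apply/eqP; rewrite eq_le Tb bT.
have [d d0 Hd] := step T aT Tb' upto.
have [t [Tt td tb]] : exists t, [/\ T < t, t < T + d & t <= b].
  have [h|h] := leP (T + d / 2) b; first by exists (T + d / 2); split; lra.
  by exists b; split; lra.
suff : t <= T by lra.
apply: sup_upper_bound hE _ _; split=> [|s as_ st]; first by apply/andP; split; lra.
have [sT|Ts] := leP s T; first exact: upto.
by apply: Hd => //; lra.
Qed.

Lemma first_exit (V : normedModType (cplx R)) (A : set V) (g : R -> V) (a b : R) :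
  open A -> {within `[a, b], continuous g} -> a <= b -> A (g a) -> ~ A (g b) ->
  exists t, [/\ a < t, t <= b, forall s, a <= s -> s < t -> A (g s), ~ A (g t) &
    closure A (g t)].
Proof.
move=> oA /continuous_itv_nmP gc ab Aa Ab; apply: contrapT => H; apply: Ab.
apply: (@real_induction (fun t => A (g t)) a b) => // t.
  move=> at_ tb Hs; have At : A (g t) by exact: Hs.
  have /open_nmP/(_ _ At)[e e0 He] := oA.
  have tab : t \in `[a, b] by rewrite in_itv /= at_ ltW.
  have [r r0 Hr] := gc t tab e e0; exists r => // s ts sr sb.
  apply: He; apply: Hr; first by rewrite in_itv /=; lra.
  by rewrite ger0_norm; lra.
move=> at_ tb Hs; apply: contrapT => At; apply: H; exists t; split => //.
apply/closure_nmP => e e0.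
have tab : t \in `[a, b] by rewrite in_itv /= tb ltW.
have [r r0 Hr] := gc t tab e e0.
have [s [as_ st sr]] := left_near at_ r0.
exists (g s); first exact: Hs.
by apply: Hr => //; rewrite in_itv /=; lra.
Qed.

End RealInduction.

Section Convex.
Context {R : realType} {n : nat}.
Local Notation Cn := 'rV[cplx R]_n.
Variable G : set Cn.
Hypotheses (oG : open G) (convG : convexC G).

(** Replace y by a nearby y' in G and absorb the error in x, which has room because G is open. *)
Lemma convex_interior (x y : Cn) (t : R) : G x -> closure G y -> 0 <= t -> t < 1 ->
  G ((1 - t)%:C *: x + t%:C *: y).
Proof.
move=> Gx cy t0 t1; have [->|tN] := eqVneq t 0; first by rewrite subr0 scale1r scale0r addr0.
have tp : 0 < t by rewrite lt_def tN.
have u0 : 0 < 1 - t by rewrite subr_gt0.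
have /open_nmP/(_ x Gx)[e e0 He] := oG.
have d0 : 0 < e * (1 - t) / t by rewrite !mulr_gt0 // invr_gt0.
have /closure_nmP/(_ _ d0)[y' Gy' y'y] := cy.
pose x' := x + (t / (1 - t))%:C *: (y - y').
have Gx' : G x'.
  apply: He; rewrite /x' addrC addKr nmZR ger0_norm; last by rewrite divr_ge0 // ltW.
  rewrite nmB mulrAC ltr_pdivrMr // mulrC -ltr_pdivlMr //.
have := convG Gy' Gx' t0 (ltW t1).
have -> : t%:C *: y' + (1 - t)%:C *: x' = (1 - t)%:C *: x + t%:C *: y; last by [].
rewrite /x' scalerDr scalerA -RtoCM mulrCA mulfV ?mulr1 ?lt0r_neq0 //.
by rewrite addrCA -scalerDr [y' + _]addrC subrK.
Qed.

Lemma convex_closure : convexC (closure G).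
Proof.
move=> x y t cx cy t0 t1; apply/closure_nmP => e e0.
have /closure_nmP/(_ _ e0)[x' Gx' xx'] := cx.
have /closure_nmP/(_ _ e0)[y' Gy' yy'] := cy.
exists (t%:C *: x' + (1 - t)%:C *: y'); first exact: convG.
have -> : t%:C *: x' + (1 - t)%:C *: y' - (t%:C *: x + (1 - t)%:C *: y) =
    t%:C *: (x' - x) + (1 - t)%:C *: (y' - y).
  by rewrite !scalerBr opprD addrACA.
apply: le_lt_trans (nmD _ _) _; rewrite !nmZR (ger0_norm t0) ger0_norm ?subr_ge0 //.
have [->|tN] := eqVneq t 0; first by rewrite mul0r subr0; lra.
have tp : 0 < t by rewrite lt_def tN.
by nra.
Qed.

Lemma convex_kob_lty x y : G x -> G y -> (kobayashi G x y < +oo)%E.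
Proof.
move=> Gx Gy; pose c (t : R) := x + t%:C *: (y - x).
have Gc t : 0 <= t -> t <= 1 -> G (c t).
  move=> t0 t1; have := convG Gy Gx t0 t1; congr G.
  by rewrite /c RtoCB scalerBl scale1r scalerBr addrCA.
pose K := c @` `[0, 1].
have cK : compact K.
  apply: continuous_compact; last exact: segment_compact.
  apply/continuous_itv_nmP => t _ e e0.
  have D0 : 0 < nm (y - x) + 1 by rewrite ltr_wpDl // nm_ge0.
  exists (e / (nm (y - x) + 1)); first by rewrite divr_gt0.
  move=> s _; rewrite ltr_pdivlMr // => st.
  have -> : c s - c t = (s - t)%:C *: (y - x).
    by rewrite /c RtoCB scalerBl opprD addrACA subrr add0r.
  rewrite nmZR; apply: le_lt_trans st; apply: ler_wpM2l => //; lra.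
have [|e e0 He] := compact_open_dist cK oG.
  move=> z [t t01 <-]; move: t01; rewrite /= in_itv /= => /andP[t0 t1]; exact: Gc.
have -> : y = x + (y - x) by rewrite addrC subrK.
apply: (@le_lt_trans _ _ (nm (y - x) / e)%:E); last exact: ltry.
apply: kob_segment => // t; rewrite in_itv /= => t01.
  by apply: Gc; lra.
apply: kr_ball => // z; apply: He; exists t => //.
Qed.

End Convex.

Section Visibility.
Context {R : realType} {n : nat}.
Local Notation Cn := 'rV[cplx R]_n.
Variable G : set Cn.
Hypotheses (oG : open G) (convG : convexC G).
Hypothesis sep : forall x y, G x -> G y -> kobayashi G x y = 0%E -> x = y.
Hypothesis complete : forall u : nat -> Cn, (forall k, G (u k)) -> kobayashi_cauchy G u ->
  exists2 x, G x & kobayashi G (u k) x @[k --> \oo] --> 0%E.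
Hypothesis vis : forall p q, boundary G p -> boundary G q -> p <> q ->
  visible_geodesics G p q.
Variable o : Cn.
Hypothesis Go : G o.
Implicit Types (x y z p q v : Cn).

Let fin x y : G x -> G y -> (kobayashi G x y < +oo)%E.
Proof. exact: convex_kob_lty. Qed.

Local Notation kd := (kd G).

Let tri y x z : G x -> G y -> G z -> kd x z <= kd x y + kd y z.
Proof. exact: (kd_triangle oG fin). Qed.

Lemma kob_disc_segment x w : (forall l : cplx R, nm l <= 2 -> G (x + l *: w)) ->
  (kobayashi G x (x + w) <= 1%:E)%E.
Proof.
move=> Gw; apply: kob_segment; first exact: oG.
  move=> s; rewrite in_itv /= => /andP[s0 s1]; apply: Gw.
  by rewrite nmC ger0_norm //; apply: le_trans s1 _; rewrite ler1n.
move=> s; rewrite in_itv /= => /andP[s0 s1].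
apply: ereal_le_lt => b; rewrite lte_fin => b1; apply: ltW; apply/kr_ltP.
exists 1; split; [exact: ltr01|exact: b1|].
exists (fun u : cplx R => x + (s%:C + u) *: w).
have cdc (a : cplx R) : cdiff (fun u : cplx R => x + (s%:C + u) *: w) a w.
  move=> e' e'0; exists 1; first exact: ltr01.
  move=> h _.
  have -> : x + (s%:C + (a + h)) *: w - (x + (s%:C + a) *: w) - h *: w = 0.
    by apply/matrixP => i j; rewrite !mxE; ring.
  by rewrite nm0; apply: mulr_ge0; [exact: ltW|exact: nm_ge0].
split.
- apply/holomorphic_discP => z z1; split; first exact: cdiff_derivable (cdc z).
  apply: Gw; apply: le_trans (nmD _ _) _; rewrite nmC ger0_norm //.
  by apply: lerD s1 _; exact: ltW.
- by rewrite addr0.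
- by exists w; [exact: cdc|rewrite scale1r].
Qed.

Lemma kd_bounded_compact (K : set Cn) : compact K -> K `<=` G ->
  exists2 C : R, 0 < C & forall x, K x -> kd x o <= C.
Proof.
move=> cK KG; have [||e e0 He] := @compact_unif R _ K (fun e x => kd x o <= e^-1) cK.
- move=> e e' y e'0 e'e /le_trans; apply; rewrite lef_pV2 ?posrE //.
  exact: lt_le_trans e'0 e'e.
- move=> x Kx; have Gx := KG x Kx.
  have [d d0 [dG dk]] := kd_continuous oG fin Gx ltr01.
  have k0 := kd_ge0 G x o; exists (1 + kd x o)^-1; first by rewrite invr_gt0; lra.
  exists d => // y yd; rewrite invrK; have := tri (dG y yd) Gx Go.
  by have := dk y yd; rewrite (kd_sym oG y x); lra.
by exists e^-1; rewrite ?invr_gt0.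
Qed.

Lemma boundary_notin q : boundary G q -> ~ G q.
Proof. by move=> [_ iq] Gq; apply: iq; apply: open_nbhs_nbhs. Qed.

Lemma geodesic_kd (L : R) g s t : geodesic G `[0, L] g -> s \in `[0, L] -> t \in `[0, L] ->
  kd (g s) (g t) = `|s - t|.
Proof. by move=> [_ _ _ H] sL tL; rewrite -[LHS]/(fine (kobayashi G _ _)) H. Qed.

(** Suppose the disc of radius r lies in the closure. Moved slightly towards o it lies in G, and its
    points x near q and y near q' = q + (r / 2) v are at distance at most 1. A geodesic from x to y
    meets the compact set of visibility for q and q', so x stays in a fixed ball about o. That ball
    is compact in G by Hopf-Rinow and cannot approach q. *)
Lemma boundary_no_disc q v (r : R) : boundary G q -> v != 0 -> 0 < r ->
  exists2 l : cplx R, nm l <= r & ~ closure G (q + l *: v).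
Proof.
move=> bq vN r0; apply: contrapT => H.
have Hcl (l : cplx R) : nm l <= r -> closure G (q + l *: v).
  by move=> lr; apply: contrapT => nc; apply: H; exists l.
have nGq := boundary_notin bq.
pose q' := q + (r / 2)%:C *: v.
have r20 : 0 < r / 2 by rewrite divr_gt0.
have nmr (s : R) : `|s| <= r -> nm (s%:C : cplx R) <= r by rewrite nmC.
have cq' : closure G q' by apply: Hcl; rewrite nmC ger0_norm; lra.
have nGq' : ~ G q'.
  (* q is the midpoint of q' and of q - (r / 2) v, which is in the closure; if q' were interior, so
     would be q. *)
  move=> Gq'; apply: nGq.
  have cq'' : closure G (q + (- (r / 2))%:C *: v).
    by apply: Hcl; rewrite nmC normrN ger0_norm; lra.
  have h0 : 0 <= 2^-1 :> R by rewrite invr_ge0.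
  have h1 : 2^-1 < 1 :> R by rewrite invf_lt1 // ltr1n.
  have := convex_interior oG convG Gq' cq'' h0 h1.
  have -> : (1 - 2^-1)%:C *: q' + (2^-1)%:C *: (q + (- (r / 2))%:C *: v) = q; last by [].
    rewrite /q' !scalerDr !scalerA -!RtoCM addrACA -!scalerDl -!RtoCD.
    have -> : (1 - 2^-1) * (r / 2) + 2^-1 * - (r / 2) = 0 by field.
    by rewrite subrK scale1r scale0r addr0.
have bq' : boundary G q' by split => // /interior_subset.
have qq' : q <> q'.
  move=> /eqP; rewrite -subr_eq0 /q' opprD addrA subrr add0r oppr_eq0 scaler_eq0.
  by rewrite (negbTE vN) orbF RtoC_eq0 gt_eqF.
have [U' [V' [K [nU nV _ [cK KG] Hg]]]] := vis bq bq' qq'.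
have [C C0 HC] := kd_bounded_compact cK KG.
have cB := @hopf_rinow R n G oG fin sep complete o (C + 1) Go.
have /compact_closed clB := cB; have {}clB := clB (@norm_hausdorff _ _).
have [e e0 He] : exists2 e : R, 0 < e & forall x, nm (x - q) < e -> ~ kball G o (C + 1) x.
  apply: contrapT => He; apply: nGq.
  suff /clB [] : closure (kball G o (C + 1)) q by [].
  apply/closure_nmP => e e0; apply: contrapT => Hx; apply: He; exists e => // x xq Bx.
  by apply: Hx; exists x.
move/nbhs_nmP: nU => [e1 e10 HU]; move/nbhs_nmP: nV => [e2 e20 HV].
(* Closeness to q defeats the compact ball and enters the first visibility neighbourhood; closeness
   to q' enters the second. *)
have [t [t0 t1 te te1 te2]] : exists t : R, [/\ 0 <= t, t < 1,
    (1 - t) * nm (o - q) < e, (1 - t) * nm (o - q) < e1 & (1 - t) * nm (o - q') < e2].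
  pose m := Num.min 1 (Num.min e (Num.min e1 e2)).
  have [m0 m1 me me1 me2] : [/\ 0 < m, m <= 1, m <= e, m <= e1 & m <= e2].
    by rewrite !ge_min !lexx !orbT !lt_min ltr01 e0 e10 e20.
  pose B := nm (o - q) + nm (o - q') + 1.
  have nq := nm_ge0 (o - q); have nq' := nm_ge0 (o - q').
  have B1 : 1 <= B by rewrite /B; lra.
  have B0 : 0 < B by lra.
  have mB : m / B <= 1 by rewrite ler_pdivrMr //; lra.
  have mB0 : 0 < m / B by rewrite divr_gt0.
  exists (1 - m / B); rewrite opprB addrCA subrr addr0.
  have lt_B c : 0 <= c -> c < B -> m / B * c < m.
    by move=> c0 cB'; rewrite mulrAC ltr_pdivrMr // ltr_pM2l.
  have lq : m / B * nm (o - q) < m by apply: lt_B => //; rewrite /B; lra.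
  have lq' : m / B * nm (o - q') < m by apply: lt_B => //; rewrite /B; lra.
  by split; [lra|lra|exact: lt_le_trans me|exact: lt_le_trans me1|exact: lt_le_trans me2].
pose c (l : cplx R) := (1 - t)%:C *: o + t%:C *: (q + l *: v).
have Gc l : nm l <= r -> G (c l).
  by move=> lr; exact: (convex_interior oG convG Go (Hcl l lr) t0 t1).
pose x := c 0; pose y := c (r / 2)%:C.
have Gx : G x by apply: Gc; rewrite nm0 ltW.
have Gy : G y by apply: Gc; rewrite nmC ger0_norm; lra.
have cq l : c l - (q + l *: v) = (1 - t)%:C *: (o - (q + l *: v)).
  by apply/matrixP => i j; rewrite /c RtoCB !mxE; ring.
have xq : nm (x - q) = (1 - t) * nm (o - q).
  by have := cq 0; rewrite scale0r addr0 => ->; rewrite nmZR ger0_norm // subr_ge0 ltW.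
have yq : nm (y - q') = (1 - t) * nm (o - q').
  by rewrite /y /q' cq nmZR ger0_norm // subr_ge0 ltW.
pose w := (t * (r / 2))%:C *: v.
have cw (s : cplx R) : x + s *: w = c (s * (r / 2)%:C).
  by rewrite /x /c /w; apply/matrixP => i j; rewrite !mxE RtoCM; ring.
have kxy : kd x y <= 1.
  rewrite -lee_fin -(kobE fin Gx Gy).
  have -> : y = x + w by rewrite -[w]scale1r cw mul1r.
  have := @kob_disc_segment x w; apply=> l l2; rewrite cw; apply: Gc.
  rewrite nmM nmC (ger0_norm (ltW r20)).
  by apply: le_trans (ler_wpM2r (ltW r20) l2) _; rewrite mulrCA mulfV ?mulr1.
have [g [gg g0 gL]] := geodesic_exists oG fin sep complete Gx Gy.
have L0 := kd_ge0 G x y.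
have [z [[s /= sL gs] Kz]] : (g @` `[0, kd x y]) `&` K !=set0.
  apply: Hg => //; first by apply: HU; rewrite g0 xq.
  by apply: HV; rewrite gL yq.
have kxz : kd x z <= 1.
  rewrite -gs -g0 (geodesic_kd gg) //; last by rewrite in_itv /= lexx.
  move: sL; rewrite in_itv /= sub0r normrN => /andP[s0 sL]; rewrite ger0_norm //.
  exact: le_trans sL kxy.
apply: (He x); first by rewrite xq.
split => //; have Gz : G z by exact: KG.
apply: le_trans (tri Go Gz Gx) _; apply: lerD; first by rewrite (kd_sym oG); exact: HC.
by rewrite (kd_sym oG z x); exact: kxz.
Qed.

(** By compactness every geodesic from E1 to E2 has a point z within a fixed distance of o, and the
    distance from x to z is at most that from x to y. In P the number e is both a radius and the
    reciprocal of the bound, which makes P monotone. *)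
Lemma visible_sets (E1 E2 : set Cn) : compact E1 -> compact E2 ->
  (forall x, E1 x -> ~ E2 x) -> exists C : R, forall x y, E1 x -> G x -> E2 y -> G y ->
    kd x o <= kd x y + C.
Proof.
move=> c1 c2 E12.
pose P (e : R) a b := forall g L, 0 <= L -> geodesic G `[0, L] g -> nm (g 0 - a) < e ->
  nm (g L - b) < e -> exists2 t, t \in `[0, L] & kd (g t) o <= e^-1.
have Pmono e e' a b : 0 < e' -> e' <= e -> P e a b -> P e' a b.
  move=> e'0 e'e H g L L0 gg ga gb.
  have [t tL ht] := H g L L0 gg (lt_le_trans ga e'e) (lt_le_trans gb e'e).
  exists t => //; apply: le_trans ht _; rewrite lef_pV2 ?posrE //.
  exact: lt_le_trans e'0 e'e.
(* Away from the boundary an endpoint itself is within bounded distance of o, vacuously so outside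
   the closure. *)
have alt a : boundary G a \/ exists d C : R, [/\ 0 < d, 0 < C &
    forall y, G y -> nm (y - a) < d -> kd y o <= C].
  have [ca|ca] := pselect (closure G a); last first.
    right; apply: contrapT => H; apply: ca; apply/closure_nmP => e e0.
    apply: contrapT => Hy; apply: H; exists e, 1; split => // y Gy ya.
    by case: Hy; exists y.
  have [Ga|Ga] := pselect (G a); last by left; split => // /interior_subset.
  right; have [d d0 [dG dk]] := kd_continuous oG fin Ga ltr01.
  have k0 := kd_ge0 G a o; exists d, (1 + kd a o); split => //; first by lra.
  by move=> y Gy yd; have := tri Gy Ga Go; have := dk y yd; rewrite (kd_sym oG y a); lra.
have point a b : E1 a -> E2 b -> exists2 e : R, 0 < e & P e a b.
  move=> E1a E2b.
  suff [d [C [d0 C0 H]]] : exists d C : R, [/\ 0 < d, 0 < C & forall g L, 0 <= L ->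
      geodesic G `[0, L] g -> nm (g 0 - a) < d -> nm (g L - b) < d ->
      exists2 t, t \in `[0, L] & kd (g t) o <= C].
    exists (Num.min d C^-1); first by rewrite lt_min d0 invr_gt0.
    move=> g L L0 gg; rewrite !lt_min => /andP[ga _] /andP[gb _].
    have [t tL ht] := H g L L0 gg ga gb; exists t => //; apply: le_trans ht _.
    rewrite -[X in X <= _]invrK lef_pV2 ?posrE ?lt_min ?d0 ?invr_gt0 //.
    by rewrite ge_min lexx orbT.
  have [ba|[d [C [d0 C0 Ha]]]] := alt a; last first.
    exists d, C; split => // g L L0 [_ _ gG _] ga _.
    have L00 : 0 \in `[0, L] by rewrite in_itv /= lexx.
    by exists 0 => //; apply: Ha => //; exact: gG.
  have [bb|[d [C [d0 C0 Hb]]]] := alt b; last first.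
    exists d, C; split => // g L L0 [_ _ gG _] _ gb.
    have L00 : L \in `[0, L] by rewrite in_itv /= lexx L0.
    by exists L => //; apply: Hb => //; exact: gG.
  have ab : a <> b by move=> ab; apply: (E12 a) => //; rewrite ab.
  have [U' [V' [K [nU nV _ [cK KG] Hg]]]] := vis ba bb ab.
  have [C C0 HC] := kd_bounded_compact cK KG.
  move/nbhs_nmP: nU => [e1 e10 HU]; move/nbhs_nmP: nV => [e2 e20 HV].
  exists (Num.min e1 e2), C; split; rewrite ?lt_min ?e10 // => g L L0 gg.
  rewrite !lt_min => /andP[ga _] /andP[_ gb].
  have [z [[s /= sL gs] Kz]] := Hg L g L0 gg (HU _ ga) (HV _ gb).
  by exists s => //; rewrite gs; exact: HC.
have Pshift e a b a' : nm (a' - a) < e / 2 -> 0 < e -> P e a b -> P (e / 2) a' b.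
  move=> aa e0 H g L L0 gg ga gb.
  have e20 : 0 < e / 2 by rewrite divr_gt0.
  have e2 : e / 2 <= e by rewrite ler_pdivrMr // ler_pMr // ler1n.
  have [||t tL ht] := H g L L0 gg; [|exact: lt_le_trans gb e2|].
    by apply: le_lt_trans (nm_triangle a' (g 0) a) _; rewrite [e]splitr; exact: ltrD.
  by exists t => //; apply: le_trans ht _; rewrite lef_pV2 ?posrE.
have Pshift2 e a b b' : nm (b' - b) < e / 2 -> 0 < e -> P e a b -> P (e / 2) a b'.
  move=> bb e0 H g L L0 gg ga gb.
  have e20 : 0 < e / 2 by rewrite divr_gt0.
  have e2 : e / 2 <= e by rewrite ler_pdivrMr // ler_pMr // ler1n.
  have [||t tL ht] := H g L L0 gg; [exact: lt_le_trans ga e2| |].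
    by apply: le_lt_trans (nm_triangle b' (g L) b) _; rewrite [e]splitr; exact: ltrD.
  by exists t => //; apply: le_trans ht _; rewrite lef_pV2 ?posrE.
have row a : E1 a -> exists2 e : R, 0 < e & forall b, E2 b -> P e a b.
  move=> E1a; apply: compact_unif => // [e e' b|b E2b]; first exact: Pmono.
  have [e e0 He] := point a b E1a E2b; have e20 : 0 < e / 2 by rewrite divr_gt0.
  by exists (e / 2) => //; exists (e / 2) => // b' bb; exact: Pshift2 bb e0 He.
have [e e0 He] : exists2 e : R, 0 < e & forall a, E1 a -> forall b, E2 b -> P e a b.
  apply: compact_unif => // [e e' a e'0 e'e H b E2b|a E1a].
    by apply: Pmono (H b E2b).
  have [e e0 He] := row a E1a; have e20 : 0 < e / 2 by rewrite divr_gt0.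
  exists (e / 2) => //; exists (e / 2) => // a' aa b E2b.
  exact: Pshift aa e0 (He b E2b).
exists e^-1 => x y E1x Gx E2y Gy.
have [g [gg g0 gL]] := geodesic_exists oG fin sep complete Gx Gy.
have L0 := kd_ge0 G x y.
have [||t tL ht] := He x E1x y E2y g _ L0 gg.
- by rewrite g0 subrr nm0.
- by rewrite gL subrr nm0.
have Ggt : G (g t) by case: gg => _ _ gG _; exact: gG.
have := tri Gx Ggt Go; rewrite -{2}g0 (geodesic_kd gg) //; last by rewrite in_itv /= lexx.
move: tL; rewrite in_itv /= sub0r normrN => /andP[t0 tL].
by rewrite ger0_norm //; lra.
Qed.

(** The set of admissible y is not compact; the geodesic is stopped at its first exit from V, which
    lies in a compact set disjoint from E. *)
Lemma visible_escape (E V : set Cn) : compact E -> open V -> E `<=` V ->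
  compact (closure V) -> exists C : R, forall x y, E x -> G x -> G y -> ~ V y ->
    kd x o <= kd x y + C.
Proof.
move=> cE oV EV cV.
have cF : compact (closure V `&` ~` V).
  by apply: compact_closedI => //; exact: open_closedC.
have [|C HC] := visible_sets cE cF; first by move=> x /EV Vx [_].
exists C => x y Ex Gx Gy Vy.
have [g [gg g0 gL]] := geodesic_exists oG fin sep complete Gx Gy.
have L0 := kd_ge0 G x y; have [_ gc gG _] := gg.
have [||t [t0 tL _ Vt cVt]] := @first_exit R _ V g 0 (kd x y) oV gc L0.
- by rewrite g0; exact: EV.
- by rewrite gL.
have tL' : t \in `[0, kd x y] by rewrite in_itv /= ltW.
have := HC x (g t) Ex Gx (conj cVt Vt) (gG _ tL'); rewrite -{2}g0 (geodesic_kd gg) //.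
  by rewrite sub0r normrN gtr0_norm //; lra.
by rewrite in_itv /= lexx.
Qed.

End Visibility.

(** * Localization of the Kobayashi-Royden metric *)

Section DiscEstimates.
Context {R : realType} {n : nat}.
Local Notation Cn := 'rV[cplx R]_n.
Implicit Types (D G : set Cn) (f : cplx R -> Cn) (x y : cplx R).

Lemma disc_recenter D f y x : holomorphic_disc D f -> nm y < 1 -> nm x <= 1 ->
  holomorphic_disc D (fun u => f (y + ((1 - nm y)%:C * x) * u)) /\
  cdiff (fun u => f (y + ((1 - nm y)%:C * x) * u)) 0 (((1 - nm y)%:C * x) *: 'D_1 f y).
Proof.
move=> /holomorphic_discP Hf y1 x1; set r : cplx R := (1 - nm y)%:C * x.
have rE : nm r <= 1 - nm y.
  rewrite nmM nmC ger0_norm ?subr_ge0 ?(ltW y1) //.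
  by rewrite ler_piMr // subr_ge0 ltW.
split.
  apply/holomorphic_discP => u u1; have ru : nm (y + r * u) < 1.
    apply: le_lt_trans (nmD _ _) _; rewrite nmM.
    have := ler_wpM2r (nm_ge0 u) rE; have : 0 < 1 - nm y by rewrite subr_gt0.
    by nra.
  have [df Df] := Hf _ ru; split; last exact: Df.
  exact: cdiff_derivable (cdiff_affine (derivable_cdiff df)).
apply: cdiff_affine; rewrite mulr0 addr0.
by apply: derivable_cdiff; have [] := Hf _ y1.
Qed.

Lemma kr_disc D f y x (c : R) : holomorphic_disc D f -> nm y < 1 -> nm x <= 1 ->
  (1 - nm y)^-1 < c -> (kobayashi_royden D (f y) (x *: 'D_1 f y) < c%:E)%E.
Proof.
move=> Hf y1 x1 yc; have [Hd Hc] := disc_recenter Hf y1 x1; apply/kr_ltP.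
have y0 : 0 < 1 - nm y by rewrite subr_gt0.
exists (1 - nm y)^-1; split; [by rewrite invr_gt0|exact: yc|].
exists (fun u => f (y + ((1 - nm y)%:C * x) * u)); split; [exact: Hd|by rewrite mulr0 addr0|].
exists (((1 - nm y)%:C * x) *: 'D_1 f y); first exact: Hc.
by rewrite scalerA mulrA -RtoCM mulVf ?lt0r_neq0 // mul1r.
Qed.

(** The curve is replaced by its chord, whose direction is close to v; upper semicontinuity bounds
    the metric along it. *)
Lemma kob_curve_local G (g : R -> Cn) (t : R) (v : Cn) (c : R) : open G -> G (g t) ->
  (forall e : R, 0 < e -> exists2 d : R, 0 < d & forall s, t < s -> s < t + d ->
     nm (g s - g t - (s - t)%:C *: v) <= e * (s - t)) ->
  (kobayashi_royden G (g t) v < c%:E)%E ->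
  exists2 d : R, 0 < d & forall s, t < s -> s < t + d ->
    G (g s) /\ (kobayashi G (g t) (g s) <= (c * (s - t))%:E)%E.
Proof.
move=> oG Gg dg kc; have [e e0 He] := kr_usc oG kc.
have /open_nmP/(_ _ Gg)[e1 e10 He1] := oG.
have e20 : 0 < e / 2 by rewrite divr_gt0.
have [d d0 Hd] := dg _ e20.
have B0 : 0 < nm v + e by rewrite ltr_wpDl // nm_ge0.
pose m := Num.min d (Num.min (e / (nm v + e)) (e1 / (nm v + e))).
have [m0 md me me1] : [/\ 0 < m, m <= d, m <= e / (nm v + e) & m <= e1 / (nm v + e)].
  by rewrite !ge_min !lexx !orbT !lt_min d0 !divr_gt0.
exists m => // s ts sm.
have st0 : 0 < s - t by rewrite subr_gt0.
have sd : s < t + d by apply: lt_le_trans sm _; rewrite lerD2l.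
have se : (s - t) * (nm v + e) < e.
  by rewrite -ltr_pdivlMr //; apply: lt_le_trans me; rewrite ltrBlDl.
have se1 : (s - t) * (nm v + e) < e1.
  by rewrite -ltr_pdivlMr //; apply: lt_le_trans me1; rewrite ltrBlDl.
have [w sw] : exists w, (s - t)%:C *: w = g s - g t.
  exists (((s - t)^-1)%:C *: (g s - g t)).
  by rewrite scalerA -RtoCM mulfV ?scale1r // lt0r_neq0.
have wv : nm (w - v) < e.
  have := Hd s ts sd; rewrite -sw -scalerBr nmZR gtr0_norm // mulrC ler_pM2r //.
  by move=> /le_lt_trans; apply; lra.
have nw : nm w <= nm v + e by have := nmD (w - v) v; rewrite subrK; lra.
have near_seg (u : R) : 0 <= u -> u <= 1 ->
    nm (g t + u%:C *: (g s - g t) - g t) <= (s - t) * (nm v + e).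
  move=> u0 u1; rewrite addrAC subrr add0r -sw !nmZR ger0_norm // gtr0_norm //.
  rewrite mulrCA; apply: ler_wpM2l; first exact: ltW.
  by apply: le_trans nw; rewrite ler_piMl // nm_ge0.
have GG (u : R) : 0 <= u -> u <= 1 -> G (g t + u%:C *: (g s - g t)).
  by move=> u0 u1; apply: He1; apply: le_lt_trans (near_seg u u0 u1) se1.
have gsE : g s = g t + (g s - g t) by rewrite addrC subrK.
split; first by have := GG 1 ler01 (lexx 1); rewrite scale1r -gsE.
rewrite gsE; apply: kob_segment => // u; rewrite in_itv /= => /andP[u0 u1].
  exact: GG.
rewrite -sw in near_seg *; apply: ltW.
have := @kr_scale_lt R n G (g t + u%:C *: ((s - t)%:C *: w)) w (s - t) c _ _.
rewrite gtr0_norm // [c * _]mulrC; apply; first exact: lt0r_neq0.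
apply: He; last exact: wv.
exact: le_lt_trans (near_seg u u0 u1) se.
Qed.

Lemma cdiff_ray f x (t : R) : derivable f (t%:C * x) 1 -> nm x <= 1 ->
  forall e : R, 0 < e -> exists2 d : R, 0 < d & forall s, `|s - t| < d ->
    nm (f (s%:C * x) - f (t%:C * x) - (s - t)%:C *: (x *: 'D_1 f (t%:C * x))) <= e * `|s - t|.
Proof.
move=> /derivable_cdiff H x1 e e0; have [d d0 Hd] := H _ e0; exists d => // s st.
have hx : nm ((s - t)%:C * x : cplx R) <= `|s - t|.
  by rewrite nmM nmC ler_piMr.
have := Hd ((s - t)%:C * x) (le_lt_trans hx st).
rewrite -mulrDl -RtoCD [t + _]addrC subrK scalerA => /le_trans; apply.
by rewrite ler_pM2l.
Qed.

End DiscEstimates.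

(** * Discs of D centred near the boundary are locally small *)

Section BoundaryDiscs.
Context {R : realType} {n : nat}.
Local Notation Cn := 'rV[cplx R]_n.
Variables (D U : set Cn).
Local Notation G := (D `&` U).
Hypotheses (oU : open U) (convG : convexC G).
Hypothesis nodisc : forall q v (r : R), boundary G q -> v != 0 -> 0 < r ->
  exists2 l : cplx R, nm l <= r & ~ closure G (q + l *: v).

Lemma boundary_inter q : boundary D q -> U q -> boundary G q.
Proof.
move=> [cq iq] Uq; split.
  move=> B nB; have [y [Dy [By Uy]]] := cq (B `&` U) (filterI nB (open_nbhs_nbhs (conj oU Uq))).
  by exists y.
by move=> iGq; apply: iq; apply: interiorS iGq => x [].
Qed.

(** The peak function is made for the closure of G in a closed ball inside U. Points of D on its
    sphere are in U, hence in G, so its bound holds on all of D there. *)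
Lemma boundary_derivative_bound q : boundary D q -> U q -> exists r C : R, 0 < r /\
  forall f, holomorphic_disc D f -> nm (f 0 - q) < r -> nm ('D_1 f 0) <= C.
Proof.
move=> bD Uq; have bG := boundary_inter bD Uq.
have /open_nmP/(_ q Uq)[e e0 He] := oU.
pose d0 := e / 2; have d00 : 0 < d0 by rewrite divr_gt0.
pose F := [set x | nm (x - q) <= d0] `&` closure G.
have cF : compact F.
  by apply: compact_closedI; [exact: compact_nm_ball|exact: closed_closure].
have convF : convexC F.
  move=> x y t [xq cx] [yq cy] t0 t1; split; last exact: (convex_closure convG).
  have -> : t%:C *: x + (1 - t)%:C *: y = t%:C *: (x - q) + (1 - t)%:C *: (y - q) + q.
    by apply/matrixP => i j; rewrite RtoCB !mxE; ring.
  rewrite /= addrK; apply: le_trans (nmD _ _) _.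
  rewrite !nmZR (ger0_norm t0) ger0_norm ?subr_ge0 //.
  by move: xq yq => /= xq yq; nra.
have Fq : F q by split; [rewrite /= subrr nm0 ltW|exact: bG.1].
have [|P [eP Pq [th th1 HP]]] := peak_function cF convF Fq d00.
  move=> v r vN r0; have [l lr Hl] := nodisc bG vN r0.
  by exists l => // [[_ cl]]; exact: Hl.
have Psph x : D x -> nm (x - q) = d0 -> nm (P x) <= th.
  move=> Dx xq; apply: (HP x _ xq); split; first by rewrite /= xq.
  by apply: subset_closure; split; [exact: Dx|apply: He; rewrite xq /d0; lra].
exact: (local_derivative_bound d00 eP Pq th1 Psph).
Qed.

Variable W : set Cn.
Hypotheses (cW : compact (closure W)) (WU : closure W `<=` U).

Let B := closure W `&` boundary D.

Let cB : compact B.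
Proof.
apply: compact_closedI => //; apply: closedI; first exact: closed_closure.
by apply: open_closedC; exact: open_interior.
Qed.

Lemma uniform_derivative_bound : exists d C : R, [/\ 0 < d, 0 < C &
  forall f q, holomorphic_disc D f -> B q -> nm (f 0 - q) < d -> nm ('D_1 f 0) <= C].
Proof.
have [||e e0 He] := @compact_unif R _ B (fun e q => forall f, holomorphic_disc D f ->
  nm (f 0 - q) < e -> nm ('D_1 f 0) <= e^-1) cB.
- move=> e e' q e'0 e'e H f Hf fq; apply: le_trans (H f Hf (lt_le_trans fq e'e)) _.
  by rewrite lef_pV2 ?posrE //; exact: lt_le_trans e'0 e'e.
- move=> q [/WU Uq bq]; have [r [C [r0 HC]]] := boundary_derivative_bound bq Uq.
  have C1 : 0 < `|C| + 1 by rewrite ltr_wpDl.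
  pose e := Num.min (r / 2) (`|C| + 1)^-1.
  have [e0 er eC] : [/\ 0 < e, e <= r / 2 & e <= (`|C| + 1)^-1].
    by rewrite !ge_min !lexx !orbT lt_min invr_gt0 divr_gt0.
  exists e => //; exists (r / 2); first by rewrite divr_gt0.
  move=> q' qq' f Hf fq'; apply: (@le_trans _ _ C).
    by apply: (HC f Hf); have := nm_triangle q' (f 0) q; lra.
  apply: (@le_trans _ _ (`|C| + 1)); first by have := ler_norm C; lra.
  by rewrite -[X in X <= _]invrK lef_pV2 ?posrE ?invr_gt0.
exists e, e^-1; split; [exact: e0|by rewrite invr_gt0|].
by move=> f q Hf Bq fq; exact: (He q Bq f Hf fq).
Qed.

(** While f y stays near q, the disc recentred at y with |y| < 1/2 has derivative at most C, so
    |f'(y)| <= 2 C. Followed along a ray by real induction, f moves too little to get away from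
    q. *)
Lemma small_discs : exists rho d : R, [/\ 0 < rho, rho <= 1, 0 < d &
  forall f q x, holomorphic_disc D f -> B q -> nm (f 0 - q) < d -> nm x < rho -> G (f x)].
Proof.
have [d [C [d0 C0 HC]]] := uniform_derivative_bound.
have [e e0 He] := compact_open_dist cW oU WU.
have [m [m0 md me]] := pos_min d0 e0.
have [d' [d'0 dd ee]] : exists d' : R, [/\ 0 < d', 2 * d' <= d & 2 * d' <= e].
  by exists (m / 2); split; lra.
have C1 : 0 < 2 * C + 1 by lra.
have dC0 : 0 < d' / (2 * C + 1) by rewrite divr_gt0.
have [|rho [rho0 rho1 rhoC]] := @pos_min R 2^-1 _ _ dC0; first by rewrite invr_gt0.
exists rho, d'; split; [exact: rho0|by lra|exact: d'0|].
move=> f q x Hf Bq fq xr; have /holomorphic_discP Hf' := Hf.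
have x1 : nm x < 2^-1 by lra.
have xC : (2 * C + 1) * nm x < d' by rewrite mulrC -ltr_pdivlMr //; lra.
have x0 := nm_ge0 x.
have tx (t : R) : 0 <= t -> t <= 1 -> nm (t%:C * x : cplx R) < 2^-1.
  by move=> t0 t1; rewrite nmM nmC ger0_norm //; nra.
(* The extra 1 absorbs the first-order remainder in the induction step. *)
pose L := (2 * C + 1) * nm x.
have L0 : 0 <= L by rewrite mulr_ge0 // ltW.
have stay : nm (f (1%:C * x) - f 0) <= L * 1.
  apply: (@real_induction R (fun t => nm (f (t%:C * x) - f 0) <= L * t) 0 1 ler01).
  - by rewrite mul0r subrr nm0 mulr0.
  - move=> t t0 t1 Hs; have yh := tx t t0 (ltW t1); set y : cplx R := t%:C * x in yh *.
    have y1 : nm y < 1 by lra.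
    have [dfy _] := Hf' y y1.
    have fy : nm (f y - q) < d.
      apply: le_lt_trans (nm_triangle (f 0) (f y) q) _; apply: lt_le_trans dd.
      have -> : 2 * d' = d' + d' by rewrite mulr_natl mulr2n.
      apply: ltrD fq; apply: le_lt_trans (Hs t t0 (lexx t)) _.
      by apply: le_lt_trans xC; rewrite -[X in _ <= X]mulr1 ler_wpM2l // ltW.
    have [Hd Hc] := @disc_recenter R n D f y 1 Hf y1 (eq_ind_r (fun u => u <= 1) (lexx 1) nm1).
    have := HC _ _ Hd Bq; rewrite mulr0 addr0 => /(_ fy).
    rewrite (cdiff_derive Hc) mulr1 nmZR gtr0_norm ?subr_gt0 // => dC.
    have df : nm ('D_1 f y) <= 2 * C by have := nm_ge0 ('D_1 f y); nra.
    have [d1 d10 Hd1] := derivable_cdiff dfy ltr01.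
    exists (d1 / (nm x + 1)); first by rewrite divr_gt0 //; lra.
    move=> s ts sd s1; have st : 0 < s - t by rewrite subr_gt0.
    have sx : s%:C * x = y + (s - t)%:C * x by rewrite /y RtoCB mulrBl addrC subrK.
    have nsx : nm ((s - t)%:C * x : cplx R) = (s - t) * nm x.
      by rewrite nmM nmC gtr0_norm.
    have sd1 : (s - t) * nm x < d1.
      have : (s - t) * (nm x + 1) < d1 by rewrite -ltr_pdivlMr //; lra.
      by rewrite mulrDr mulr1; lra.
    have := Hd1 ((s - t)%:C * x); rewrite nsx mul1r -sx => /(_ sd1) h1.
    have h2 : nm (f (s%:C * x) - f y) <= (s - t) * nm x + (s - t) * nm x * (2 * C).
      have := nmD (f (s%:C * x) - f y - (((s - t)%:C * x) : cplx R) *: 'D_1 f y)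
        ((((s - t)%:C * x) : cplx R) *: 'D_1 f y).
      rewrite subrK => /le_trans; apply; apply: lerD => //.
      rewrite nmZ nsx; apply: ler_wpM2l => //; rewrite mulr_ge0 //; exact: ltW.
    apply: le_trans (nm_triangle (f y) (f (s%:C * x)) (f 0)) _.
    apply: le_trans (lerD h2 (Hs t t0 (lexx t))) _.
    have -> : L * s = L * (s - t) + L * t by rewrite -mulrDr subrK.
    by rewrite lerD2r le_eqVlt; apply/orP; left; apply/eqP; rewrite /L; ring.
  - move=> t t0 t1 Hs; have yh := tx t (ltW t0) t1.
    rewrite leNgt; apply/negP => Lt.
    have y1 : nm (t%:C * x : cplx R) < 1 by lra.
    have [dfy _] := Hf' _ y1.
    pose gap := nm (f (t%:C * x) - f 0) - L * t.
    have gap0 : 0 < gap by rewrite subr_gt0.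
    have /nbhs_nmP[d1 d10 Hd1] := derivable_continuous dfy (nbhs_nm _ gap0).
    have [s [s0 st sd]] := left_near t0 d10.
    have sx : nm (s%:C * x - t%:C * x : cplx R) < d1.
      rewrite -mulrBl -RtoCB nmM nmC; apply: le_lt_trans sd.
      by rewrite ler_piMr //; lra.
    have := Hd1 _ sx; rewrite /= nmB /gap ltrBrDr => /lt_le_trans.
    move=> /(_ _ (nm_triangle (f (s%:C * x)) (f (t%:C * x)) (f 0))); rewrite ltrD2l.
    apply/negP; rewrite -leNgt; apply: le_trans (Hs s s0 st) _.
    by apply: ler_wpM2l => //; exact: ltW.
rewrite mul1r mulr1 in stay.
have x11 : nm x < 1 by lra.
split; first by have [] := Hf' x x11.
apply: (He q); first exact: Bq.1.
by have := nm_triangle (f 0) (f x) q; rewrite /L in stay; lra.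
Qed.

End BoundaryDiscs.

Section RoydenComparison.
Context {R : realType} {n : nat}.
Local Notation Cn := 'rV[cplx R]_n.
Variables (D U : set Cn).
Local Notation G := (D `&` U).
Hypotheses (oD : open D) (oU : open U) (convG : convexC G).
Hypothesis sep : forall x y, G x -> G y -> kobayashi G x y = 0%E -> x = y.
Hypothesis complete : forall u : nat -> Cn, (forall k, G (u k)) -> kobayashi_cauchy G u ->
  exists2 x, G x & kobayashi G (u k) x @[k --> \oo] --> 0%E.
Hypothesis vis : forall p q, boundary G p -> boundary G q -> p <> q ->
  visible_geodesics G p q.
Variable o : Cn.
Hypothesis Go : G o.
Variables E W : set Cn.
Hypotheses (cE : compact E) (oW : open W) (EW : E `<=` W).
Hypotheses (cW : compact (closure W)) (WU : closure W `<=` U).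
Implicit Types (x y z q v : Cn).

Let oG : open G. Proof. exact: openI. Qed.

Let fin x y : G x -> G y -> (kobayashi G x y < +oo)%E.
Proof. exact: (convex_kob_lty oG convG). Qed.

Local Notation kd := (kd G).
Local Notation h x := (kd x o).

Let WG x : D x -> closure W x -> G x.
Proof. by move=> Dx Wx; split=> //; exact: WU. Qed.

(** The points of the closure of W at distance at least d from the boundary points form a compact
    subset of G, where h is bounded. Beyond that bound [small_discs] applies. *)
Lemma royden_rough : exists L M : R, [/\ 0 < L, 0 <= M & forall x v, D x -> W x -> M < h x ->
  (kobayashi_royden G x v <= L%:E * kobayashi_royden D x v)%E].
Proof.
have nd := boundary_no_disc oG convG sep complete vis Go.
have [rho [d [rho0 rho1 d0 Hd]]] := small_discs oU convG nd cW WU.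
pose Q := closure W `&` (closure D `&`
  \bigcap_(q in closure W `&` boundary D) [set x | d <= nm (x - q)]).
have cQ : compact Q.
  apply: compact_closedI => //; apply: closedI; first exact: closed_closure.
  apply: closed_bigI => q _.
  have -> : [set x | d <= nm (x - q)] = (fun x => nm (x - q)) @^-1` [set t | d <= t] by [].
  by apply: preimage_closed; [move=> x _; exact: nm_sub_continuous|exact: closed_ge].
have QG : Q `<=` G.
  move=> x [Wx [Dx Hx]]; apply: WG => //; apply: contrapT => nDx.
  have /Hx /= : (closure W `&` boundary D) x.
    by split => //; split => // /interior_subset.
  by rewrite subrr nm0 leNgt d0.
have [C C0 HC] := kd_bounded_compact oG convG Go cQ QG.
exists rho^-1, C; split; [by rewrite invr_gt0|exact: ltW|].
move=> x v Dx Wx Cx; apply: kr_royden; [exact: rho0|exact: rho1|].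
move=> f Hf f0x y yr.
have [q Bq xq] : exists2 q, (closure W `&` boundary D) q & nm (x - q) < d.
  apply: contrapT => H; move: Cx; rewrite ltNge => /negP; apply; apply: HC.
  split; first exact: subset_closure.
  split; first exact: subset_closure.
  by move=> q Bq /=; rewrite leNgt; apply/negP => xq; apply: H; exists q.
by apply: (Hd f q y Hf Bq _ yr); rewrite f0x.
Qed.

(** Along a ray the rough comparison bounds the speed for G by L / (1 - t), so the distance
    travelled by -L ln (1 - t). As long as this is below h(f 0) - C, h stays above M and, by
    [visible_escape], the ray cannot leave W. The 2 in L leaves room for strict inequalities. *)
Lemma royden_log : exists L C : R, [/\ 0 < L, 0 <= C & forall f (z : cplx R),
  holomorphic_disc D f -> E (f 0) -> nm z < 1 ->
  L * (- ln (1 - nm z)) < h (f 0) - C -> G (f z)].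
Proof.
have [L0 [M [L00 M0 rough]]] := royden_rough.
have [C0 HC0] := visible_escape oG convG sep complete vis Go cE oW EW cW.
exists (2 * L0), (`|C0| + M); split; [by rewrite mulr_gt0|by rewrite addr_ge0|].
move=> f z Hf Ex z1; set x := f 0; set L := 2 * L0; set r := nm z => hL.
have L_0 : 0 < L by rewrite mulr_gt0.
have /holomorphic_discP Hf' := Hf.
have Dx : D x by have [] := Hf' 0 (eq_ind_r (fun u => u < 1) ltr01 nm0).
have Gx : G x by apply: WG => //; apply: subset_closure; exact: EW.
have [z0|zN] := eqVneq z 0; first by rewrite z0.
have r0 : 0 < r by rewrite nm_gt0.
pose u : cplx R := (r^-1)%:C * z.
have u1 : nm u = 1 by rewrite nmM nmC ger0_norm ?invr_ge0 ?(ltW r0) // mulVf // lt0r_neq0.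
have zE : z = r%:C * u by rewrite /u mulrA -RtoCM mulfV ?mul1r // lt0r_neq0.
pose g (t : R) := f (t%:C * u).
have ntu (t : R) : 0 <= t -> nm (t%:C * u : cplx R) = t by move=> t0; rewrite nmM u1 mulr1 nmC ger0_norm.
have Df t : 0 <= t -> t <= r -> derivable f (t%:C * u) 1 /\ D (g t).
  by move=> t0 tr; apply: Hf'; rewrite ntu //; exact: le_lt_trans tr z1.
have dg t : 0 <= t -> t <= r -> forall e : R, 0 < e -> exists2 d : R, 0 < d & forall s, `|s - t| < d ->
    nm (g s - g t - (s - t)%:C *: (u *: 'D_1 f (t%:C * u))) <= e * `|s - t|.
  by move=> t0 tr; apply: cdiff_ray; [have [] := Df t t0 tr|rewrite u1].
have cg t : 0 <= t -> t <= r -> forall e : R, 0 < e -> exists2 d : R, 0 < d & forall s, `|s - t| < d ->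
    nm (g s - g t) < e.
  move=> t0 tr e e0; have [d d0 Hd] := dg t t0 tr 1 ltr01.
  set v := u *: _ in Hd; have B0 : 0 < nm v + 1 by rewrite ltr_wpDl // nm_ge0.
  have [d' [d'0 d'd d'e]] := pos_min d0 (divr_gt0 e0 B0).
  exists d' => // s st; have := Hd s (lt_le_trans st d'd).
  have := nmD (g s - g t - (s - t)%:C *: v) ((s - t)%:C *: v); rewrite subrK nmZR mul1r.
  have : `|s - t| * (nm v + 1) < e by rewrite -ltr_pdivlMr //; exact: lt_le_trans d'e.
  by rewrite mulrDr mulr1; lra.
have lnr t : t <= r -> L * (- ln (1 - t)) < h x - (`|C0| + M).
  move=> tr; apply: le_lt_trans hL; apply: ler_wpM2l; first exact: ltW.
  by rewrite lerN2 ler_ln ?posrE; lra.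
have stay : W (g r) /\ kd x (g r) <= L * (- ln (1 - r)).
  apply: (@real_induction R (fun t => W (g t) /\ kd x (g t) <= L * (- ln (1 - t))) 0 r (ltW r0)).
  - have -> : g 0 = x by rewrite /g mul0r.
    by split; [exact: EW|rewrite (kd_refl oG Gx) subr0 ln1 oppr0 mulr0].
  - move=> t t0 tr Hs; have [Wt kt] := Hs t t0 (lexx t).
    have [_ Dgt] := Df t t0 (ltW tr).
    have Ggt : G (g t) by apply: WG => //; exact: subset_closure.
    have t1 : 0 < 1 - t by move: z1; rewrite -/r; lra.
    have Mh : M < h (g t).
      have := kd_triangle oG fin Gx Ggt Go; have := lnr t (ltW tr); have := normr_ge0 C0.
      by lra.
    have krG : (kobayashi_royden G (g t) (u *: 'D_1 f (t%:C * u)) < (L / (1 - t))%:E)%E.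
      apply: (le_lt_trans (rough _ _ Dgt Wt Mh)).
      have -> : (L / (1 - t))%:E = (L0%:E * (2 / (1 - t))%:E)%E by rewrite -EFinM /L mulrA [L0 * 2]mulrC.
      rewrite lte_pmul2l // ?lte_fin //; apply: kr_disc Hf _ _ _.
      + by rewrite ntu //; move: z1; rewrite -/r; lra.
      + by rewrite u1.
      + by rewrite ntu // ltr_pMl ?invr_gt0 // ltr1n.
    have dgr : forall e : R, 0 < e -> exists2 d : R, 0 < d & forall s, t < s -> s < t + d ->
        nm (g s - g t - (s - t)%:C *: (u *: 'D_1 f (t%:C * u))) <= e * (s - t).
      move=> e e0; have [d d0 Hd] := dg t t0 (ltW tr) e e0; exists d => // s ts sd.
      have st : 0 < s - t by rewrite subr_gt0.
      by have := Hd s; rewrite gtr0_norm //; apply; lra.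
    have [d d0 Hd] := kob_curve_local oG Ggt dgr krG.
    have /open_nmP/(_ _ Wt)[e e0 He] := oW.
    have [d' d'0 Hd'] := cg t t0 (ltW tr) e e0.
    have [m [m0 md md']] := pos_min d0 d'0.
    exists m => // s ts sm sr; have [Ggs ks] := Hd s ts (lt_le_trans sm (lerD (lexx t) md)).
    split; first by apply: He; apply: Hd'; rewrite gtr0_norm; lra.
    move: ks; rewrite (kobE fin Ggt Ggs) lee_fin => ks.
    apply: le_trans (kd_triangle oG fin Gx Ggt Ggs) _; apply: le_trans (lerD kt ks) _.
    rewrite -mulrA -mulrDr; apply: ler_wpM2l; first exact: ltW.
    have s1 : 0 < 1 - s by move: z1; rewrite -/r; lra.
    (* Concavity of ln: (s - t) / (1 - t) is at most the increment of -ln (1 - t). *)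
    have := @le_ln1Dx R ((1 - s) / (1 - t) - 1); rewrite addrCA subrr addr0.
    rewrite ln_div ?posrE // => H; have {}H : ln (1 - s) - ln (1 - t) <= (1 - s) / (1 - t) - 1.
      by apply: H; rewrite ltrDr divr_gt0.
    have -> : (1 - t)^-1 * (s - t) = 1 - (1 - s) / (1 - t) by field; rewrite lt0r_neq0.
    lra.
  - move=> t t0 tr Hs; have [_ Dgt] := Df t (ltW t0) tr.
    have cWt : closure W (g t).
      apply/closure_nmP => e e0; have [d d0 Hd] := cg t (ltW t0) tr e e0.
      have [s [s0 st sd]] := left_near t0 d0.
      by exists (g s); [have [] := Hs s s0 st|exact: Hd].
    have Ggt : G (g t) by exact: WG.
    have kt : kd x (g t) <= L * (- ln (1 - t)).
      apply/ler_addgt0Pr => e e0; have [d d0 [dG dk]] := kd_continuous oG fin Ggt e0.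
      have [d' d'0 Hd'] := cg t (ltW t0) tr d d0.
      have [s [s0 st sd]] := left_near t0 d'0.
      have gs : nm (g s - g t) < d by exact: Hd'.
      have [_ ks] := Hs s s0 st; have := dk _ gs; rewrite (kd_sym oG) => kst.
      apply: le_trans (kd_triangle oG fin Gx (dG _ gs) Ggt) _; apply: lerD (ltW kst).
      apply: le_trans ks _; apply: ler_wpM2l; first exact: ltW.
      by rewrite lerN2 ler_ln ?posrE; move: z1; rewrite -/r; lra.
    split => //; apply: contrapT => nW.
    have := HC0 _ _ Ex Gx Ggt nW; have := lnr t tr; have := ler_norm C0; rewrite -/x.
    lra.
have [Wr _] := stay; rewrite zE; apply: WG; last exact: subset_closure.
by have [] := Df r (ltW r0) (lexx r).
Qed.

(** By [royden_log] discs centred at x stay in G up to radius 1 - e with e = exp (-(h x - c) / L).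
    Royden's localization gives the factor 1 / (1 - e) <= 1 + 2 e, and e <= K^2 / (1 + h x)^2. *)
Lemma royden_fine : exists C M : R, [/\ 0 <= C, 0 <= M & forall x v, D x -> E x -> M < h x ->
  (kobayashi_royden G x v <= (1 + C / (1 + h x) ^+ 2)%:E * kobayashi_royden D x v)%E].
Proof.
have [L [c [L0 c0 H]]] := royden_log.
pose K := 1 + c + 2 * L; have K1 : 1 <= K by rewrite /K; lra.
exists (2 * K ^+ 2), (2 * K); split; [by rewrite mulr_ge0 // sqr_ge0|lra|].
move=> x v Dx Ex hx; set b := h x - c.
have b0 : 0 < b by rewrite /b; move: hx; rewrite /K; lra.
pose e := expR (- (b / L)).
have e0 : 0 < e by exact: expR_gt0.
have h1 : 0 < 1 + h x by lra.
have eK : e <= K ^+ 2 / (1 + h x) ^+ 2.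
  have y0 : 0 < 1 + b / (2 * L) by rewrite ltr_wpDr // divr_ge0 // ltW // mulr_gt0.
  have hK : 1 + h x <= K * (1 + b / (2 * L)).
    have -> : 1 + h x = (1 + c) + b by rewrite /b; lra.
    have -> : K * (1 + b / (2 * L)) = K + K / (2 * L) * b by ring.
    have : b <= K / (2 * L) * b.
      by rewrite ler_peMl ?(ltW b0) // ler_pdivlMr ?mulr_gt0 // /K; lra.
    by rewrite /K; lra.
  rewrite ler_pdivlMr ?exprn_gt0 //.
  apply: (@le_trans _ _ (e * (K * (1 + b / (2 * L))) ^+ 2)).
    apply: ler_wpM2l; first exact: ltW.
    by apply: lerXn2r; rewrite ?nnegrE //; [lra|apply: mulr_ge0; lra].
  rewrite exprMn mulrCA ler_piMr ?sqr_ge0 //.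
  have -> : e = (expR (b / (2 * L)) ^+ 2)^-1.
    by rewrite -expRM_natl -expRN; congr expR; field; rewrite lt0r_neq0.
  rewrite mulrC ler_pdivrMr ?exprn_gt0 ?expR_gt0 // mul1r.
  by apply: lerXn2r; rewrite ?nnegrE ?(ltW y0) ?expR_ge0 // expR_ge1Dx.
have e4 : e <= 4^-1.
  apply: le_trans eK _; rewrite ler_pdivrMr ?exprn_gt0 // -ler_pdivrMl ?invr_gt0 // invrK.
  have -> : 4 * K ^+ 2 = (2 * K) ^+ 2 by ring.
  by apply: lerXn2r; rewrite ?nnegrE; lra.
have rho0 : 0 < 1 - e by lra.
apply: le_trans (_ : _ <= (1 - e)^-1%:E * kobayashi_royden D x v)%E _.
  apply: kr_royden; [exact: rho0|lra|].
  move=> f Hf f0 z zr; apply: H; [exact: Hf|by rewrite f0|lra|].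
  rewrite f0 -/b -ltr_pdivlMl // mulrC ltrNl -ltr_expR lnK ?posrE; last by lra.
  by rewrite -/e; lra.
apply: lee_wpmul2r; first exact: kr_ge0.
rewrite lee_fin; apply: (@le_trans _ _ (1 + 2 * e)).
  by rewrite -[X in X <= _]mul1r ler_pdivrMr //; nra.
by rewrite lerD2l -mulrA ler_wpM2l.
Qed.

End RoydenComparison.

(** * Localization of the Kobayashi distance *)

Section Chain.
Context {R : realType}.

(* The function c / (1 + u)^2 has integral c on [0, +oo); the factor 2 absorbs its
   variation on steps where F increases by at most 1. *)
Lemma chain_bound (k : R -> R -> R) (F : R -> R) (a0 b0 c : R) : a0 <= b0 -> 0 <= c ->
  {within `[a0, b0], continuous F} ->
  (forall a b, a0 <= a -> a <= b -> b <= b0 -> F a <= F b) ->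
  (forall a b e, a0 <= a -> a <= b -> b <= e -> e <= b0 -> k a e <= k a b + k b e) ->
  (forall a b, a0 <= a -> a <= b -> b <= b0 ->
     k a b <= (1 + c / (1 + (F a - F a0)) ^+ 2) * (F b - F a)) ->
  k a0 b0 <= F b0 - F a0 + 2 * c.
Proof.
move=> ab0 c0 cF mF tri loc.
pose w t := 1 + (F t - F a0).
have w1 t : a0 <= t -> t <= b0 -> 1 <= w t.
  by move=> at_ tb; have := mF a0 t (lexx _) at_ tb; rewrite /w; lra.
(* S a - S b = 2 c (w b - w a) / (w a w b) telescopes, and it dominates c (F b - F a) / (w a)^2 as
   soon as w b <= 2 w a. *)
pose S t := 2 * c / w t.
have short a b : a0 <= a -> a <= b -> b <= b0 -> F b - F a <= 1 ->
    k a b <= F b - F a + S a - S b.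
  move=> ha hab hb Fab; apply: le_trans (loc a b ha hab hb) _; rewrite -/(w a).
  have wa := w1 a ha (le_trans hab hb); have wb := w1 b (le_trans ha hab) hb.
  have wab : w b - w a = F b - F a by rewrite /w; ring.
  have Fab0 := mF a b ha hab hb.
  have -> : F b - F a + S a - S b = F b - F a + 2 * c / (w a * w b) * (F b - F a).
    by rewrite /S -wab; field; rewrite !lt0r_neq0 //; lra.
  rewrite mulrDl mul1r lerD2l; apply: ler_wpM2r; first by lra.
  rewrite ler_pdivrMr ?exprn_gt0; [|lra|lra].
  rewrite mulrAC ler_pdivlMr; last by apply: mulr_gt0; lra.
  have -> : c * (w a * w b) = c * w a * w b by ring.
  have -> : 2 * c * w a ^+ 2 = c * w a * (2 * w a) by ring.
  by apply: ler_wpM2l; [apply: mulr_ge0; lra|lra].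
have long (N : nat) : forall a b, a0 <= a -> a <= b -> b <= b0 -> F b - F a <= N%:R ->
    k a b <= F b - F a + S a - S b.
  elim: N => [|N IH] a b ha hab hb FN.
    by apply: short => //; apply: le_trans FN _; rewrite ler01.
  have [F1|F1] := leP (F b - F a) 1; first exact: short.
  have [m mab Fm] : exists2 m, m \in `[a, b] & F m = F a + 1.
    apply: IVT => //; last first.
      by rewrite ge_min le_max; apply/andP; split; apply/orP; [left|right]; lra.
    apply: continuous_subspaceW cF => t /=; rewrite !in_itv /= => /andP[ta tb].
    by apply/andP; split; [exact: le_trans ta|exact: le_trans hb].
  move: mab; rewrite in_itv /= => /andP[am mb].
  apply: le_trans (tri a m b ha am mb hb) _.
  have h1 : k a m <= F m - F a + S a - S m.
    by apply: short => //; [exact: le_trans mb hb|lra].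
  have h2 : k m b <= F b - F m + S m - S b.
    by apply: IH => //; [exact: le_trans am|move: FN; rewrite -natr1; lra].
  lra.
have Fab := mF a0 b0 (lexx _) ab0 (lexx _).
have Fab0 : 0 <= F b0 - F a0 by lra.
have := long _ a0 b0 (lexx _) ab0 (lexx _) (ltW (archi_boundP Fab0)).
have : S a0 = 2 * c by rewrite /S /w subrr addr0 divr1.
have : 0 <= S b0.
  by rewrite /S divr_ge0 ?mulr_ge0 //; have := w1 b0 ab0 (lexx _); lra.
lra.
Qed.

End Chain.

Section ParamCurves.
Context {R : realType} {n : nat}.
Local Notation Cn := 'rV[cplx R]_n.
Implicit Types (D G : set Cn) (x y : Cn) (g : R -> Cn) (F : R -> R).

Lemma kob_subset D G x y : open D -> open G -> G `<=` D ->
  (kobayashi D x y <= kobayashi G x y)%E.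
Proof.
move=> oD oG GD; apply: ereal_le_lt => b /(kob_param oG)[g [F [[[g0 g1] _ gG [F0 _] H] Fb]]].
have := H D 1 0 1 (lexx 0) ler01 (lexx 1) oD ler01; rewrite g0 g1 F0 subr0 mul1r.
move=> /(_ _)/wrap[u u01|/le_trans]; last by apply; rewrite lee_fin ltW // -lte_fin.
have Ggu := gG u u01; split; first exact: GD.
move=> v; rewrite -[X in X%:E]invr1; apply: kr_royden; [exact: ltr01|exact: lexx|].
by move=> f /holomorphic_discP Hf _ z /Hf[_ /GD].
Qed.

Lemma param_rev D x y g F : open D -> param_curve D x y g F ->
  param_curve D y x (fun t => g (1 - t)) (fun t => F 1 - F (1 - t)).
Proof.
move=> oD [[g0 g1] gc gD [F0 Fc] H].
have rev t : t \in `[0, 1] -> 1 - t \in `[0, 1 : R] by rewrite !in_itv /=; lra.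
split.
- by rewrite subr0 subrr.
- apply/continuous_itv_nmP => t t01 e e0.
  have /continuous_itv_nmP/(_ _ (rev t t01) e e0)[r r0 Hr] := gc.
  exists r => // s s01 st; apply: Hr; first exact: rev.
  by rewrite opprB addrC addrA subrK distrC.
- by move=> t /rev; exact: gD.
- split; first by rewrite subr0 subrr.
  apply/continuous_itv_normP => t t01 e e0.
  have /continuous_itv_normP/(_ _ (rev t t01) e e0)[r r0 Hr] := Fc.
  exists r => // s s01 st; have -> : F 1 - F (1 - s) - (F 1 - F (1 - t)) =
    - (F (1 - s) - F (1 - t)) by ring.
  rewrite normrN; apply: Hr; first exact: rev.
  by rewrite opprB addrC addrA subrK distrC.
- move=> G L s t s0 st t1 oG L0 Hu.
  have -> : F 1 - F (1 - t) - (F 1 - F (1 - s)) = F (1 - s) - F (1 - t) by ring.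
  rewrite kob_sym //; apply: H => //; [by lra|by lra|by lra|].
  move=> u ust; have := Hu (1 - u); rewrite opprB addrCA subrr addr0; apply.
  by move: ust; rewrite !in_itv /=; lra.
Qed.

Lemma param_kob_le D x y g F s t : open D -> param_curve D x y g F ->
  0 <= s -> s <= t -> t <= 1 -> (kobayashi D (g s) (g t) <= (F t - F s)%:E)%E.
Proof.
move=> oD [_ _ gD _ H] s0 st t1; have := H D 1 s t s0 st t1 oD ler01; rewrite mul1r; apply.
move=> u ust; split; first by apply: gD; move: ust; rewrite !in_itv /=; lra.
by move=> v; rewrite mul1e.
Qed.

Lemma param_mono D x y g F s t : open D -> param_curve D x y g F ->
  0 <= s -> s <= t -> t <= 1 -> F s <= F t.
Proof.
move=> oD gF s0 st t1; rewrite -subr_ge0 -lee_fin.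
exact: le_trans (kob_ge0 _ _ _) (param_kob_le oD gF s0 st t1).
Qed.

End ParamCurves.

Section Localization.
Context {R : realType} {n : nat}.
Local Notation Cn := 'rV[cplx R]_n.
Variables (D U : set Cn).
Local Notation G := (D `&` U).
Hypotheses (oD : open D) (oU : open U) (convG : convexC G).
Variable o : Cn.
Hypothesis Go : G o.
Implicit Types (x y z v : Cn) (g : R -> Cn) (F : R -> R).

Let oG : open G. Proof. exact: openI. Qed.

Let fin x y : G x -> G y -> (kobayashi G x y < +oo)%E.
Proof. exact: (convex_kob_lty oG convG). Qed.

Local Notation kd := (kd G).
Local Notation h x := (kd x o).

Let tri y x z : G x -> G y -> G z -> kd x z <= kd x y + kd y z.
Proof. exact: (kd_triangle oG fin). Qed.

Let h_lip x y : G x -> G y -> `|h x - h y| <= kd x y.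
Proof.
move=> Gx Gy; have h1 := tri Gx Gy Go; have h2 := tri Gy Gx Go.
by rewrite ler_norml; apply/andP; split; rewrite (kd_sym oG y x) in h2; lra.
Qed.

Let h_continuous x (e : R) : G x -> 0 < e -> exists2 d : R, 0 < d &
  forall y, nm (y - x) < d -> G y /\ `|h y - h x| < e.
Proof.
move=> Gx e0; have [d d0 [dG dk]] := kd_continuous oG fin Gx e0.
exists d => // y yd; split; first exact: dG.
rewrite distrC; apply: le_lt_trans (h_lip Gx (dG y yd)) _; exact: dk.
Qed.

(** Lengths are for D but are compared with the distance of G, for which h is defined. *)
Definition near_minimal g F := forall s t, 0 <= s -> s <= t -> t <= 1 ->
  G (g s) -> G (g t) -> F t - F s <= kd (g s) (g t) + 1.

(** An arc cannot exceed the distance of its endpoints by more than 1, or a shortcut would make the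
    whole curve too long; the defect does not grow under restriction. *)
Lemma param_near_minimal x y g F : param_curve D x y g F ->
  ((F 1)%:E < kobayashi D x y + 1%:E)%E -> near_minimal g F.
Proof.
move=> gF F1 s t s0 st t1 Gs Gt; have [[g0 g1] _ _ [F0 _] _] := gF.
rewrite -lee_fin.
have k1 := param_kob_le oD gF (lexx 0) s0 (le_trans st t1).
have k2 : (kobayashi D (g s) (g t) <= (kd (g s) (g t))%:E)%E.
  by rewrite -(kobE fin Gs Gt); apply: kob_subset => // z [].
have k3 := param_kob_le oD gF (le_trans s0 st) t1 (lexx 1).
rewrite g0 F0 subr0 in k1; rewrite g1 in k3.
have := le_trans (kob_triangle (g s) x y oD) (leeD k1 (kob_triangle (g t) (g s) y oD)).
move=> /le_trans/(_ (leeD (lexx _) (leeD k2 k3))); rewrite -!EFinD => k.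
have := lt_le_trans F1 (leeD k (lexx 1%:E)); rewrite -EFinD lte_fin lee_fin.
lra.
Qed.

Lemma near_minimal_rev g F : near_minimal g F ->
  near_minimal (fun t => g (1 - t)) (fun t => F 1 - F (1 - t)).
Proof.
move=> H s t s0 st t1 Gs Gt; have := H (1 - t) (1 - s).
rewrite (kd_sym oG); have -> : F 1 - F (1 - t) - (F 1 - F (1 - s)) = F (1 - s) - F (1 - t).
  by ring.
by apply => //; lra.
Qed.

Variables E W1 : set Cn.
Hypotheses (oW1 : open W1) (EW1 : E `<=` W1) (W1U : closure W1 `<=` U).
Variables (C M : R).
Hypotheses (C_ge0 : 0 <= C) (M_ge0 : 0 <= M).
Hypothesis fine_bound : forall x v, D x -> closure W1 x -> M < h x ->
  (kobayashi_royden G x v <= (1 + C / (1 + h x) ^+ 2)%:E * kobayashi_royden D x v)%E.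

Let A := [set x | [/\ D x, W1 x & M < h x]].

Let AG x : A x -> G x.
Proof. by move=> [Dx W1x _]; split => //; apply: W1U; exact: subset_closure. Qed.

Let oA : open A.
Proof.
apply/open_nmP => x Ax; have Gx := AG Ax; have [Dx Wx Mx] := Ax.
have /open_nmP/(_ x Wx)[d1 d10 H1] := oW1.
have hM : 0 < h x - M by rewrite subr_gt0.
have [d2 d20 H2] := h_continuous Gx hM.
have [d [d0 dd1 dd2]] := pos_min d10 d20.
exists d => // y yd; have [[Dy _] hy] := H2 y (lt_le_trans yd dd2); split => //.
  exact: H1 (lt_le_trans yd dd1).
by move: hy; rewrite ltr_norml => /andP[]; lra.
Qed.

Section Segment.
Variables (x y : Cn) (g : R -> Cn) (F : R -> R).
Hypotheses (gF : param_curve D x y g F) (gmin : near_minimal g F).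

Let hg_continuous (s t : R) : 0 <= s -> t <= 1 -> (forall u, u \in `[s, t] -> G (g u)) ->
  {within `[s, t], continuous (fun u => h (g u))}.
Proof.
move=> s0 t1 GA; apply/continuous_itv_normP => u ust e e0.
have [d d0 Hd] := h_continuous (GA u ust) e0.
have u01 : u \in `[0, 1] by move: ust; rewrite !in_itv /=; lra.
have [_ /continuous_itv_nmP/(_ u u01 d d0)[r r0 Hr] _ _ _] := gF.
exists r => // w wst wu; have [] // := Hd (g w).
by apply: Hr => //; move: wst; rewrite !in_itv /=; lra.
Qed.

Let Fcont s t : 0 <= s -> t <= 1 -> {within `[s, t], continuous F}.
Proof.
move=> s0 t1; have [_ _ _ [_ Fc] _] := gF.
by apply: continuous_subspaceW Fc => u /=; rewrite !in_itv /=; lra.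
Qed.

(** At u the length from t0 is at most kd (g t0) (g u) + 1 <= h (g t0) + h (g u) + 1 <= 2 h (g u) +
    1, as h is minimal at t0. So 1 + m <= 2 (1 + h), whence the 4. *)
Let local_bound_at (s t t0 a b m : R) : 0 <= s -> t <= 1 ->
  (forall u, u \in `[s, t] -> A (g u)) -> t0 \in `[s, t] ->
  (forall u, u \in `[s, t] -> h (g t0) <= h (g u)) ->
  s <= a -> a <= b -> b <= t -> 0 <= m ->
  (forall u, u \in `[a, b] -> m <= `|F u - F t0|) ->
  kd (g a) (g b) <= (1 + 4 * C / (1 + m) ^+ 2) * (F b - F a).
Proof.
move=> s0 t1 gA t0st hmin sa ab bt m0 Hm.
have sub u : u \in `[a, b] -> u \in `[s, t] by rewrite !in_itv /=; lra.
have Gg u : u \in `[s, t] -> G (g u) by move=> /gA/AG.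
have aab : a \in `[a, b] by rewrite in_itv /= lexx.
have bab : b \in `[a, b] by rewrite in_itv /= lexx ab.
rewrite -lee_fin -(kobE fin (Gg a (sub a aab)) (Gg b (sub b bab))).
have m1 : 0 < 1 + m by lra.
have [_ _ _ _ H] := gF; apply: H => //; [by lra|by lra| |].
  by rewrite addr_ge0 // divr_ge0 ?sqr_ge0 // mulr_ge0.
move=> u uab; have ust := sub u uab; split; first exact: Gg.
have [Du W1u Mu] := gA u ust.
move=> v; apply: le_trans (fine_bound v Du (subset_closure W1u) Mu) _.
apply: lee_wpmul2r; first exact: kr_ge0.
rewrite lee_fin lerD2l.
have hu0 := kd_ge0 G (g u) o.
have mh : m <= 2 * h (g u) + 1.
  apply: le_trans (Hm u uab) _.
  have k0 : kd (g t0) (g u) <= h (g t0) + h (g u).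
    by have := tri (Gg t0 t0st) Go (Gg u ust); rewrite (kd_sym oG o (g u)).
  have := hmin u ust; move: t0st ust; rewrite !in_itv /= => /andP[h1 h2] /andP[h3 h4] hm.
  have [ut|ut] := leP u t0.
    have Fut : F u <= F t0 by apply: (param_mono oD gF) => //; lra.
    rewrite ler0_norm; last by lra.
    have := gmin (le_trans s0 h3) ut (le_trans h2 t1) (Gg u _) (Gg t0 _).
    rewrite !in_itv /= h1 h2 h3 h4 => /(_ isT isT); rewrite (kd_sym oG (g u)).
    by lra.
  have Fut : F t0 <= F u by apply: (param_mono oD gF) => //; lra.
  rewrite ger0_norm; last by lra.
  have := gmin (le_trans s0 h1) (ltW ut) (le_trans h4 t1) (Gg t0 _) (Gg u _).
  by rewrite !in_itv /= h1 h2 h3 h4 => /(_ isT isT); lra.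
have hu1 : 0 < 1 + h (g u) by lra.
rewrite ler_pdivrMr ?exprn_gt0 // mulrAC ler_pdivlMr ?exprn_gt0 //.
have -> : 4 * C * (1 + h (g u)) ^+ 2 = C * (2 * (1 + h (g u))) ^+ 2 by ring.
apply: ler_wpM2l => //; apply: lerXn2r; rewrite ?nnegrE; lra.
Qed.

(** The arc is cut where h is minimal; [chain_bound] with 4 C costs 8 C on each side. *)
Lemma segment_bound s t : 0 <= s -> s <= t -> t <= 1 ->
  (forall u, u \in `[s, t] -> A (g u)) -> kd (g s) (g t) <= F t - F s + 16 * C.
Proof.
move=> s0 st t1 gA; have Gg u : u \in `[s, t] -> G (g u) by move=> /gA/AG.
have [t0 t0st hmin] := EVT_min st (hg_continuous s0 t1 Gg).
have [st0 t0t] : s <= t0 /\ t0 <= t by move: t0st; rewrite in_itv /= => /andP.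
have loc := local_bound_at s0 t1 gA t0st hmin.
have C4 : 0 <= 4 * C by rewrite mulr_ge0.
have right : kd (g t0) (g t) <= F t - F t0 + 2 * (4 * C).
  apply: (@chain_bound R (fun a b => kd (g a) (g b)) F t0 t (4 * C) t0t C4).
  - by apply: Fcont => //; exact: le_trans st0.
  - by move=> a b ha hab hb; apply: (param_mono oD gF) => //; lra.
  - by move=> a b e ha hab hbe he; apply: tri; apply: Gg; rewrite in_itv /=; lra.
  - move=> a b ha hab hb; have Fa : F t0 <= F a by apply: (param_mono oD gF) => //; lra.
    apply: loc => //; [lra|lra|].
    move=> u; rewrite in_itv /= => /andP[au ub].
    have Fu : F a <= F u by apply: (param_mono oD gF) => //; lra.
    by rewrite ger0_norm; lra.
have left : kd (g s) (g t0) <= F t0 - F s + 2 * (4 * C).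
  (* Time is reversed so that the chain again starts at t0. *)
  have := @chain_bound R (fun a b => kd (g (- b)) (g (- a))) (fun a => - F (- a))
    (- t0) (- s) (4 * C) _ C4 _ _ _ _; rewrite !opprK => H.
  have -> : F t0 - F s = - F s + F t0 by rewrite addrC.
  apply: H.
  - by rewrite lerN2.
  - apply/continuous_itv_normP => u; rewrite in_itv /= => u01 e e0.
    have cF := Fcont s0 (le_trans t0t t1).
    have nu : - u \in `[s, t0] by rewrite in_itv /=; lra.
    have /continuous_itv_normP/(_ _ nu e e0)[r r0 Hr] := cF.
    exists r => // w; rewrite in_itv /= => w01 wu.
    rewrite -opprD normrN; apply: Hr; first by rewrite in_itv /=; lra.
    by rewrite -opprD normrN.
  - by move=> a b ha hab hb; rewrite lerN2; apply: (param_mono oD gF); lra.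
  - move=> a b e ha hab hbe he; rewrite addrC.
    by apply: tri; apply: Gg; rewrite in_itv /=; lra.
  - move=> a b ha hab hb.
    have Fa : F (- a) <= F t0 by apply: (param_mono oD gF); lra.
    have -> : - F (- b) - - F (- a) = F (- a) - F (- b) by ring.
    apply: loc; [lra|lra|lra|lra|].
    move=> u; rewrite in_itv /= => /andP[au ub].
    have Fu : F u <= F (- a) by apply: (param_mono oD gF); lra.
    by rewrite ler0_norm; lra.
have := tri (Gg s _) (Gg t0 t0st) (Gg t _); rewrite !in_itv /= !lexx st => /(_ isT isT).
lra.
Qed.

Variable C0 : R.
Hypothesis escape : forall x y, E x -> G x -> G y -> ~ W1 y -> h x <= kd x y + C0.

(** Up to the first exit from A the previous bound applies, and passes to the limit. At the exit
    either W1 is left, and [escape] bounds h x, or h <= M, and the triangle inequality does. *)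
Lemma exit_bound : E x -> D x -> (exists2 u, u \in `[0, 1] & ~ A (g u)) ->
  exists t1, [/\ t1 \in `[0, 1], ~ A (g t1), forall s, 0 <= s -> s < t1 -> A (g s) &
    h x <= F t1 + (16 * C + `|C0| + M)].
Proof.
move=> Ex Dx [u u01 Au]; have [[g0 g1] gc gD [F0 Fc] _] := gF.
have C16 : 0 <= 16 * C by rewrite mulr_ge0.
have n0 := normr_ge0 C0; have nC := ler_norm C0; have M0 := M_ge0.
have Gx : G x by split => //; apply: W1U; apply: subset_closure; exact: EW1.
have [A0|A0] := pselect (A (g 0)); last first.
  exists 0; split; [by rewrite in_itv /= lexx ler01|exact: A0|by move=> s s0; rewrite ltNge s0|].
  rewrite F0 add0r; have [hx|hx] := leP (h x) M; first by lra.
  by case: A0; rewrite g0; split => //; exact: EW1.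
move: (u01); rewrite in_itv /= => /andP[u0 u1].
have gcu : {within `[0, u], continuous g}.
  by apply: continuous_subspaceW gc => t /=; rewrite !in_itv /=; lra.
have [t1 [t10 t1u As At cAt]] := first_exit oA gcu u0 A0 Au.
have t101 : t1 \in `[0, 1] by rewrite in_itv /=; lra.
exists t1; split => //.
have Dt := gD t1 t101.
have cW1t : closure W1 (g t1) by apply: closureS cAt => z [].
have Gt : G (g t1) by split => //; exact: W1U.
have kt : kd x (g t1) <= F t1 + 16 * C.
  apply/ler_addgt0Pr => e e0; have [d d0 [dG dk]] := kd_continuous oG fin Gt e0.
  have /continuous_itv_nmP/(_ _ t101 d d0)[r r0 Hr] := gc.
  have [s [s0 st sd]] := left_near t10 r0.
  have gs : nm (g s - g t1) < d by apply: Hr => //; rewrite in_itv /=; lra.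
  have := dk _ gs; rewrite (kd_sym oG) => kst.
  have s1 : s <= 1 by lra.
  have := @segment_bound 0 s (lexx 0) s0 s1; rewrite g0 F0 subr0 => ks.
  have {}ks : kd x (g s) <= F s + 16 * C.
    apply: ks => w; rewrite in_itv /= => /andP[w0 ws]; apply: As => //; lra.
  have Fs : F s <= F t1 by apply: (param_mono oD gF); lra.
  have := tri Gx (dG _ gs) Gt; lra.
have [Wt|Wt] := pselect (W1 (g t1)); last by have := escape Ex Gx Gt Wt; lra.
have hM : h (g t1) <= M.
  by rewrite leNgt; apply/negP => Mt; apply: At; split.
have := tri Gx Gt Go; lra.
Qed.

End Segment.

Variable C0 : R.
Hypothesis escape : forall x y, E x -> G x -> G y -> ~ W1 y -> h x <= kd x y + C0.

(** If the curve leaves A, it is cut at its first exit and, reversed, at its last one. Each end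
    bounds h at its endpoint by its own length, and kd z w <= h z + h w; the middle part is
    discarded. *)
Lemma kob_localization z w : E z -> D z -> E w -> D w ->
  (kobayashi G z w <= kobayashi D z w + (2 * (16 * C + `|C0| + M) + 1)%:E)%E.
Proof.
move=> Ez Dz Ew Dw; set X := 16 * C + `|C0| + M.
have C16 : 0 <= 16 * C by rewrite mulr_ge0.
have X0 : 16 * C <= X by rewrite /X; have := normr_ge0 C0; have := M_ge0; lra.
have GE x : E x -> D x -> G x.
  by move=> Ex Dx; split => //; apply: W1U; apply: subset_closure; exact: EW1.
have Gz := GE z Ez Dz; have Gw := GE w Ew Dw.
have kfin : kobayashi D z w \is a fin_num.
  rewrite ge0_fin_numE ?kob_ge0 //; apply: le_lt_trans (fin Gz Gw).
  by apply: kob_subset => // x [].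
have [|g [F [gF F1]]] := @kob_param R n D z w (kobayashi D z w + 1%:E)%E oD.
  by rewrite lteDl // lte_fin.
have gmin := param_near_minimal gF F1.
suff kF : kd z w <= F 1 + 2 * X.
  rewrite (kobE fin Gz Gw); apply: (@le_trans _ _ ((F 1)%:E + (2 * X)%:E)%E).
    by rewrite -EFinD lee_fin.
  have -> : (2 * X + 1)%:E = (1%:E + (2 * X)%:E)%E by rewrite -EFinD addrC.
  by rewrite addeA leeD2r // ltW.
have [[g0 g1] _ _ [F0 _] _] := gF.
have [gA|gA] := pselect (forall u, u \in `[0, 1] -> A (g u)).
  by have := segment_bound gF gmin (lexx 0) ler01 (lexx 1) gA; rewrite g0 g1 F0; lra.
have [u u01 Au] : exists2 u, u \in `[0, 1] & ~ A (g u).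
  apply: contrapT => H; apply: gA => u u01; apply: contrapT => Au; apply: H.
  by exists u.
have [t1 [t101 At1 As1 hz]] := exit_bound gF gmin escape Ez Dz (ex_intro2 _ _ u u01 Au).
have Au' : exists2 v, v \in `[0, 1 : R] & ~ A (g (1 - v)).
  exists (1 - u); first by move: u01; rewrite !in_itv /=; lra.
  by rewrite opprB addrCA subrr addr0.
have [t2 [t201 At2 As2 hw]] := exit_bound (param_rev oD gF) (near_minimal_rev gmin) escape Ew Dw Au'.
(* The two end pieces do not overlap, so their lengths add up to at most F 1. *)
have t12 : t1 <= 1 - t2.
  rewrite leNgt; apply/negP => lt; apply: At2; apply: As1 => //.
  by move: t201; rewrite in_itv /=; lra.
have Ft : F t1 <= F (1 - t2).
  apply: (param_mono oD gF) => //; move: t101 t201; rewrite !in_itv /=; lra.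
have := tri Gz Go Gw; rewrite (kd_sym oG o w); rewrite -/X in hz hw; lra.
Qed.

End Localization.

Section Thickening.
Context {R : realType} {n : nat}.
Local Notation Cn := 'rV[cplx R]_n.
Implicit Types (K : set Cn) (e : R).

Definition thick K e : set Cn := [set x | exists2 y, K y & nm (x - y) < e].

Lemma open_thick K e : open (thick K e).
Proof.
apply/open_nmP => x [y Ky xy]; exists (e - nm (x - y)); first by rewrite subr_gt0.
by move=> z zx; exists y => //; have := nm_triangle x z y; lra.
Qed.

Lemma closure_thick K e e' : e < e' -> closure (thick K e) `<=` thick K e'.
Proof.
move=> ee x /closure_nmP H; have e0 : 0 < e' - e by rewrite subr_gt0.
have [z [y Ky zy] zx] := H _ e0; exists y => //.
by have := nm_triangle z x y; rewrite (nmB x z); lra.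
Qed.

Lemma compact_closure_thick K e : compact K -> compact (closure (thick K e)).
Proof.
move=> cK; have [||d d0 Hd] := @compact_unif R _ K (fun d y => nm y <= d^-1) cK.
- move=> a b y b0 ba /le_trans; apply; rewrite lef_pV2 ?posrE //; exact: lt_le_trans b0 ba.
- move=> x Kx; have nx := nm_ge0 x; exists (nm x + 1)^-1; first by rewrite invr_gt0; lra.
  by exists 1 => // y yx; rewrite invrK; have := nmD (y - x) x; rewrite subrK; lra.
apply: (subclosed_compact _ (@compact_nm_ball R n 0 (d^-1 + (e + 1)))).
  exact: closed_closure.
have e1 : e < e + 1 by lra.
move=> x /(closure_thick e1)[y Ky xy] /=; rewrite subr0.
by have := Hd y Ky; have := nmD (x - y) y; rewrite subrK; lra.
Qed.

End Thickening.

Theorem theorem1p4 (R : realType) (n : nat) (D U : set 'rV[cplx R]_n)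
    (p : 'rV[cplx R]_n) :
  is_domain D -> boundary D p ->
  open U -> U p ->
  convexC (D `&` U) -> visibility_property (D `&` U) ->
  forall V : set 'rV[cplx R]_n,
    nbhs p V -> compact (closure V) -> closure V `<=` U ->
    exists2 C : R, 0 < C &
      forall z w : 'rV[cplx R]_n, (D `&` V) z -> (D `&` V) w ->
        (kobayashi (D `&` U) z w <= kobayashi D z w + C%:E)%E.
Proof.
move=> [oD _ _] _ oU _ convG [[[oG _ [b Gb]] sep complete] vis] V _ cV VU.
have [e e0 He] := compact_open_dist cV oU VU.
have thickU a : a < e -> closure (thick (closure V) a) `<=` U.
  by move=> ae x /(closure_thick ae)[y Vy xy]; exact: He Vy xy.
have VT a : 0 < a -> closure V `<=` thick (closure V) a.
  by move=> a0 x Vx; exists x => //; rewrite subrr nm0.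
(* Two margins are spent: the fine estimate on the closure of W1 lets discs run in W, and the
   distance estimate for points of V lets curves run in W1. *)
pose W1 := thick (closure V) (e / 4); pose W := thick (closure V) (e / 2).
have e4 : 0 < e / 4 by rewrite divr_gt0.
have W1W : closure W1 `<=` W by apply: closure_thick; lra.
have WU : closure W `<=` U by apply: thickU; lra.
have oW1 : open W1 by exact: open_thick.
have oW : open W by exact: open_thick.
have cW1 : compact (closure W1) by exact: compact_closure_thick.
have cW : compact (closure W) by exact: compact_closure_thick.
have W1U : closure W1 `<=` U by apply: thickU; lra.
have VW1 : closure V `<=` W1 by exact: VT.
have [C [M [C0 M0 HC]]] :=
  royden_fine oD oU convG sep complete vis Gb cW1 oW W1W cW WU.
have [C1 HC1] := visible_escape oG convG sep complete vis Gb cV oW1 VW1 cW1.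
have K0 : 0 < 2 * (16 * C + `|C1| + M) + 1.
  by rewrite ltr_wpDl // mulr_ge0 // !addr_ge0 // mulr_ge0.
exists (2 * (16 * C + `|C1| + M) + 1); first exact: K0.
move=> z w [Dz Vz] [Dw Vw].
have cVz := subset_closure Vz; have cVw := subset_closure Vw.
exact: (kob_localization oD oU convG Gb oW1 VW1 W1U C0 M0 HC HC1 cVz Dz cVw Dw).
Qed.
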